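(* Let $X$ be a real or complex Banach space, let $T=(T(t))_{t\ge 0}$ be a holomorphic $C_0$-semigroup on $X$ with generator $-A$, and let $\tau>0$. Let $1<p<\infty$. Let $\Phi\colon X\to X$ be linear such that $I-\Phi T(\tau)\colon X\to X$ is bijective. Then the following statements are equivalent. (i) The problem $\mathcal P_\Phi$ satisfies maximal $L^p$-regularity. (ii) $A$ satisfies maximal regularity, $\Phi\,\mathrm{tr}_p\subset \mathrm{tr}_p$ and $(I-\Phi T(\tau))^{-1}\mathrm{tr}_p\subset \mathrm{tr}_p$.
   Context: $D(A)$ carries the graph norm. $\mathrm{MR}_p:=W^{1,p}(0,\tau;X)\cap L^p(0,\tau;D(A))$ and $\mathrm{tr}_p:=\{w(0): w\in \mathrm{MR}_p\}$ is its trace space; since $T$ is holomorphic, $\mathrm{tr}_p=(X,D(A))_{1/p',p}$ with $\frac1p+\frac1{p'}=1$ and $\mathrm{tr}_p=\{x\in X: AT(\cdot)x\in L^p(0,\tau;X)\}$. $A$ satisfies maximal regularity (written $A\in\mathcal{MR}(X)$) if for all $f\in L^p(0,\tau;X)$ the function $(T*f)(t):=\int_0^tT(t-s)f(s)\,ds$ belongs to $W^{1,p}(0,\tau;X)$ (equivalently to $\mathrm{MR}_p$); this property does not depend on $p\in(1,\infty)$ or $\tau\in(0,\infty)$. For $f\in L^p(0,\tau;X)$, a strong $L^p$-solution of $\dot u+Au=f$ is a function $u\in W^{1,p}(0,\tau;X)$ such that $u(t)\in D(A)$ a.e. and $\dot u+Au=f$ a.e. on $(0,\tau)$. The problem $\mathcal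 P_\Phi$ (that is, $\dot u+Au=f$, $u(0)=\Phi u(\tau)$) satisfies maximal $L^p$-regularity if for all $f\in L^p(0,\tau;X)$ there exists a unique strong $L^p$-solution $u$ of $\dot u+Au=f$ satisfying $u(0)=\Phi u(\tau)$. *)

(* Defs.v *)
From HB Require Import structures.
From mathcomp Require Import all_boot all_order all_algebra.
From mathcomp Require Import complex.
From mathcomp Require Import all_classical all_reals all_analysis.

Set Implicit Arguments.
Unset Strict Implicit.
Unset Printing Implicit Defensive.

Import Order.TTheory GRing.Theory Num.Theory.
Import numFieldNormedType.Exports.

Local Open Scope classical_set_scope.
Local Open Scope ring_scope.
Local Open Scope complex_scope.

(** * Scalars *)

Variant scalar_kind := RealScalars | ComplexScalars.

(* A real or complex Banach space is a [completeNormedModType (scalar_field R k)]. *)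
Definition scalar_field (R : realType) (k : scalar_kind) : numFieldType :=
  match k with
  | RealScalars => R
  | ComplexScalars => R[i]
  end.

Definition of_real (R : realType) (k : scalar_kind) : R -> scalar_field R k :=
  match k with
  | RealScalars => fun a => a
  | ComplexScalars => fun a => a%:C
  end.

Definition real_part (R : realType) (k : scalar_kind) : scalar_field R k -> R :=
  match k with
  | RealScalars => fun a => a
  | ComplexScalars => fun a => complex.Re a
  end.

(* Over the complex scalars the library norm takes its values in [R[i]]; it is
   real there, so no information is lost by taking the real part. *)
Definition rnorm (R : realType) (k : scalar_kind)
  (X : normedModType (scalar_field R k)) (x : X) : R := real_part `|x|.

(** * Bochner integration over subsets of the real line *)

Section Bochner.
Variables (R : realType) (k : scalar_kind).
Variable X : completeNormedModType (scalar_field R k).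

Local Notation mu := (@lebesgue_measure R).

Definition simple_fun (s : R -> X) : Prop :=
  finite_set (range s) /\ forall x, measurable (s @^-1` [set x]).

(* Only meaningful for [D] of finite measure. *)
Definition simple_integral (D : set R) (s : R -> X) : X :=
  \sum_(x \in range s) of_real k (fine (mu (D `&` s @^-1` [set x]))) *: x.

(* [s_ n] are simple functions with values in the subspace [V] converging to
   [f] a.e. on [D] for the norm [N] of [V]. *)
Definition simple_approx (V : set X) (N : X -> R) (D : set R) (f : R -> X)
    (s_ : nat -> R -> X) : Prop :=
  (forall n, simple_fun (s_ n) /\ range (s_ n) `<=` V) /\
  {ae mu, forall t, D t -> V (f t) /\ N (f t - s_ n t) @[n --> \oo] --> (0 : R)}.

Definition strongly_measurable (V : set X) (N : X -> R) (D : set R)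
    (f : R -> X) : Prop :=
  exists s_, simple_approx V N D f s_.

Definition is_bochner_integral (D : set R) (f : R -> X) (I : X) : Prop :=
  exists s_, [/\ simple_approx setT (@rnorm R k X) D f s_,
    (\int[mu]_(t in D) (rnorm (f t - s_ n t))%:E)%E @[n --> \oo] --> 0%E &
    simple_integral D (s_ n) @[n --> \oo] --> I].

(* The value is 0 when [f] is not Bochner integrable on [D]. *)
Definition bochner_integral (D : set R) (f : R -> X) : X :=
  xget 0 [set I | is_bochner_integral D f I].

(* [Lp_in V N p D] is the Bochner space L^p(D; (V, N)). Membership does not
   depend on the values of [f] on a null set. *)
Definition Lp_in (V : set X) (N : X -> R) (p : R) (D : set R) : set (R -> X) :=
  [set f | strongly_measurable V N D f /\
           (\int[mu]_(t in D) (N (f t) `^ p)%:E < +oo)%E].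

Definition Lp (p tau : R) : set (R -> X) :=
  Lp_in setT (@rnorm R k X) p `]0, tau[.

(* Elements of W^{1,p}(0,tau;X) are represented by their continuous
   representative on [0,tau], so that u(0) and u(tau) make sense; [v] is the
   derivative. Values outside [0,tau] are irrelevant. *)
Definition W1p_derivative (p tau : R) (u v : R -> X) : Prop :=
  [/\ Lp p tau u, Lp p tau v &
      forall t : R, 0 <= t <= tau -> u t = u 0 + bochner_integral `]0, t[ v].

Definition W1p (p tau : R) : set (R -> X) :=
  [set u | exists v, W1p_derivative p tau u v].

End Bochner.

(** * Semigroups *)

Section Semigroup.
Variables (R : realType) (k : scalar_kind).
Variable X : completeNormedModType (scalar_field R k).

(* Values of [T] at negative times are irrelevant. *)
Definition C0_semigroup (T : R -> {linear X -> X}) : Prop :=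
  [/\ forall t : R, 0 <= t -> continuous (T t),
      forall x, T 0 x = x,
      forall (s t : R) x, 0 <= s -> 0 <= t -> T (s + t) x = T s (T t x) &
      forall x, T t x @[t --> 0^'+] --> x].

(* [B], restricted to [DB], is the generator of [T]. *)
Definition is_generator (T : R -> {linear X -> X}) (DB : set X) (B : X -> X) :
    Prop :=
  let quotient x := fun t : R => of_real k t^-1 *: (T t x - x) in
  (forall x, DB x <-> exists y : X, quotient x t @[t --> 0^'+] --> y) /\
  (forall x, DB x -> quotient x t @[t --> 0^'+] --> B x).

End Semigroup.

Definition cmod (R : realType) (z : R[i]) : R := complex.Re `|z|.

Definition sector (R : realType) (theta : R) : set R[i] :=
  [set z | exists r phi : R,
     [/\ 0 < r, `|phi| < theta & z = (r * cos phi) +i* (r * sin phi)]].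

Section Holomorphic.
(* A complex vector space [V] with scalar multiplication [cs] and norm [N]. *)
Variables (R : realType) (V : zmodType) (cs : R[i] -> V -> V) (N : V -> R).

Definition bounded_operator (L : V -> V) : Prop :=
  [/\ forall x y, L (x + y) = L x + L y,
      forall a x, L (cs a x) = cs a (L x) &
      exists M : R, forall x, N (L x) <= M * N x].

(* Complex differentiability in operator norm. *)
Definition holomorphic_on (U : set R[i]) (S : R[i] -> V -> V) : Prop :=
  forall z, U z -> exists2 L, bounded_operator L &
    forall e : R, 0 < e -> exists2 d : R, 0 < d &
      forall w, U w -> cmod (w - z) < d ->
      forall x, N (S w x - S z x - cs (w - z) (L x)) <= e * cmod (w - z) * N x.

Definition has_holomorphic_extension (T : R -> V -> V) : Prop :=
  exists theta : R, exists S : R[i] -> V -> V,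
    [/\ 0 < theta <= pi / 2,
        forall z, sector theta z -> bounded_operator (S z),
        holomorphic_on (sector theta) S,
        forall t : R, 0 < t -> S t%:C =1 T t &
        forall theta' : R, 0 < theta' < theta -> exists M : R,
          forall z, sector theta' z -> cmod z <= 1 ->
          forall x, N (S z x) <= M * N x].

End Holomorphic.

(* Scalar multiplication of the complexification X + iX, realized on X * X. *)
Definition complexification_scale (R : realType) (X : lmodType R)
    (z : R[i]) (v : X * X) : X * X :=
  let: a +i* b := z in (a *: v.1 - b *: v.2, b *: v.1 + a *: v.2).

(* On a real space, holomorphy refers to the complexified semigroup. The sum
   norm on X + iX is equivalent to every admissible complexification norm,
   and holomorphy only depends on the norm up to equivalence. *)
Definition holomorphic_semigroup (R : realType) (k : scalar_kind) :
    forall X : completeNormedModType (scalar_field R k), (R -> X -> X) -> Prop :=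
  match k with
  | RealScalars => fun X T =>
      @has_holomorphic_extension R (X * X)%type (@complexification_scale R X)
        (fun v => `|v.1| + `|v.2|) (fun t v => (T t v.1, T t v.2))
  | ComplexScalars => fun X T =>
      @has_holomorphic_extension R X (fun z x => z *: x)
        (@rnorm R ComplexScalars X) T
  end.

(** * Maximal regularity *)

Section MaximalRegularity.
Variables (R : realType) (k : scalar_kind).
Variable X : completeNormedModType (scalar_field R k).
Variables (p tau : R) (T : R -> {linear X -> X}) (DA : set X) (A : X -> X).

Definition graph_norm (x : X) : R := rnorm x + rnorm (A x).

Definition MR_space : set (R -> X) :=
  W1p p tau `&` Lp_in DA graph_norm p `]0, tau[.

Definition trace_space : set X := [set w 0 | w in MR_space].

Definition convolution (f : R -> X) (t : R) : X :=
  bochner_integral `]0, t[ (fun s => T (t - s) (f s)).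

(* For the given [p] and [tau]. *)
Definition maximal_regularity : Prop :=
  forall f, Lp p tau f -> W1p p tau (convolution f).

Definition strong_solution (f u : R -> X) : Prop :=
  exists2 v, W1p_derivative p tau u v &
    {ae (@lebesgue_measure R),
      forall t : R, 0 < t < tau -> DA (u t) /\ v t + A (u t) = f t}.

(* Uniqueness is in W^{1,p}(0,tau;X), i.e. up to values outside [0,tau]. *)
Definition problem_maximal_regularity (Phi : X -> X) : Prop :=
  forall f, Lp p tau f ->
    exists u, [/\ strong_solution f u, u 0 = Phi (u tau) &
      forall u', strong_solution f u' -> u' 0 = Phi (u' tau) ->
        forall t : R, 0 <= t <= tau -> u' t = u t].

End MaximalRegularity.

(* Main.v *)
Require Import Defs.
From mathcomp Require Import all_boot all_order all_algebra.
From mathcomp Require Import complex.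
From mathcomp Require Import all_classical all_reals all_analysis.
From mathcomp Require Import measurable_realfun ring lra.

Set Implicit Arguments.
Unset Strict Implicit.
Unset Printing Implicit Defensive.

Import Order.TTheory GRing.Theory Num.Theory.
Import numFieldNormedType.Exports.

Local Open Scope classical_set_scope.
Local Open Scope ring_scope.

(** Strong solutions of [u' + A u = f] satisfy the mild formula
    [u(t) = T(t) u(0) + (T * f)(t)], and the trace space consists of their
    initial values. Write [B = (I - Phi T(tau))^-1].

    If [A] has maximal regularity, the only candidate for the initial value is
    [x0 = B Phi (T * f)(tau)]. Reversing time shows [(T * f)(tau)] to be a
    trace, hence so is [x0] and, by maximal regularity again,
    [T(.) x0 = w - T * f'] for some [w] with [w(0) = x0] is a strong solution.

    Conversely, if the problem is well posed, [T * f] differs from its solution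
    by an orbit of [T], which is smooth on [[tau/2, tau]] by holomorphy; shifting
    [f] by [tau/2] yields regularity on [[0, tau/2]] as well. Every trace is of
    the form [(T * f)(tau)], so [B Phi] preserves the trace space. Since [T(tau)]
    maps [X] into it, so do [B = I + B Phi T(tau)],
    [Phi T(tau) = B Phi T(tau) (I - Phi T(tau))] and finally
    [Phi = (I - Phi T(tau)) B Phi]. *)

(** * Real and complex scalars *)

(** [Phi] is merely linear, so its composites need not be bounded: every argument about [B] is
    algebraic, by applying I - Phi T(tau) and its injectivity, and no limit passes through [B]. The
    trace space is handled as the set of initial values of strong solutions with L^p forcing. This
    set is symmetric in time although the semigroup is not: reversing a solution of u' + A u = f
    only changes the forcing, to the reversed f - 2u'. Hence a trace x is also a final value, x =
    T(tau) y + (T * g)(tau), and the orbit term is itself a convolution at time tau, that of T(s) y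
    / tau.

    The analytic obstacle is that a strong solution lies in D(A) only almost everywhere, so s |->
    T(t-s) u(s) cannot be differentiated pointwise. The mild formula is therefore proved after
    applying T(e) with e > 0, which is then sent to 0. Conversely, that T * f satisfies the equation
    once it is in W^{1,p} is checked at Lebesgue points of vector-valued functions. *)

Section Scalars.
Variables (R : realType) (k : scalar_kind).
Implicit Types a b : R.

Lemma of_realD a b : of_real k (a + b) = of_real k a + of_real k b.
Proof. by case: k => //=; rewrite rmorphD. Qed.

Lemma of_realM a b : of_real k (a * b) = of_real k a * of_real k b.
Proof. by case: k => //=; rewrite rmorphM. Qed.

Lemma of_realN a : of_real k (- a) = - of_real k a.
Proof. by case: k => //=; rewrite rmorphN. Qed.

Lemma of_real0 : of_real k (0 : R) = 0.
Proof. by case: k. Qed.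

Lemma of_real1 : of_real k (1 : R) = 1.
Proof. by case: k. Qed.

Lemma of_real_gt0 a : (0 < of_real k a) = (0 < a).
Proof. by case: k => //=; rewrite ltcR. Qed.

Lemma real_partK (z : scalar_field R k) : 0 <= z -> of_real k (real_part z) = z.
Proof. by case: k z => //= -[x y] /=; rewrite lecE /= => /andP[/eqP -> _]. Qed.

Lemma real_part_ge0 (z : scalar_field R k) : 0 <= z -> 0 <= real_part z.
Proof. by case: k z => //= -[x y] /=; rewrite lecE /= => /andP[]. Qed.

Lemma real_part_le (y z : scalar_field R k) :
  y <= z -> real_part y <= real_part z.
Proof. by case: k y z => //= -[a b] [c d]; rewrite lecE => /andP[]. Qed.

Lemma real_part_lt (y z : scalar_field R k) :
  y < z -> real_part y < real_part z.
Proof. by case: k y z => //= -[a b] [c d]; rewrite ltcE => /andP[]. Qed.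

Lemma real_partD (y z : scalar_field R k) :
  real_part (y + z) = real_part y + real_part z.
Proof. by case: k y z => //= -[a b] [c d]. Qed.

Lemma of_realK a : real_part (of_real k a) = a.
Proof. by case: k. Qed.

Lemma norm_of_real a : `|of_real k a| = of_real k `|a|.
Proof. by case: k => //=; rewrite normc_def /= expr0n /= addr0 sqrtr_sqr. Qed.

Lemma real_part_ofM a (z : scalar_field R k) :
  real_part (of_real k a * z) = a * real_part z.
Proof. by case: k z => //= -[c d] /=; rewrite mul0r subr0. Qed.

End Scalars.

Section RealNorm.
Variables (R : realType) (k : scalar_kind).
Variable X : normedModType (scalar_field R k).
Implicit Types (x y z : X) (a b : R).

Lemma rnorm_ge0 x : 0 <= rnorm x.
Proof. exact: real_part_ge0. Qed.

Lemma of_real_rnorm x : of_real k (rnorm x) = `|x|.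
Proof. exact: real_partK. Qed.

Lemma rnorm0 : rnorm (0 : X) = 0.
Proof. by rewrite /rnorm normr0 -(@of_real0 R k) of_realK. Qed.

Lemma rnorm0_eq0 x : rnorm x = 0 -> x = 0.
Proof.
by move=> h; apply/eqP; rewrite -normr_eq0 -of_real_rnorm h of_real0.
Qed.

Lemma rnormN x : rnorm (- x) = rnorm x.
Proof. by rewrite /rnorm normrN. Qed.

Lemma rnormB x y : rnorm (x - y) = rnorm (y - x).
Proof. by rewrite -rnormN opprB. Qed.

Lemma rnormD x y : rnorm (x + y) <= rnorm x + rnorm y.
Proof. by rewrite -real_partD; apply: real_part_le; exact: ler_normD. Qed.

Lemma rnorm_triangle y x z : rnorm (x - z) <= rnorm (x - y) + rnorm (y - z).
Proof. by rewrite (le_trans _ (rnormD _ _))// addrA subrK. Qed.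

Lemma rnorm_leB x y : `|rnorm x - rnorm y| <= rnorm (x - y).
Proof.
have := rnormD (x - y) y; have := rnormD (y - x) x.
by rewrite !subrK (rnormB y x) ler_norml => ? ?; apply/andP; split; lra.
Qed.

Lemma rnormZ a x : rnorm (of_real k a *: x) = `|a| * rnorm x.
Proof. by rewrite /rnorm normrZ norm_of_real real_part_ofM. Qed.

(** Radii in the topology of [X] are positive scalars; these are real even in [R[i]], so [of_real]
    and [real_part] translate between them and positive reals. *)
Lemma cvg_rnormP (I : Type) (F : set_system I) {FF : Filter F} (f : I -> X) x :
  f @ F --> x <-> rnorm (f i - x) @[i --> F] --> (0 : R).
Proof.
split=> [/cvgrPdistC_lt h|/cvgr0Pnorm_lt h].
  apply/cvgr0Pnorm_lt => e e0; have e0' : 0 < of_real k e by rewrite of_real_gt0.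
  near=> i; rewrite ger0_norm ?rnorm_ge0// -[e](@of_realK R k).
  by apply: real_part_lt; near: i; exact: h.
apply/cvgrPdistC_lt => e e0; have e0' : 0 < real_part e.
  by rewrite -(@of_real_gt0 R k) real_partK// ltW.
near=> i.
rewrite -of_real_rnorm -(real_partK (ltW e0)) -subr_gt0 -of_realN -of_realD.
rewrite of_real_gt0 subr_gt0 (le_lt_trans (ler_norm _))//.
by near: i; exact: h.
Unshelve. all: by end_near. Qed.

Lemma rnorm_cvg (I : Type) (F : set_system I) {FF : Filter F} (f : I -> X) x :
  f @ F --> x -> rnorm (f i) @[i --> F] --> rnorm x.
Proof.
move=> /cvg_rnormP h; apply/subr_cvg0.
apply: norm_cvg0; apply: (squeeze_cvgr _ (cvg_cst 0) h).
by apply: nearW => i; rewrite normr_ge0 rnorm_leB.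
Qed.

Lemma cvg_of_realZ (I : Type) (F : set_system I) {FF : Filter F}
    (r : I -> R) (f : I -> X) a x :
  r @ F --> a -> f @ F --> x -> of_real k (r i) *: f i @[i --> F] --> of_real k a *: x.
Proof.
move=> ra fx; apply: cvgZ => //.
apply/cvgrPdistC_lt => e e0; have e0' : 0 < real_part e.
  by rewrite -(@of_real_gt0 R k) real_partK// ltW.
near=> i; rewrite -of_realN -of_realD norm_of_real -(real_partK (ltW e0)).
rewrite -subr_gt0 -of_realN -of_realD of_real_gt0 subr_gt0.
by near: i; move: ra => /cvgrPdistC_lt; apply.
Unshelve. all: by end_near. Qed.

End RealNorm.

Lemma rnorm_cauchy_cvg (R : realType) (k : scalar_kind)
    (X : completeNormedModType (scalar_field R k)) (u : nat -> X) :
  (forall e : R, 0 < e -> exists N, forall m n, (N <= m)%N -> (N <= n)%N ->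
     rnorm (u m - u n) < e) -> exists x : X, u @ \oo --> x.
Proof.
move=> h; suff : cvg (u @ \oo) by move=> /cvg_ex.
apply/cauchy_cvgP/cauchy_ballP => e e0.
have e0' : 0 < real_part e by rewrite -(@of_real_gt0 R k) real_partK// ltW.
have [N hN] := h _ e0'.
exists (u @` [set n | (N <= n)%N], u @` [set n | (N <= n)%N]).
  by split; exists N => // n /= Nn; exists n.
move=> [_ _] [[m /= Nm <-] [n /= Nn <-]]; rewrite -ball_normE /= -of_real_rnorm.
rewrite -(real_partK (ltW e0)) -subr_gt0 -of_realN -of_realD of_real_gt0.
by rewrite subr_gt0 hN.
Qed.

(** * Strongly measurable functions *)

Section SimpleMaps.
Variable R : realType.
Implicit Types I J : Type.

(** [simple_fun] with an arbitrary codomain: indices, truth values and tuples of simple functions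
    can be combined first and mapped to [X] afterwards. *)
Definition simple_map I (q : R -> I) : Prop :=
  finite_set (range q) /\ forall i, measurable (q @^-1` [set i]).

Lemma simple_map_preimage I (q : R -> I) (A : set I) :
  simple_map q -> measurable (q @^-1` A).
Proof.
move=> [fq mq].
rewrite (_ : q @^-1` A = \bigcup_(i in range q `&` A) q @^-1` [set i]).
  by apply: fin_bigcup_measurable => //; exact: finite_setIl.
by apply/seteqP; split=> [t At|t [i [_ Ai] /= ->]//]; exists (q t).
Qed.

Lemma simple_map_comp I J (q : R -> I) (c : I -> J) :
  simple_map q -> simple_map (c \o q).
Proof.
move=> sq; split=> [|j]; first by have := finite_image c sq.1; rewrite image_comp.
by rewrite comp_preimage; exact: simple_map_preimage.
Qed.

Lemma simple_map_pair I J (q : R -> I) (r : R -> J) :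
  simple_map q -> simple_map r -> simple_map (fun t => (q t, r t)).
Proof.
move=> [fq mq] [fr mr]; split=> [|[i j]].
  apply: (@sub_finite_set _ _ (range q `*` range r)); last exact: finite_setX.
  by move=> _ [t _ <-]; split; exists t.
rewrite (_ : _ @^-1` _ = q @^-1` [set i] `&` r @^-1` [set j]).
  exact: measurableI.
by apply/seteqP; split=> t /= [-> ->].
Qed.

Lemma simple_map_in (E : set R) : measurable E -> simple_map (fun t => t \in E).
Proof.
move=> mE; split=> [|b]; first exact: finite_finset.
case: b; rewrite /preimage /=.
  by rewrite (_ : [set _ | _] = E)//; apply/seteqP; split=> t; [exact: set_mem|exact: mem_set].
rewrite (_ : [set _ | _] = ~` E); first exact: measurableC.
by apply/seteqP; split=> t /= tE; [move=> /mem_set; rewrite tE|rewrite memNset].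
Qed.

Lemma simple_map_cst I (i : I) : simple_map (fun=> i).
Proof. exact: (simple_map_comp (fun=> i) (simple_map_in (@measurableT _ R))). Qed.

Lemma simple_map_measurable (q : R -> R) : simple_map q -> measurable_fun setT q.
Proof. by move=> sq _ A mA; rewrite setTI; exact: simple_map_preimage. Qed.

(* [q n t] minimizes [d j t] over [j <= n]. *)
Lemma nearest_index (d : nat -> R -> R) :
  (forall j, measurable_fun setT (d j)) -> (forall j t, 0 <= d j t) ->
  (forall t e, 0 < e -> exists j, d j t < e) ->
  exists q : nat -> R -> nat, (forall n, simple_map (q n)) /\
    forall t, d (q n t) t @[n --> \oo] --> (0 : R).
Proof.
move=> md d0 dd.
pose q := fix q n t : nat := if n isn't n'.+1 then 0 else
  if d n t < d (q n' t) t then n else q n' t.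
exists q; split=> [n|t].
  (* The choice at [n.+1] compares with the distance attained by [q n], so measurability of that
     distance is carried through the induction. *)
  suff [] : simple_map (q n) /\ measurable_fun setT (fun t => d (q n t) t) by [].
  elim: n => [|n [sq mq]]; first by split; [exact: simple_map_cst|exact: md].
  pose E := [set t | d n.+1 t < d (q n t) t].
  have mE : measurable E.
    rewrite -[E]setTI; have := measurable_fun_ltr (md n.+1) mq.
    by move=> /(_ measurableT [set true]); apply.
  have EE t : (d n.+1 t < d (q n t) t) = (t \in E).
    by apply/idP/idP; rewrite inE.
  split.
    have -> : q n.+1 = (fun bi => if bi.1 then n.+1 else bi.2) \o
        (fun t => (t \in E, q n t)) by apply/funext => t /=; rewrite EE.
    by apply: simple_map_comp; exact: simple_map_pair (simple_map_in mE) sq.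
  have -> : (fun t => d (q n.+1 t) t) = (d n.+1 \min (fun t => d (q n t) t)).
    by apply/funext => t /=; rewrite /Order.min; case: ifP.
  exact: measurable_minr.
have qmin n j : (j <= n)%N -> d (q n t) t <= d j t.
  elim: n j => [|n IH] j; first by rewrite leqn0 => /eqP ->.
  rewrite leq_eqVlt ltnS => /predU1P[->|jn] /=; case: ltP => //.
    by move=> /ltW /le_trans; apply; exact: IH.
  by move=> _; exact: IH.
apply/cvgr0Pnorm_lt => e e0; have [j je] := dd t e e0.
exists j => // n /= jn; rewrite ger0_norm//.
by apply: le_lt_trans je; exact: qmin.
Qed.

End SimpleMaps.

Section StrongMeasurability.
Variables (R : realType) (k : scalar_kind).
Variable X : completeNormedModType (scalar_field R k).
Implicit Types f g : R -> X.

(** Convergence is required everywhere, without exceptional null set, which makes the notion stable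
    under composition, pasting and limits; [strongly_measurableP] relates it to the almost
    everywhere notion. *)
Definition smeasurable f : Prop :=
  exists s_ : nat -> R -> X, (forall n, simple_fun (s_ n)) /\
    forall t, s_ n t @[n --> \oo] --> f t.

Lemma simple_smeasurable f : simple_fun f -> smeasurable f.
Proof. by move=> sf; exists (fun=> f); split => // t; exact: cvg_cst. Qed.

Lemma smeasurable_cst (x : X) : smeasurable (fun=> x).
Proof. exact/simple_smeasurable/simple_map_cst. Qed.

Lemma smeasurable_dist f (y : X) :
  smeasurable f -> measurable_fun setT (fun t => rnorm (f t - y)).
Proof.
move=> [s_ [ss sf]].
apply: (@measurable_fun_cvg _ _ _ _ (fun n t => rnorm (s_ n t - y))) => [n|t _].
  apply: simple_map_measurable.
  exact: (@simple_map_comp _ _ _ (s_ n) (fun x => rnorm (x - y)) (ss n)).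
by apply: rnorm_cvg; apply: cvgB; [exact: sf|exact: cvg_cst].
Qed.

Lemma smeasurable_rnorm f : smeasurable f -> measurable_fun setT (fun t => rnorm (f t)).
Proof.
move=> /(smeasurable_dist 0); congr measurable_fun.
by apply/funext => t; rewrite subr0.
Qed.

(** Separability of the range, witnessed by a sequence in [X] that need not lie in the range
    itself. *)
Definition near_range (f : R -> X) (y_ : nat -> X) : Prop :=
  forall t (e : R), 0 < e -> exists j, rnorm (f t - y_ j) < e.

Lemma smeasurable_near_range f : smeasurable f -> exists y_, near_range f y_.
Proof.
move=> [s_ [ss sf]].
have /choice[S hS] n : exists l : seq X, range (s_ n) = [set` l].
  by have [/finite_seqP] := ss n.
pose y_ j := let: (n, i) := odflt (0%N, 0%N) (unpickle j) in nth 0 (S n) i.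
exists y_ => t e e0.
have := sf t => /cvg_rnormP/cvgr0Pnorm_lt/(_ _ e0)[n _ /(_ n (leqnn n)) hn].
have : s_ n t \in S n by have : [set` S n] (s_ n t) by rewrite -hS; exists t.
move=> snt; exists (pickle (n, index (s_ n t) (S n))).
by rewrite /y_ pickleK /= nth_index// rnormB (le_lt_trans _ hn)// ler_norm.
Qed.

(** A metric form of Pettis' criterion: the simple approximants pick a nearest point among finitely
    many [y_ j], which involves only the distances to these points. *)
Lemma near_range_smeasurable f (y_ : nat -> X) :
  (forall j, measurable_fun setT (fun t => rnorm (f t - y_ j))) ->
  near_range f y_ -> smeasurable f.
Proof.
move=> md nr.
have [|q [sq qf]] := nearest_index md _ nr; first by move=> *; exact: rnorm_ge0.
exists (fun n => y_ \o q n); split=> [n|t]; first exact: simple_map_comp.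
apply/cvg_rnormP; have := qf t; apply: cvg_trans.
by under eq_fun do rewrite rnormB.
Qed.

(** Pettis' criterion replaces a diagonal argument: the countable families of all [f_ n] together
    approximate the range of the limit, and distances to a fixed point pass to the limit. *)
Lemma smeasurable_lim (f_ : nat -> R -> X) f :
  (forall n, smeasurable (f_ n)) -> (forall t, f_ n t @[n --> \oo] --> f t) ->
  smeasurable f.
Proof.
move=> mf ff.
have /choice[y_ hy] n := smeasurable_near_range (mf n).
pose z j := let: (n, i) := odflt (0%N, 0%N) (unpickle j) in y_ n i.
apply: (@near_range_smeasurable _ z) => [j|t e e0].
  apply: (@measurable_fun_cvg _ _ _ _ (fun n t => rnorm (f_ n t - z j))).
    by move=> n; exact: smeasurable_dist.
  by move=> t _; apply: rnorm_cvg; apply: cvgB; [exact: ff|exact: cvg_cst].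
have e20 : 0 < e / 2 by rewrite divr_gt0.
have := ff t => /cvg_rnormP/cvgr0Pnorm_lt/(_ _ e20)[n _ /(_ n (leqnn n)) hn].
have [i hi] := hy n t _ e20.
exists (pickle (n, i)); rewrite /z pickleK /=.
rewrite (le_lt_trans (rnorm_triangle (f_ n t) _ _))// [e]splitr ltrD//.
by rewrite rnormB (le_lt_trans _ hn)// ler_norm.
Qed.

Lemma smeasurable_comp2 (c : X -> X -> X) f g :
  (forall (u v : nat -> X) a b, u @ \oo --> a -> v @ \oo --> b ->
     c (u n) (v n) @[n --> \oo] --> c a b) ->
  smeasurable f -> smeasurable g -> smeasurable (fun t => c (f t) (g t)).
Proof.
move=> cc [s [ss sf]] [r [sr rg]].
exists (fun n t => c (s n t) (r n t)); split=> [n|t]; last exact: cc.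
exact: (simple_map_comp (fun ab => c ab.1 ab.2) (simple_map_pair (ss n) (sr n))).
Qed.

Lemma smeasurable_comp (c : X -> X) f :
  continuous c -> smeasurable f -> smeasurable (c \o f).
Proof.
move=> cc mf; apply: (@smeasurable_comp2 (fun a _ => c a) f f) => // u v a b ua _.
exact: (cvg_comp _ _ ua (cc a)).
Qed.

Lemma smeasurableD f g :
  smeasurable f -> smeasurable g -> smeasurable (fun t => f t + g t).
Proof. by apply: smeasurable_comp2 => u v a b; exact: cvgD. Qed.

Lemma smeasurableZ (a : R) f :
  smeasurable f -> smeasurable (fun t => of_real k a *: f t).
Proof.
by apply: (@smeasurable_comp (fun x => of_real k a *: x)) => x; exact: scaler_continuous.
Qed.

Lemma smeasurable_if (E : set R) f g : measurable E ->
  smeasurable f -> smeasurable g ->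
  smeasurable (fun t => if t \in E then f t else g t).
Proof.
move=> mE [s [ss sf]] [r [sr rg]].
exists (fun n t => if t \in E then s n t else r n t); split=> [n|t].
  exact: (simple_map_comp (fun bab => if bab.1 then bab.2.1 else bab.2.2)
    (simple_map_pair (simple_map_in mE) (simple_map_pair (ss n) (sr n)))).
by case: ifP.
Qed.

Lemma continuous_smeasurable f : continuous f -> smeasurable f.
Proof.
move=> cf.
pose y_ j := f (ratr (odflt 0 (unpickle j))).
apply: (@near_range_smeasurable _ y_) => [j|t e e0].
  apply: continuous_measurable_fun => t.
  by apply: rnorm_cvg; apply: cvgB; [exact: cf|exact: cvg_cst].
have /cvg_rnormP/cvgr0Pnorm_lt/(_ _ e0) := cf t.
move=> /nbhs_ballP[d /= d0 dB].
have [q] : exists q : rat, ratr q \in `]t, t + d[.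
  by apply: rat_in_itvoo; rewrite ltrDl.
rewrite in_itv /= => /andP[tq qd].
exists (pickle q); rewrite /y_ pickleK /= rnormB.
apply: le_lt_trans (ler_norm _) _; apply: dB.
by rewrite -ball_normE /= ler0_norm; lra.
Qed.

(** Meant for strongly continuous operator families. For simple [f] the result is a finite pasting
    of the orbits [G^~ x]; continuity of each [G t] gives the general case. *)
Lemma smeasurable_apply (G : R -> X -> X) f :
  (forall x, smeasurable (G^~ x)) -> (forall t, continuous (G t)) ->
  smeasurable f -> smeasurable (fun t => G t (f t)).
Proof.
move=> mG cG [s_ [ss sf]].
apply: (@smeasurable_lim (fun n t => G t (s_ n t))) => [n|t]; last first.
  exact: (cvg_comp _ _ (sf t) (cG t (f t))).
have [/finite_seqP[l hl] ms] := ss n.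
pose h (l : seq X) t :=
  foldr (fun x y => if t \in s_ n @^-1` [set x] then G t x else y) 0 l.
have mh : smeasurable (h l).
  elim: l {hl} => [|x l IH]; first exact: smeasurable_cst.
  exact: smeasurable_if.
move: mh; congr smeasurable; apply/funext => t.
have : [set` l] (s_ n t) by rewrite -hl; exists t.
elim: l {hl} => //= x l IH; rewrite inE.
case: ifPn => [/[!inE]/= -> //|]; rewrite notin_setE /= => /eqP/negPf ->.
exact: IH.
Qed.

End StrongMeasurability.

(** * Integrals of simple functions *)

Section LowerIntegral.
Context d (T : measurableType d) (R : realType) (mu : {measure set T -> \bar R}).
Local Open Scope ereal_scope.

Import HBNNSimple.

(* No measurability of the integrands is assumed: for nonnegative functions the
   library integral is the supremum of the integrals of simple minorants. *)
Lemma ge0_ae_le_integral (D : set T) (f g : T -> R) : measurable D ->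
  (forall t, D t -> (0 <= f t)%R) -> (forall t, D t -> (0 <= g t)%R) ->
  {ae mu, forall t, D t -> (f t <= g t)%R} ->
  \int[mu]_(t in D) (f t)%:E <= \int[mu]_(t in D) (g t)%:E.
Proof.
move=> mD f0 g0 [N [mN N0 fgN]].
rewrite integral_mkcond [leRHS]integral_mkcond.
have p0 (h : T -> R) : (forall t, D t -> (0 <= h t)%R) ->
    forall t, 0 <= ((EFin \o h) \_ D) t.
  by move=> h0 t; rewrite patchE; case: ifPn => // /[!inE] /h0; rewrite lee_fin.
rewrite (ge0_integralTE mu (p0 _ f0)) (ge0_integralTE mu (p0 _ g0)).
apply: ge_ereal_sup => _ [h /= hf <-].
(* Set to zero on the null set [N], a simple minorant of [f] becomes one of [g] and keeps its
   integral. *)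
pose h' := proj_nnsfun h (measurableC mN).
apply: (@le_trans _ _ (sintegral mu h')); last first.
  apply: ereal_sup_ubound; exists h' => // t; rewrite /h' /= mindicE.
  have [tN|tN] := boolP (t \in ~` N); last by rewrite mulr0 p0.
  rewrite mulr1 (le_trans (hf t))// !patchE; case: ifPn => // /[!inE] Dt.
  rewrite lee_fin; apply: contrapT => nfg; move: tN; rewrite inE; apply.
  by apply: fgN => /(_ Dt).
rewrite -!integralT_nnsfun.
rewrite (@ge0_ae_eq_integral _ _ _ mu setT (EFin \o h) (EFin \o h'))//.
- exact/measurable_EFinP.
- exact/measurable_EFinP.
- by move=> t _; rewrite /comp lee_fin; exact: fun_ge0.
- by move=> t _; rewrite /comp lee_fin; exact: fun_ge0.
exists N; split => // t /= ht; apply: contrapT => tN; apply: ht => _.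
by rewrite mindicE mem_set//= mulr1.
Qed.

Lemma ge0_ae_eq_integralW (D : set T) (f g : T -> R) : measurable D ->
  (forall t, D t -> (0 <= f t)%R) -> (forall t, D t -> (0 <= g t)%R) ->
  {ae mu, forall t, D t -> f t = g t} ->
  \int[mu]_(t in D) (f t)%:E = \int[mu]_(t in D) (g t)%:E.
Proof.
move=> mD f0 g0 fg; apply/eqP; rewrite eq_le; apply/andP.
by split; apply: ge0_ae_le_integral => //; apply: filterS fg => t fg Dt; rewrite fg.
Qed.

Lemma ge0_le_integralW (D : set T) (f g : T -> R) : measurable D ->
  (forall t, D t -> (0 <= f t)%R) -> (forall t, D t -> (f t <= g t)%R) ->
  \int[mu]_(t in D) (f t)%:E <= \int[mu]_(t in D) (g t)%:E.
Proof.
move=> mD f0 fg; apply: ge0_ae_le_integral => //; last exact: aeW.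
by move=> t Dt; rewrite (le_trans (f0 t Dt))// fg.
Qed.

Lemma ge0_subset_integralW (D E : set T) (f : T -> R) :
  measurable D -> measurable E -> D `<=` E -> (forall t, E t -> (0 <= f t)%R) ->
  \int[mu]_(t in D) (f t)%:E <= \int[mu]_(t in E) (f t)%:E.
Proof.
move=> mD mE DE f0; rewrite integral_mkcond [leRHS]integral_mkcond !restrict_EFin.
apply: ge0_le_integralW => // t _; rewrite !patchE.
  by case: ifPn => // /[!inE] /DE /f0.
case: ifPn => [/[!inE] Dt|_]; first by rewrite mem_set//; exact: DE.
by case: ifPn => // /[!inE] /f0.
Qed.

End LowerIntegral.

Section SimpleIntegral.
Variables (R : realType) (k : scalar_kind).
Variable X : completeNormedModType (scalar_field R k).
Local Notation mu := (@lebesgue_measure R).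
Variable D : set R.
Hypotheses (mD : measurable D) (Dfin : (mu D < +oo)%E).

Let fin_muI E : measurable E -> mu (D `&` E) \is a fin_num.
Proof.
move=> mE; rewrite ge0_fin_numE//; apply: le_lt_trans Dfin.
by rewrite le_measure ?inE//; exact: measurableI.
Qed.

Section Reindex.
Variables (I : choiceType) (q : R -> I) (l : seq I).
Hypotheses (sq : simple_map q) (ul : uniq l) (ql : range q = [set` l]).

Let m i := fine (mu (D `&` q @^-1` [set i])).

Let measure_preimage (P : pred I) :
  fine (mu (D `&` q @^-1` [set i | P i])) = \sum_(i <- l | P i) m i.
Proof.
have mq i : measurable (D `&` q @^-1` [set i]) by apply: measurableI => //; exact: sq.2.
have -> : D `&` q @^-1` [set i | P i] =
    \bigcup_(i in [set` [seq i <- l | P i]]) (D `&` q @^-1` [set i]).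
  apply/seteqP; split=> [t [Dt Pt]|t [i /= il [Dt /= qti]]].
    exists (q t) => //=; rewrite mem_filter Pt.
    by have : [set` l] (q t) by rewrite -ql; exists t.
  by split => //=; move: il; rewrite -qti mem_filter => /andP[].
rewrite (measure_fin_bigcup mu)//; last 2 first.
- by move=> i j _ _ [t [[_ /= <-] [_ /= <-]]].
- by move=> i _; exact: mq.
rewrite -fsbig_seq ?filter_uniq// big_filter.
rewrite (eq_bigr (fun i => (m i)%:E)) ?sumEFin// => i _.
by rewrite fineK// fin_muI//; exact: sq.2.
Qed.

(** The definition sums over the level sets of the function; here any finer finite partition,
    indexed by [q], may be used, since indices with the same value [c i] add up to one level set. *)
Lemma simple_integral_comp (c : I -> X) :
  simple_integral D (c \o q) =
  \sum_(i <- l) of_real k (fine (mu (D `&` q @^-1` [set i]))) *: c i.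
Proof.
rewrite /simple_integral.
have -> : range (c \o q) = [set` undup (map c l)].
  apply/seteqP; split=> [_ [t _ <-]|x]; rewrite /= mem_undup.
    by apply: map_f; have : [set` l] (q t) by rewrite -ql; exists t.
  move=> /mapP[i il ->]; have : [set` l] i by [].
  by rewrite -ql => -[t _ <-]; exists t.
rewrite -fsbig_seq ?undup_uniq//.
transitivity (\sum_(x <- undup (map c l)) \sum_(i <- l | c i == x)
    of_real k (m i) *: c i).
  apply: eq_bigr => x _.
  rewrite (_ : _ @^-1` [set x] = q @^-1` [set i | c i == x]); last first.
    by apply/seteqP; split=> t /= /eqP.
  rewrite measure_preimage (big_morph (of_real k) (@of_realD R k) (@of_real0 R k)).
  by rewrite scaler_suml; apply: eq_bigr => i /eqP ->.
rewrite (exchange_big_dep predT)//=; apply: eq_big_seq => i il.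
rewrite (@eq_bigl _ _ _ _ _ _ (pred1 (c i))); last by move=> x; rewrite eq_sym.
rewrite -big_filter filter_pred1_uniq ?undup_uniq ?mem_undup ?map_f//.
by rewrite big_seq1.
Qed.

Lemma integral_simple_comp (r : I -> R) : (forall i, 0 <= r i) ->
  (\int[mu]_(t in D) (r (q t))%:E)%E =
  (\sum_(i <- l) fine (mu (D `&` q @^-1` [set i])) * r i)%:E.
Proof.
move=> r0.
transitivity (\int[mu]_(t in D)
    (\sum_(i <- l) (r i * \1_(q @^-1` [set i]) t)%:E))%E.
  apply: eq_integral => t _; rewrite sumEFin; congr EFin.
  have qtl : q t \in l by have : [set` l] (q t) by rewrite -ql; exists t.
  rewrite (bigD1_seq (q t))//= big1 ?addr0 => [|i it].
    by rewrite indicE mem_set// mulr1.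
  by rewrite indicE memNset ?mulr0//= => qi; rewrite qi eqxx in it.
rewrite ge0_integral_sum//; last 2 first.
- move=> i; apply/measurable_EFinP; apply: measurable_funM => //.
  by apply: measurable_indic; exact: sq.2.
- by move=> i t _; rewrite lee_fin mulr_ge0.
rewrite -sumEFin; apply: eq_bigr => i _.
rewrite (@integralZl_indic _ _ _ mu D mD (fun=> q @^-1` [set i]) (r i))//.
- rewrite integral_indic//; last exact: sq.2.
  rewrite setIC mulrC EFinM fineK//; apply: fin_muI; exact: sq.2.
- by move=> /lt_geF; rewrite r0.
- exact: sq.2.
Qed.

End Reindex.

Lemma simple_map_seq (I : choiceType) (q : R -> I) : simple_map q ->
  exists2 l : seq I, uniq l & range q = [set` l].
Proof.
move=> [/finite_seqP[l ql] _]; exists (undup l); first exact: undup_uniq.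
by rewrite ql; apply/seteqP; split=> i /=; rewrite mem_undup.
Qed.

Lemma simple_integralD (s r : R -> X) : simple_fun s -> simple_fun r ->
  simple_integral D (fun t => s t + r t) = simple_integral D s + simple_integral D r.
Proof.
(* The pair of values indexes a common refinement of the two partitions. *)
move=> ss sr; have sp := simple_map_pair ss sr.
have [l ul hl] := simple_map_seq sp.
rewrite (simple_integral_comp sp ul hl (fun ab => ab.1 + ab.2)).
rewrite (simple_integral_comp sp ul hl fst) (simple_integral_comp sp ul hl snd).
by rewrite -big_split; apply: eq_bigr => i _; rewrite scalerDr.
Qed.

Lemma simple_integral_linear (L : X -> X) (s : R -> X) :
  (forall x y, L (x + y) = L x + L y) -> (forall a x, L (of_real k a *: x) = of_real k a *: L x) ->
  simple_fun s -> simple_integral D (L \o s) = L (simple_integral D s).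
Proof.
move=> LD LZ ss; have [l ul hl] := simple_map_seq ss.
rewrite (simple_integral_comp ss ul hl L) (simple_integral_comp ss ul hl id).
have L0 : L 0 = 0 by have := LZ 0 0; rewrite of_real0 !scale0r.
rewrite (big_morph L LD L0); apply: eq_bigr => i _; by rewrite LZ.
Qed.

Lemma simple_integralB (s r : R -> X) : simple_fun s -> simple_fun r ->
  simple_integral D (fun t => s t - r t) = simple_integral D s - simple_integral D r.
Proof.
move=> ss sr; rewrite simple_integralD//; last exact: (simple_map_comp -%R sr).
congr (_ + _); apply: (@simple_integral_linear -%R) => // [x y|a x].
  by rewrite opprD.
by rewrite scalerN.
Qed.

Lemma integral_rnorm_simple_lty (s : R -> X) : simple_fun s ->
  (\int[mu]_(t in D) (rnorm (s t))%:E < +oo)%E.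
Proof.
move=> ss; have [l ul hl] := simple_map_seq ss.
rewrite (integral_simple_comp ss ul hl (r := @rnorm R k X)) ?ltry//.
by move=> x; exact: rnorm_ge0.
Qed.

Lemma rnorm_simple_integral_le (s : R -> X) : simple_fun s ->
  ((rnorm (simple_integral D s))%:E <= \int[mu]_(t in D) (rnorm (s t))%:E)%E.
Proof.
move=> ss; have [l ul hl] := simple_map_seq ss.
rewrite (simple_integral_comp ss ul hl id).
rewrite (integral_simple_comp ss ul hl (r := @rnorm R k X)); last first.
  by move=> x; exact: rnorm_ge0.
rewrite lee_fin; elim/big_rec2: _ => [|i a x _ h]; first by rewrite rnorm0.
rewrite (le_trans (rnormD _ _))// lerD// rnormZ ger0_norm//.
exact: fine_ge0.
Qed.

End SimpleIntegral.

(** * The Bochner integral *)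

Section AlmostEverywhere.
Variable R : realType.
Local Notation mu := (@lebesgue_measure R).
Implicit Types P Q : R -> Prop.

Lemma ae_all P : (forall t, P t) -> {ae mu, forall t, P t}.
Proof. by move=> allP; exists set0; split => // t /= /(_ (allP t)). Qed.

Lemma ae_mono P Q : (forall t, P t -> Q t) ->
  {ae mu, forall t, P t} -> {ae mu, forall t, Q t}.
Proof.
move=> PQ [N [mN N0 hN]]; exists N; split => // t /= nQ.
by apply: hN => /= /PQ.
Qed.

Lemma ae_and P Q : {ae mu, forall t, P t} -> {ae mu, forall t, Q t} ->
  {ae mu, forall t, P t /\ Q t}.
Proof.
move=> [N [mN N0 hN]] [M [mM M0 hM]]; exists (N `|` M); split.
- exact: measurableU.
- by apply/eqP; rewrite eq_le measure_ge0 andbT (le_trans (measureU2 _ _ _))//= N0 M0 adde0.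
move=> t /= nPQ; have [Pt|nP] := pselect (P t); last by left; apply: hN.
by right; apply: hM => /= Qt; apply: nPQ.
Qed.

End AlmostEverywhere.

Lemma cvge0_lt (R : realType) (u : nat -> \bar R) (e : R) :
  u @ \oo --> 0%E -> 0 < e -> \forall n \near \oo, (u n < e%:E)%E.
Proof.
move=> u0 e0; apply: (u0 [set y | (y < e%:E)%E]).
exact: (@nbhs_open_ereal_lt _ 0 (fun=> e)).
Qed.

Section Bochner.
Variables (R : realType) (k : scalar_kind).
Variable X : completeNormedModType (scalar_field R k).
Local Notation mu := (@lebesgue_measure R).
Implicit Types (f g h s : R -> X) (D : set R).

Import HBNNSimple.

(** The approximants are cut to zero outside [D] and on the exceptional null set, so that they
    converge at every point. *)
Lemma strongly_measurableP D f : measurable D ->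
  strongly_measurable setT (@rnorm R k X) D f <->
  exists2 g, smeasurable g & {ae mu, forall t, D t -> f t = g t}.
Proof.
move=> mD; split=> [[s_ [ss [N [mN N0 hN]]]]|[g [s_ [ss sg]] fg]].
  exists (fun t => if t \in D `\` N then f t else 0).
    exists (fun n t => if t \in D `\` N then s_ n t else 0); split=> [n|t].
      exact: (simple_map_comp (fun bx => if bx.1 then bx.2 else 0)
        (simple_map_pair (simple_map_in (measurableD mD mN)) (ss n).1)).
    case: ifPn => [|_]; last exact: cvg_cst.
    rewrite inE => -[Dt Nt].
    have : (~` N) t by []; move=> /(subsetC hN); rewrite setCK => /(_ Dt)[_ h].
    by apply/cvg_rnormP; under eq_fun do rewrite rnormB.
  exists N; split => // t /= nt; apply: contrapT => Nt; apply: nt => Dt.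
  by rewrite mem_set//.
exists s_; split => //; apply: ae_mono fg => t /= h Dt; split => //.
by rewrite h//; have /cvg_rnormP := sg t; under eq_fun do rewrite rnormB.
Qed.

Lemma measurable_rnorm_EFin D g : smeasurable g ->
  measurable_fun D (fun t => (rnorm (g t))%:E).
Proof.
by move=> mg; apply/measurable_EFinP/measurable_funTS; exact: smeasurable_rnorm.
Qed.

Lemma smeasurableN f : smeasurable f -> smeasurable (fun t => - f t).
Proof. by apply: (@smeasurable_comp _ _ _ -%R); exact: opp_continuous. Qed.

Lemma smeasurableB f g :
  smeasurable f -> smeasurable g -> smeasurable (fun t => f t - g t).
Proof. by move=> mf mg; apply: smeasurableD => //; exact: smeasurableN. Qed.

Lemma measurable_dist_EFin D f g : smeasurable f -> smeasurable g ->
  measurable_fun D (fun t => (rnorm (f t - g t))%:E).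
Proof. by move=> mf mg; apply: measurable_rnorm_EFin; exact: smeasurableB. Qed.

Lemma integral_rnorm_triangle D f g h : measurable D ->
  smeasurable f -> smeasurable g -> smeasurable h ->
  (\int[mu]_(t in D) (rnorm (f t - h t))%:E <=
   \int[mu]_(t in D) (rnorm (f t - g t))%:E +
   \int[mu]_(t in D) (rnorm (g t - h t))%:E)%E.
Proof.
move=> mD mf mg mh; rewrite -ge0_integralD//; last 4 first.
- by move=> t _; rewrite lee_fin rnorm_ge0.
- exact: measurable_dist_EFin.
- by move=> t _; rewrite lee_fin rnorm_ge0.
- exact: measurable_dist_EFin.
under [leRHS]eq_integral do rewrite -EFinD.
by apply: ge0_le_integralW => // t _; [exact: rnorm_ge0|exact: rnorm_triangle].
Qed.

(* The approximating simple functions are truncated where they exceed twice a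
   simple minorant of [|g|], which makes [3 |g|] a dominating function. *)
Lemma simple_approximation D g : measurable D -> smeasurable g ->
  (\int[mu]_(t in D) (rnorm (g t))%:E < +oo)%E ->
  exists s_ : nat -> R -> X, [/\ forall n, simple_fun (s_ n),
    forall t, s_ n t @[n --> \oo] --> g t &
    (\int[mu]_(t in D) (rnorm (g t - s_ n t))%:E)%E @[n --> \oo] --> 0%E].
Proof.
move=> mD mg intg; have [s_ [ss sg]] := mg.
have mng : measurable_fun setT (fun t => (rnorm (g t))%:E) by exact: measurable_rnorm_EFin.
have ng0 t : setT t -> (0 <= (rnorm (g t))%:E)%E by move=> _; rewrite lee_fin rnorm_ge0.
pose phi n : R -> R := nnsfun_approx (@measurableT _ R) mng n.
have phile n t : phi n t <= rnorm (g t).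
  rewrite -lee_fin /phi nnsfun_approxE.
  exact: le_approx.
have phicvg t : phi n t @[n --> \oo] --> rnorm (g t).
  rewrite /phi; under eq_fun do rewrite nnsfun_approxE.
  exact: (cvg_approx ng0 I (ltry _)).
have phi0 n t : 0 <= phi n t by exact: fun_ge0.
have sphi n : simple_map (phi n).
  split; first exact: fimfunP.
  by move=> r; rewrite /phi.
pose r_ n t := if rnorm (s_ n t) <= 2 * phi n t then s_ n t else 0.
exists r_.
have sr n : simple_fun (r_ n).
  exact: (simple_map_comp (fun xa => if rnorm xa.1 <= 2 * xa.2 then xa.1 else 0)
    (simple_map_pair (ss n) (sphi n))).
have rg t : r_ n t @[n --> \oo] --> g t.
  have [gt0|gt0] := eqVneq (rnorm (g t)) 0.
    apply/cvg_rnormP; rewrite (rnorm0_eq0 gt0).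
    have := sg t; rewrite (rnorm0_eq0 gt0) => /cvg_rnormP sg0.
    apply: (squeeze_cvgr _ (cvg_cst 0) sg0); apply: nearW => n.
    rewrite rnorm_ge0/= /r_; case: ifP => // _.
    by rewrite subr0 rnorm0 rnorm_ge0.
  have gp : 0 < rnorm (g t) by rewrite lt_neqAle eq_sym gt0 rnorm_ge0.
  have := sg t; apply: cvg_trans; apply: near_eq_cvg.
  (* Once [s_ n t] and [phi n t] are within a quarter of |g| of their limits, |s_n| < 5/4 |g| < 3/2
     |g| < 2 phi, so the truncation is inactive. *)
  have e0 : 0 < rnorm (g t) / 4 by rewrite divr_gt0.
  have cvg_near (a : nat -> R) (b : R) : a @ \oo --> b -> b = rnorm (g t) ->
      \forall n \near \oo, `|rnorm (g t) - a n| < rnorm (g t) / 4.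
    by move=> /cvgrPdist_lt ab bE; rewrite -bE; apply: ab; rewrite bE.
  have h1 := cvg_near _ _ (phicvg t) erefl.
  have h2 := cvg_near _ _ (rnorm_cvg (sg t)) erefl.
  near=> n; rewrite /r_ ifT//.
  have : `|rnorm (g t) - phi n t| < rnorm (g t) / 4 by near: n; exact: h1.
  have : `|rnorm (g t) - rnorm (s_ n t)| < rnorm (g t) / 4 by near: n; exact: h2.
  by rewrite !ltr_norml => /andP[? ?] /andP[? ?]; lra.
split => //.
have dom n t : rnorm (g t - r_ n t) <= 3 * rnorm (g t).
  rewrite (le_trans (rnormD _ _))// rnormN /r_.
  have := phile n t; have := rnorm_ge0 (g t).
  by case: ifP => [|_]; rewrite ?rnorm0; lra.
have [|||||_ _ +] := @dominated_convergence _ _ _ mu D mD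
  (fun n t => (rnorm (g t - r_ n t))%:E) (cst 0%E) (fun t => (3 * rnorm (g t))%:E).
- by move=> n; apply: measurable_dist_EFin => //; exact: simple_smeasurable.
- exact: measurable_cst.
- apply: ae_all => t _; apply: cvg_EFin; first exact: nearW.
  have /cvg_rnormP := rg t; apply: cvg_trans.
  by under eq_fun do rewrite rnormB.
- apply/integrableP; split.
    apply/measurable_EFinP; apply: measurable_funM => //.
    by apply: measurable_funTS; exact: smeasurable_rnorm.
  under eq_integral => t _ do rewrite gee0_abs ?EFinM ?mule_ge0 ?lee_fin ?rnorm_ge0//.
  rewrite ge0_integralZl_EFin//; first by apply: lte_mul_pinfty.
    by move=> t _; rewrite lee_fin rnorm_ge0.
  exact: measurable_rnorm_EFin.
- by apply: ae_all => t n _; rewrite gee0_abs ?lee_fin ?rnorm_ge0//; exact: dom.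
by rewrite integral0.
Unshelve. all: by end_near. Qed.

(** [f] may be arbitrary on a null set. Measurability and integrability are placed on the
    representative [g], for whose norm the integral is additive. *)
Definition bochner_rep D f g : Prop :=
  [/\ smeasurable g, {ae mu, forall t, D t -> f t = g t} &
      (\int[mu]_(t in D) (rnorm (g t))%:E < +oo)%E].

Definition bochner_integrable D f : Prop := exists g, bochner_rep D f g.

Section FixedDomain.
Variable D : set R.
Hypotheses (mD : measurable D) (Dfin : (mu D < +oo)%E).

Lemma simple_dist f g (e : R) : bochner_rep D f g -> 0 < e ->
  exists2 s, simple_fun s & (\int[mu]_(t in D) (rnorm (g t - s t))%:E < e%:E)%E.
Proof.
move=> [mg _ ig] e0; have [s_ [ss _ si]] := simple_approximation mD mg ig.
have [n _ /(_ n (leqnn n)) hn] : \forall n \near \oo,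
    (\int[mu]_(t in D) (rnorm (g t - s_ n t))%:E < e%:E)%E.
  exact: cvge0_lt si e0.
by exists (s_ n).
Qed.

Lemma rnorm_simple_integralB s (r : R -> X) g : simple_fun s -> simple_fun r -> smeasurable g ->
  ((rnorm (simple_integral D s - simple_integral D r))%:E <=
   \int[mu]_(t in D) (rnorm (g t - s t))%:E + \int[mu]_(t in D) (rnorm (g t - r t))%:E)%E.
Proof.
move=> ss sr mg; rewrite -simple_integralB//.
have ssr : simple_fun (fun t => s t - r t).
  exact: (simple_map_comp (fun ab => ab.1 - ab.2) (simple_map_pair ss sr)).
apply: (le_trans (rnorm_simple_integral_le mD Dfin ssr)).
apply: (le_trans (integral_rnorm_triangle mD (simple_smeasurable ss) mg (simple_smeasurable sr))).
by rewrite leeD2r//; under eq_integral do rewrite rnormB.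
Qed.

Lemma ex_bochner_integral f g : bochner_rep D f g ->
  exists I, is_bochner_integral D f I.
Proof.
move=> fg; have [mg aefg ig] := fg.
have [s_ [ss sg si]] := simple_approximation mD mg ig.
have [I hI] : exists I : X, simple_integral D (s_ n) @[n --> \oo] --> I.
  apply: rnorm_cauchy_cvg => e e0.
  have e20 : 0 < e / 2 by rewrite divr_gt0.
  have [N _ hN] : \forall n \near \oo,
      (\int[mu]_(t in D) (rnorm (g t - s_ n t))%:E < (e / 2)%:E)%E.
    exact: cvge0_lt si e20.
  exists N => m n Nm Nn; rewrite -lte_fin.
  apply: (le_lt_trans (rnorm_simple_integralB (ss m) (ss n) mg)).
  by rewrite [e in ltRHS]splitr EFinD lteD// hN.
exists I, s_; split => //.
  split => //; apply: ae_mono aefg => t h Dt; split => //; rewrite h//.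
  by have /cvg_rnormP := sg t; under eq_fun do rewrite rnormB.
move: si; apply: cvg_trans; apply: near_eq_cvg; apply: nearW => n.
apply: ge0_ae_eq_integralW => // [t _|t _|]; rewrite ?rnorm_ge0//.
by apply: ae_mono aefg => t h Dt; rewrite h.
Qed.

(** The source of all later properties of the integral: it bounds the distance from whatever value
    [xget] selects to any simple integral, so uniqueness of the value is built in, and identities
    follow by comparison with one good simple function. *)
Lemma bochner_integral_simple f g s : bochner_rep D f g -> simple_fun s ->
  ((rnorm (bochner_integral D f - simple_integral D s))%:E <=
   \int[mu]_(t in D) (rnorm (g t - s t))%:E)%E.
Proof.
move=> fg ss; have [mg aefg ig] := fg.
have [r_ [[sr _] ri rI]] : is_bochner_integral D f (bochner_integral D f).
  exact: (xgetPex 0 (ex_bochner_integral fg)).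
apply/lee_addgt0Pr => e e0; have e20 : 0 < e / 2 by rewrite divr_gt0.
have fgr n : (\int[mu]_(t in D) (rnorm (f t - r_ n t))%:E =
              \int[mu]_(t in D) (rnorm (g t - r_ n t))%:E)%E.
  apply: ge0_ae_eq_integralW => // [t _|t _|]; rewrite ?rnorm_ge0//.
  by apply: ae_mono aefg => t h Dt; rewrite h.
have h1 : \forall n \near \oo,
    (\int[mu]_(t in D) (rnorm (g t - r_ n t))%:E < (e / 2)%:E)%E.
  near=> n; rewrite -fgr; near: n.
  exact: cvge0_lt ri e20.
have := rI => /cvg_rnormP/cvgr0Pnorm_lt/(_ _ e20) h2.
have [n [hn1 hn2]] := @filter_ex _ _ _ _ (filterI h1 h2).
have ha : ((rnorm (simple_integral D (r_ n) - bochner_integral D f))%:E <= (e / 2)%:E)%E.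
  by rewrite lee_fin ltW// (le_lt_trans (ler_norm _) hn2).
have hb : ((rnorm (simple_integral D (r_ n) - simple_integral D s))%:E <=
    (e / 2)%:E + \int[mu]_(t in D) (rnorm (g t - s t))%:E)%E.
  apply: (le_trans (rnorm_simple_integralB (sr n).1 ss mg)).
  by rewrite leeD2r// ltW.
rewrite [e]splitr EFinD [leRHS]addeC -addeA (le_trans _ (leeD ha hb))//.
rewrite -EFinD lee_fin (le_trans (rnorm_triangle (simple_integral D (r_ n)) _ _))//.
by rewrite lerD2r rnormB.
Unshelve. all: by end_near. Qed.

End FixedDomain.
End Bochner.

Section BochnerProperties.
Variables (R : realType) (k : scalar_kind).
Variable X : completeNormedModType (scalar_field R k).
Local Notation mu := (@lebesgue_measure R).
Implicit Types (f g h s : R -> X) (D : set R).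

Lemma rnorm_le_eps (x y : X) : (forall e : R, 0 < e -> rnorm (x - y) <= e) -> x = y.
Proof.
move=> h; apply/eqP; rewrite -subr_eq0; apply/eqP/rnorm0_eq0/eqP.
rewrite eq_le rnorm_ge0 andbT leNgt; apply/negP => x0.
by have := h _ (divr_gt0 x0 (ltr0n _ 2)); lra.
Qed.

Section FixedDomain.
Variable D : set R.
Hypotheses (mD : measurable D) (Dfin : (mu D < +oo)%E).

Lemma bochner_integral_dist f g (e : R) : bochner_rep D f g -> 0 < e ->
  exists s, [/\ simple_fun s, (\int[mu]_(t in D) (rnorm (g t - s t))%:E < e%:E)%E &
    rnorm (bochner_integral D f - simple_integral D s) < e].
Proof.
move=> fg e0; have [s ss hs] := simple_dist mD fg e0.
exists s; split => //; rewrite -lte_fin.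
exact: (le_lt_trans (bochner_integral_simple mD Dfin fg ss)).
Qed.

(** Both functions have the same set of candidate integrals, so the choices made by [xget] agree,
    default value included. *)
Lemma eq_bochner_integral f f' : (forall t, D t -> f t = f' t) ->
  bochner_integral D f = bochner_integral D f'.
Proof.
move=> ff'; rewrite /bochner_integral; congr (xget 0); apply/seteqP.
have sub (h h' : R -> X) : (forall t, D t -> h t = h' t) ->
    is_bochner_integral D h `<=` is_bochner_integral D h'.
  move=> hh' I [s_ [[ss hs] si sI]]; exists s_; split => //.
    by split => //; apply: ae_mono hs => t H Dt; rewrite -hh'//; exact: H.
  move: si; apply: cvg_trans; apply: near_eq_cvg; apply: nearW => n.
  by apply: eq_integral => t /[!inE] Dt; rewrite hh'.
by split; apply: sub => // t Dt; rewrite ff'.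
Qed.

Lemma bochner_repD f1 g1 f2 g2 : bochner_rep D f1 g1 -> bochner_rep D f2 g2 ->
  bochner_rep D (fun t => f1 t + f2 t) (fun t => g1 t + g2 t).
Proof.
move=> [m1 e1 i1] [m2 e2 i2]; split; first exact: smeasurableD.
  by apply: ae_mono (ae_and e1 e2) => t [h1 h2] Dt; rewrite h1// h2.
apply: (@le_lt_trans _ _ (\int[mu]_(t in D) (rnorm (g1 t))%:E +
    \int[mu]_(t in D) (rnorm (g2 t))%:E)%E); last exact: lte_add_pinfty.
rewrite -ge0_integralD//; last 4 first.
- by move=> t _; rewrite lee_fin rnorm_ge0.
- exact: measurable_rnorm_EFin.
- by move=> t _; rewrite lee_fin rnorm_ge0.
- exact: measurable_rnorm_EFin.
under [leRHS]eq_integral do rewrite -EFinD.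
by apply: ge0_le_integralW => // t _; [exact: rnorm_ge0|exact: rnormD].
Qed.

Lemma bochner_integralD f1 f2 :
  bochner_integrable D f1 -> bochner_integrable D f2 ->
  bochner_integrable D (fun t => f1 t + f2 t) /\
  bochner_integral D (fun t => f1 t + f2 t) =
  bochner_integral D f1 + bochner_integral D f2.
Proof.
move=> [g1 fg1] [g2 fg2]; have fg := bochner_repD fg1 fg2.
split; first by exists (fun t => g1 t + g2 t).
apply: rnorm_le_eps => e e0; have e40 : 0 < e / 4 by rewrite divr_gt0.
have [s1 [ss1 hs1 hf1]] := bochner_integral_dist fg1 e40.
have [s2 [ss2 hs2 hf2]] := bochner_integral_dist fg2 e40.
have ss : simple_fun (fun t => s1 t + s2 t).
  exact: (simple_map_comp (fun ab => ab.1 + ab.2) (simple_map_pair ss1 ss2)).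
have h : rnorm (bochner_integral D (fun t => f1 t + f2 t) -
    simple_integral D (fun t => s1 t + s2 t)) <= e / 4 + e / 4.
  rewrite -lee_fin (le_trans (bochner_integral_simple mD Dfin fg ss))//.
  have [[m1 _ _] [m2 _ _]] := (fg1, fg2).
  rewrite EFinD (le_trans _ (leeD (ltW hs1) (ltW hs2)))//.
  rewrite -ge0_integralD//; last 4 first.
  - by move=> t _; rewrite lee_fin rnorm_ge0.
  - by apply: measurable_dist_EFin => //; exact: simple_smeasurable.
  - by move=> t _; rewrite lee_fin rnorm_ge0.
  - by apply: measurable_dist_EFin => //; exact: simple_smeasurable.
  under [leRHS]eq_integral do rewrite -EFinD.
  apply: ge0_le_integralW => // t _; first exact: rnorm_ge0.
  by rewrite opprD addrACA rnormD.
rewrite simple_integralD// in h.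
rewrite (le_trans (rnorm_triangle (simple_integral D s1 + simple_integral D s2) _ _))//.
have : rnorm (simple_integral D s1 + simple_integral D s2 -
    (bochner_integral D f1 + bochner_integral D f2)) <= e / 4 + e / 4.
  rewrite rnormB opprD addrACA (le_trans (rnormD _ _))//; lra.
by lra.
Qed.

Section Linear.
Variables (L : X -> X) (C : R).
Hypotheses (LD : forall x y, L (x + y) = L x + L y)
  (LZ : forall a x, L (of_real k a *: x) = of_real k a *: L x)
  (LC : forall x, rnorm (L x) <= C * rnorm x).

Let LB x y : L (x - y) = L x - L y.
Proof. by rewrite LD; congr (_ + _); have := LZ (-1) y; rewrite of_realN of_real1 !scaleN1r. Qed.

Lemma bounded_linear_continuous : continuous L.
Proof.
move=> x; apply/cvg_rnormP.
have h : C * rnorm (y - x) @[y --> x] --> (0 : R).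
  by rewrite -[X in _ --> X](mulr0 C); apply: cvgMr; apply/cvg_rnormP; exact: cvg_id.
apply: (squeeze_cvgr _ (cvg_cst 0) h).
by apply: nearW => y; rewrite rnorm_ge0 -LB LC.
Qed.

Lemma bochner_integral_linear f : bochner_integrable D f ->
  bochner_integrable D (L \o f) /\
  bochner_integral D (L \o f) = L (bochner_integral D f).
Proof.
move=> [g fg]; have [mg aefg ig] := fg.
(* A strictly positive bound, since it is divided by below; [C] itself may be zero or, on a trivial
   space, negative. *)
have C0 : 0 <= `|C| + 1 by rewrite addr_ge0.
have LC' x : rnorm (L x) <= (`|C| + 1) * rnorm x.
  by rewrite (le_trans (LC x))// ler_wpM2r ?rnorm_ge0//; have := ler_norm C; lra.
have intC h : smeasurable h -> (\int[mu]_(t in D) (rnorm (L (h t)))%:E <=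
    (`|C| + 1)%:E * \int[mu]_(t in D) (rnorm (h t))%:E)%E.
  move=> mh; rewrite -ge0_integralZl_EFin//; last 2 first.
  - by move=> t _; rewrite lee_fin rnorm_ge0.
  - exact: measurable_rnorm_EFin.
  under [leRHS]eq_integral do rewrite -EFinM.
  by apply: ge0_le_integralW => // t _; rewrite ?rnorm_ge0.
have Lfg : bochner_rep D (L \o f) (L \o g).
  split; first exact: smeasurable_comp bounded_linear_continuous mg.
    by apply: ae_mono aefg => t h Dt /=; rewrite h.
  by rewrite (le_lt_trans (intC _ mg))// lte_mul_pinfty.
split; first by exists (L \o g).
apply: rnorm_le_eps => e e0.
have d0 : 0 < e / (2 * (`|C| + 1)) by rewrite divr_gt0// mulr_gt0// ltr_wpDl.
have [s [ss hs hf]] := bochner_integral_dist fg d0.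
have sLs : simple_fun (L \o s) by exact: simple_map_comp.
have hC : (`|C| + 1) * (e / (2 * (`|C| + 1))) = e / 2.
  by field; rewrite gt_eqF// ltr_wpDl.
rewrite (le_trans (rnorm_triangle (simple_integral D (L \o s)) _ _))// [leRHS]splitr lerD//.
  rewrite -lee_fin (le_trans (bochner_integral_simple mD Dfin Lfg sLs))//.
  under eq_integral do rewrite /= -LB.
  rewrite (le_trans (intC _ _))//.
    by apply: smeasurableB => //; exact: simple_smeasurable.
  by rewrite -hC EFinM lee_wpmul2l ?lee_fin// ltW.
rewrite simple_integral_linear// -LB (le_trans (LC' _))// -hC ler_wpM2l//.
by rewrite rnormB ltW.
Qed.

End Linear.

Lemma bochner_integralZ (a : R) f : bochner_integrable D f ->
  bochner_integrable D (fun t => of_real k a *: f t) /\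
  bochner_integral D (fun t => of_real k a *: f t) =
  of_real k a *: bochner_integral D f.
Proof.
apply: (@bochner_integral_linear (fun x => of_real k a *: x) `|a|).
- by move=> x y; rewrite scalerDr.
- by move=> b x; rewrite !scalerA mulrC.
- by move=> x; rewrite rnormZ.
Qed.

Lemma bochner_integralB f1 f2 :
  bochner_integrable D f1 -> bochner_integrable D f2 ->
  bochner_integrable D (fun t => f1 t - f2 t) /\
  bochner_integral D (fun t => f1 t - f2 t) =
  bochner_integral D f1 - bochner_integral D f2.
Proof.
move=> i1 /(@bochner_integralZ (-1)); rewrite of_realN of_real1 scaleN1r.
have -> : (fun t => -1 *: f2 t) = (fun t => - f2 t).
  by apply/funext => t; rewrite scaleN1r.
by move=> [i2 <-]; exact: bochner_integralD.
Qed.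

Lemma rnorm_bochner_integral_le f : bochner_integrable D f ->
  ((rnorm (bochner_integral D f))%:E <= \int[mu]_(t in D) (rnorm (f t))%:E)%E.
Proof.
move=> [g fg]; have [mg aefg ig] := fg.
rewrite (@ge0_ae_eq_integralW _ _ _ mu D (fun t => rnorm (f t)) (fun t => rnorm (g t)))//;
  last 3 first.
- by move=> t _; exact: rnorm_ge0.
- by move=> t _; exact: rnorm_ge0.
- by apply: ae_mono aefg => t h Dt; rewrite h.
have s0 : simple_fun (fun=> 0 : X) by exact: simple_map_cst.
have := bochner_integral_simple mD Dfin fg s0.
have -> : simple_integral D (fun=> 0) = 0 :> X.
  by apply: fsbig1 => _ [t _ <-]; rewrite scaler0.
rewrite subr0; congr (_ <= _)%E.
by apply: eq_integral => t _; rewrite subr0.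
Qed.

Lemma bochner_integrable_cst (x : X) :
  bochner_integrable D (fun=> x) /\
  bochner_integral D (fun=> x) = of_real k (fine (mu D)) *: x.
Proof.
have sx : simple_fun (fun=> x : X) by exact: simple_map_cst.
have fg : bochner_rep D (fun=> x) (fun=> x).
  split; [exact: smeasurable_cst|exact: ae_all|exact: integral_rnorm_simple_lty].
split; first by exists (fun=> x).
have := bochner_integral_simple mD Dfin fg sx.
under eq_integral do rewrite subrr rnorm0.
rewrite integral0 lee_fin => h; apply: rnorm_le_eps => e /ltW e0.
rewrite (le_trans _ e0)// (le_trans _ h)// /simple_integral.
rewrite (_ : range (fun=> x) = [set x]); last first.
  by apply/seteqP; split=> [_ [t _ <-]//|_ ->]; exists 0.
rewrite fsbig_set1 (_ : (fun=> x) @^-1` [set x] = setT) ?setIT//.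
by apply/seteqP; split.
Qed.

End FixedDomain.

Lemma bochner_integrableS (D E : set R) f : measurable D -> measurable E ->
  D `<=` E -> bochner_integrable E f -> bochner_integrable D f.
Proof.
move=> mD mE DE [g [mg fg ig]]; exists g; split => //.
  by apply: ae_mono fg => t h /DE /h.
apply: le_lt_trans ig; apply: ge0_subset_integralW => // t _; exact: rnorm_ge0.
Qed.

(** The decomposition is expressed through measures instead of a union, so that [D1] and [D2] may
    miss a null part of [D] such as the splitting point of an interval. *)
Lemma bochner_integral_split (D D1 D2 : set R) f :
  measurable D -> measurable D1 -> measurable D2 -> (mu D < +oo)%E ->
  D1 `<=` D -> D2 `<=` D ->
  (forall E, measurable E -> mu (D `&` E) = mu (D1 `&` E) + mu (D2 `&` E))%E ->
  bochner_integrable D f ->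
  bochner_integral D f = bochner_integral D1 f + bochner_integral D2 f.
Proof.
move=> mD mD1 mD2 Dfin D1D D2D muD fi.
have fin E F : measurable E -> measurable F -> E `<=` D -> mu (E `&` F) \is a fin_num.
  move=> mE mF ED; rewrite ge0_fin_numE// (le_lt_trans _ Dfin)// le_measure// ?inE//.
    exact: measurableI.
  by move=> t [/ED].
have finT E : measurable E -> E `<=` D -> (mu E < +oo)%E.
  by move=> mE ED; rewrite (le_lt_trans _ Dfin)// le_measure// inE.
have [g fg] := fi; have [mg aefg ig] := fg.
have rep E : measurable E -> E `<=` D -> bochner_rep E f g.
  move=> mE ED; split => //; first by apply: ae_mono aefg => t h /ED /h.
  apply: le_lt_trans ig; apply: ge0_subset_integralW => // t _; exact: rnorm_ge0.
apply: rnorm_le_eps => e e0; have e30 : 0 < e / 3 by rewrite divr_gt0.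
have [s [ss hs hf]] := bochner_integral_dist mD Dfin fg e30.
have sD : simple_integral D s = simple_integral D1 s + simple_integral D2 s.
  have [l ul hl] := simple_map_seq ss.
  rewrite (simple_integral_comp mD Dfin ss ul hl id).
  rewrite (simple_integral_comp mD1 (finT _ mD1 D1D) ss ul hl id).
  rewrite (simple_integral_comp mD2 (finT _ mD2 D2D) ss ul hl id).
  rewrite -big_split; apply: eq_bigr => i _ /=.
  rewrite muD; last exact: ss.2.
  by rewrite fineD ?fin//; try exact: ss.2; rewrite of_realD scalerDl.
have hE E : measurable E -> E `<=` D ->
    rnorm (bochner_integral E f - simple_integral E s) <= e / 3.
  move=> mE ED.
  rewrite -lee_fin (le_trans (bochner_integral_simple mE (finT _ mE ED) (rep _ mE ED) ss))//.
  rewrite (le_trans _ (ltW hs))//; apply: ge0_subset_integralW => // t _; exact: rnorm_ge0.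
have h1 := hE _ mD1 D1D; have h2 := hE _ mD2 D2D.
rewrite (le_trans (rnorm_triangle (simple_integral D s) _ _))// sD.
have : rnorm (simple_integral D1 s + simple_integral D2 s -
    (bochner_integral D1 f + bochner_integral D2 f)) <= e / 3 + e / 3.
  rewrite rnormB opprD addrACA (le_trans (rnormD _ _))//; lra.
by rewrite sD in hf; lra.
Qed.

(** * Measure-preserving changes of variable *)

Section MeasurePreserving.
Variable phi : R -> R.
Hypotheses (mphi : measurable_fun setT phi) (phi_surj : forall t, exists u, phi u = t)
  (phi_mu : forall E, measurable E -> mu (phi @^-1` E) = mu E).

Let mpre (E : set R) : measurable E -> measurable (phi @^-1` E).
Proof. by move=> mE; rewrite -[_ @^-1` _]setTI; exact: mphi. Qed.

Lemma ae_preserving (P : R -> Prop) :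
  {ae mu, forall t, P t} -> {ae mu, forall t, P (phi t)}.
Proof.
move=> [N [mN N0 hN]]; exists (phi @^-1` N); split; first exact: mpre.
  by rewrite phi_mu.
by move=> t /= nP; exact: hN.
Qed.

Lemma ge0_integral_preserving (D : set R) (r : R -> R) : measurable D ->
  measurable_fun setT r -> (forall t, 0 <= r t) ->
  (\int[mu]_(t in phi @^-1` D) (r (phi t))%:E = \int[mu]_(t in D) (r t)%:E)%E.
Proof.
move=> mD mr r0.
have mphi' : measurable_fun (setT : set (measurableTypeR R))
  (phi : measurableTypeR R -> measurableTypeR R) by exact: mphi.
rewrite -(@ge0_integral_pushforward _ _ (measurableTypeR R) (measurableTypeR R) R
  phi mphi' mu D (EFin \o r))//; last 2 first.
- by apply/measurable_EFinP; exact: measurable_funTS.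
- by move=> t _; rewrite lee_fin.
by apply: eq_measure_integral => E mE _; rewrite /= /pushforward phi_mu.
Qed.

Lemma smeasurable_preserving f : smeasurable f -> smeasurable (f \o phi).
Proof.
move=> [s_ [ss sf]]; exists (fun n => s_ n \o phi); split=> [n|t]; last exact: sf.
have [fs ms] := ss n; split=> [|x]; last by rewrite comp_preimage; exact: mpre.
by apply: sub_finite_set fs => _ [t _ <-]; exists (phi t).
Qed.

Lemma bochner_integral_preserving (D : set R) f :
  measurable D -> (mu D < +oo)%E -> bochner_integrable D f ->
  bochner_integrable (phi @^-1` D) (f \o phi) /\
  bochner_integral (phi @^-1` D) (f \o phi) = bochner_integral D f.
Proof.
move=> mD Dfin [g fg]; have [mg aefg ig] := fg.
have mD' := mpre mD.
have Dfin' : (mu (phi @^-1` D) < +oo)%E by rewrite phi_mu.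
have fg' : bochner_rep (phi @^-1` D) (f \o phi) (g \o phi).
  split; first exact: smeasurable_preserving.
    exact: (ae_preserving (P := fun t => D t -> f t = g t)).
  rewrite (@ge0_integral_preserving D (fun t => rnorm (g t)))//.
    exact: smeasurable_rnorm.
  by move=> t; exact: rnorm_ge0.
split; first by exists (g \o phi).
apply: rnorm_le_eps => e e0; have e20 : 0 < e / 2 by rewrite divr_gt0.
have [s [ss hs hf]] := bochner_integral_dist mD Dfin fg e20.
have [fs ms] := ss.
have sphi : simple_fun (s \o phi).
  split=> [|x]; last by rewrite comp_preimage; exact: mpre.
  by apply: sub_finite_set fs => _ [t _ <-]; exists (phi t).
have sE : simple_integral (phi @^-1` D) (s \o phi) = simple_integral D s.
  rewrite /simple_integral.
  (* Surjectivity of [phi] makes both sums run over the same values. *)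
  have -> : range (s \o phi) = range s.
    apply/seteqP; split=> [_ [t _ <-]|_ [t _ <-]]; first by exists (phi t).
    by have [u <-] := phi_surj t; exists u.
  apply: eq_fsbigr => x _.
  by rewrite comp_preimage -preimage_setI phi_mu//; exact: measurableI.
have hf' : rnorm (bochner_integral (phi @^-1` D) (f \o phi) - simple_integral D s) <= e / 2.
  rewrite -sE -lee_fin (le_trans (bochner_integral_simple mD' Dfin' fg' sphi))//.
  rewrite (@ge0_integral_preserving D (fun t => rnorm (g t - s t))) ?ltW//.
    by apply: smeasurable_rnorm; apply: smeasurableB => //; exact: simple_smeasurable.
  by move=> t; exact: rnorm_ge0.
rewrite rnormB in hf.
by rewrite (le_trans (rnorm_triangle (simple_integral D s) _ _))//; lra.
Qed.

End MeasurePreserving.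
End BochnerProperties.

(** * Translations and reflections of the line *)

Section AffineMaps.
Variable R : realType.
Local Notation mu := (@lebesgue_measure R).

Lemma measurable_shift (c : R) : measurable_fun setT (fun t : R => t + c).
Proof. by apply: measurable_funD => //; exact: measurable_cst. Qed.

Lemma lebesgue_measure_shift (c : R) (E : set R) : measurable E ->
  mu ((fun t => t + c) @^-1` E) = mu E.
Proof.
move=> mE.
suff : pushforward mu ((fun t => t + c) : _ -> measurableTypeR R) E = mu E by [].
apply/esym/lebesgue_measure_unique => //=.
  exact: measurable_shift.
move=> _ _ [[a b]] _ <-.
rewrite /pushforward.
rewrite (_ : _ @^-1` _ = `](a - c), (b - c)]%classic); last first.
  by apply/seteqP; split=> t /=; rewrite !in_itv/= ltrBlDr lerBrDr.
rewrite !lebesgue_measure_itv/= !lte_fin ltrD2r -!EFinB.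
by case: ifP => // _; congr EFin; ring.
Qed.

Lemma measurable_reflect (c : R) : measurable_fun setT (fun t : R => c - t).
Proof. by apply: measurable_funB => //; exact: measurable_cst. Qed.

Lemma lebesgue_measure_reflect (c : R) (E : set R) : measurable E ->
  mu ((fun t => c - t) @^-1` E) = mu E.
Proof.
move=> mE.
rewrite -(lebesgue_measure_shift c mE).
have mE' : measurable ((fun t => t + c) @^-1` E).
  by rewrite -[_ @^-1` _]setTI; exact: measurable_shift.
rewrite -(lebesgue_measureN mE'); congr (mu _).
by apply/seteqP; split=> t /=; rewrite addrC.
Qed.

End AffineMaps.

(** * Bochner spaces *)

Lemma integral_cst_lebesgue (R : realType) (D : set R) (C : R) : measurable D ->
  (\int[@lebesgue_measure R]_(t in D) C%:E = C%:E * lebesgue_measure D)%E.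
Proof.
move=> mD; rewrite -(integral_cst (@lebesgue_measure R) mD C%:E).
exact: eq_integral.
Qed.

Section LpSpaces.
Variables (R : realType) (k : scalar_kind).
Variable X : completeNormedModType (scalar_field R k).
Local Notation mu := (@lebesgue_measure R).
Variable p : R.
Hypothesis p_gt1 : 1 < p.
Implicit Types (f g : R -> X) (D : set R).

Local Notation LpX := (Lp_in setT (@rnorm R k X) p).

Let p_ge0 : 0 <= p. Proof. by rewrite (le_trans _ (ltW p_gt1)). Qed.

Lemma measurable_rnorm_powR D g : smeasurable g ->
  measurable_fun D (fun t => (rnorm (g t) `^ p)%:E).
Proof.
move=> mg; apply/measurable_EFinP/measurable_funTS.
apply: (measurableT_comp (measurable_powR p)); exact: smeasurable_rnorm.
Qed.

Lemma Lp_inP D f : measurable D -> LpX D f <->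
  exists g, [/\ smeasurable g, {ae mu, forall t, D t -> f t = g t} &
    (\int[mu]_(t in D) (rnorm (g t) `^ p)%:E < +oo)%E].
Proof.
move=> mD.
have eqfg g : {ae mu, forall t, D t -> f t = g t} ->
    (\int[mu]_(t in D) (rnorm (f t) `^ p)%:E = \int[mu]_(t in D) (rnorm (g t) `^ p)%:E)%E.
  move=> fg; apply: ge0_ae_eq_integralW => [//|t _|t _|]; [exact: powR_ge0|exact: powR_ge0|].
  by apply: ae_mono fg => t h Dt; rewrite h.
split=> [[/(strongly_measurableP f mD)[g mg fg] fi]|[g [mg fg gi]]].
  by exists g; split; [exact: mg|exact: fg|rewrite -(eqfg g fg)].
split; last by rewrite (eqfg g fg).
by apply/(strongly_measurableP f mD); exists g.
Qed.

Lemma Lp_ae D f f' : measurable D -> LpX D f' ->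
  {ae mu, forall t, D t -> f t = f' t} -> LpX D f.
Proof.
move=> mD /(Lp_inP f' mD)[g [mg f'g ig]] ff'; apply/Lp_inP => //; exists g; split => //.
by apply: ae_mono (ae_and ff' f'g) => t [h1 h2] Dt; rewrite h1// h2.
Qed.

Lemma Lp_subset D E f : measurable D -> measurable E -> D `<=` E -> LpX E f -> LpX D f.
Proof.
move=> mD mE DE /(Lp_inP f mE)[g [mg fg ig]]; apply/Lp_inP => //; exists g; split => //.
  by apply: ae_mono fg => t h /DE /h.
apply: le_lt_trans ig; apply: ge0_subset_integralW => // t _; exact: powR_ge0.
Qed.

(** Pointwise |g| <= 1 + |g|^p, and constants are integrable on a set of finite measure. *)
Lemma Lp_bochner_integrable D f : measurable D -> (mu D < +oo)%E -> LpX D f ->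
  bochner_integrable D f.
Proof.
move=> mD Dfin /(Lp_inP f mD)[g [mg fg ig]]; exists g; split => //.
apply: (@le_lt_trans _ _ (\int[mu]_(t in D) 1%:E +
  \int[mu]_(t in D) (rnorm (g t) `^ p)%:E)%E); last first.
  by apply: lte_add_pinfty => //; rewrite integral_cst_lebesgue// mul1e.
rewrite -ge0_integralD//; last 2 first.
- by move=> t _; rewrite lee_fin powR_ge0.
- exact: measurable_rnorm_powR.
under [leRHS]eq_integral do rewrite -EFinD.
apply: ge0_le_integralW => // t _; first exact: rnorm_ge0.
have [h1|h1] := leP (rnorm (g t)) 1; first by rewrite /= ler_wpDr ?powR_ge0.
rewrite /= ler_wpDl// -[leLHS]powRr1 ?rnorm_ge0//.
by rewrite ler_powR// ltW.
Qed.

(** From a + b <= 2 max(a, b) and monotonicity of the power. *)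
Lemma powR_addr_le (a b : R) : 0 <= a -> 0 <= b ->
  (a + b) `^ p <= 2 `^ p * (a `^ p + b `^ p).
Proof.
move=> a0 b0; have [ab|ba] := leP a b.
  apply: (@le_trans _ _ ((2 * b) `^ p)).
    by rewrite ge0_ler_powR ?nnegrE ?addr_ge0 ?mulr_ge0//; lra.
  by rewrite powRM// ler_wpM2l ?powR_ge0// ler_wpDl ?powR_ge0.
apply: (@le_trans _ _ ((2 * a) `^ p)).
  by rewrite ge0_ler_powR ?nnegrE ?addr_ge0 ?mulr_ge0//; lra.
by rewrite powRM// ler_wpM2l ?powR_ge0// ler_wpDr ?powR_ge0.
Qed.

(** The sum of the norms, not the norm of the sum, is integrated: this also covers the graph norm of
    a strong solution. *)
Lemma integral_powR_add_lty D g1 g2 : measurable D -> smeasurable g1 -> smeasurable g2 ->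
  (\int[mu]_(t in D) (rnorm (g1 t) `^ p)%:E < +oo)%E ->
  (\int[mu]_(t in D) (rnorm (g2 t) `^ p)%:E < +oo)%E ->
  (\int[mu]_(t in D) ((rnorm (g1 t) + rnorm (g2 t)) `^ p)%:E < +oo)%E.
Proof.
move=> mD m1 m2 i1 i2.
apply: (@le_lt_trans _ _ ((2 `^ p)%:E * (\int[mu]_(t in D) (rnorm (g1 t) `^ p)%:E +
    \int[mu]_(t in D) (rnorm (g2 t) `^ p)%:E))%E); last first.
  have i12 := lte_add_pinfty i1 i2.
  by apply: lte_mul_pinfty; [rewrite lee_fin powR_ge0|by []|exact: i12].
rewrite -ge0_integralD//; last 4 first.
- by move=> t _; rewrite lee_fin powR_ge0.
- exact: measurable_rnorm_powR.
- by move=> t _; rewrite lee_fin powR_ge0.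
- exact: measurable_rnorm_powR.
rewrite -ge0_integralZl_EFin ?powR_ge0//; last 2 first.
- by move=> t _; rewrite -EFinD lee_fin addr_ge0 ?powR_ge0.
- by apply: emeasurable_funD; exact: measurable_rnorm_powR.
under [leRHS]eq_integral do rewrite -EFinD -EFinM.
apply: ge0_le_integralW => // t _; first exact: powR_ge0.
by apply: powR_addr_le; exact: rnorm_ge0.
Qed.

Lemma LpD D f1 f2 : measurable D -> LpX D f1 -> LpX D f2 ->
  LpX D (fun t => f1 t + f2 t).
Proof.
move=> mD /(Lp_inP _ mD)[g1 [m1 e1 i1]] /(Lp_inP _ mD)[g2 [m2 e2 i2]].
apply/Lp_inP => //; exists (fun t => g1 t + g2 t); split; first exact: smeasurableD.
  by apply: ae_mono (ae_and e1 e2) => t [h1 h2] Dt; rewrite h1// h2.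
apply: le_lt_trans (integral_powR_add_lty mD m1 m2 i1 i2).
apply: ge0_le_integralW => // t _; first exact: powR_ge0.
by rewrite ge0_ler_powR ?nnegrE ?addr_ge0 ?rnorm_ge0// rnormD.
Qed.

Lemma LpN D f : measurable D -> LpX D f -> LpX D (fun t => - f t).
Proof.
move=> mD /(Lp_inP _ mD)[g [mg e i]]; apply/Lp_inP => //; exists (fun t => - g t).
split; first exact: smeasurableN.
  by apply: ae_mono e => t h Dt; rewrite h.
by under eq_integral do rewrite rnormN.
Qed.

Lemma LpB D f1 f2 : measurable D -> LpX D f1 -> LpX D f2 ->
  LpX D (fun t => f1 t - f2 t).
Proof. by move=> mD h1 h2; exact: (LpD mD h1 (LpN mD h2)). Qed.

Lemma Lp_bounded D f (C : R) : measurable D -> (mu D < +oo)%E ->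
  (exists2 g, smeasurable g & {ae mu, forall t, D t -> f t = g t}) ->
  (forall t, D t -> rnorm (f t) <= C) -> LpX D f.
Proof.
move=> mD Dfin [g mg fg] fC; split; first by apply/strongly_measurableP => //; exists g.
apply: (@le_lt_trans _ _ (\int[mu]_(t in D) (`|C| `^ p)%:E)%E).
  apply: ge0_le_integralW => // t Dt; first exact: powR_ge0.
  rewrite ge0_ler_powR ?nnegrE ?rnorm_ge0//.
  by rewrite (le_trans (fC t Dt))// ler_norm.
by rewrite integral_cst_lebesgue// lte_mul_pinfty// lee_fin powR_ge0.
Qed.

Lemma Lp_preserving (phi : R -> R) D f : measurable_fun setT phi ->
  (forall E, measurable E -> mu (phi @^-1` E) = mu E) -> measurable D ->
  LpX D f -> LpX (phi @^-1` D) (f \o phi).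
Proof.
move=> mphi phi_mu mD /(Lp_inP _ mD)[g [mg e i]].
have mD' : measurable (phi @^-1` D) by rewrite -[_ @^-1` _]setTI; exact: mphi.
apply/Lp_inP => //; exists (g \o phi); split.
- exact: smeasurable_preserving.
- exact: (ae_preserving mphi phi_mu (P := fun t => D t -> f t = g t)).
rewrite (@ge0_integral_preserving R phi mphi phi_mu D (fun t => rnorm (g t) `^ p))//.
  by apply/measurable_EFinP; exact: measurable_rnorm_powR.
by move=> t; exact: powR_ge0.
Qed.

(** For splicing two functions at an interior point of []0, tau[], which belongs to neither open
    half. *)
Lemma Lp_glue (D D1 D2 : set R) f1 f2 f :
  measurable D -> measurable D1 -> measurable D2 ->
  LpX D1 f1 -> LpX D2 f2 ->
  (forall t, D1 t -> f t = f1 t) -> (forall t, D2 t -> f t = f2 t) ->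
  {ae mu, forall t, D t -> D1 t \/ D2 t} -> LpX D f.
Proof.
move=> mD mD1 mD2 /(Lp_inP _ mD1)[g1 [m1 e1 i1]] /(Lp_inP _ mD2)[g2 [m2 e2 i2]] ff1 ff2 D12.
have m0 : smeasurable (fun=> 0 : X) by exact: smeasurable_cst.
pose h1 t := if t \in D1 then g1 t else 0.
pose h2 t := if t \in D2 then g2 t else 0.
have mh1 : smeasurable h1 by exact: smeasurable_if.
have mh2 : smeasurable h2 by exact: smeasurable_if.
pose g t := if t \in D1 then g1 t else h2 t.
have hi (E : set R) (h : R -> X) : measurable E ->
    (\int[mu]_(t in E) (rnorm (h t) `^ p)%:E < +oo)%E ->
    (\int[mu]_(t in D) (rnorm (if t \in E then h t else 0) `^ p)%:E < +oo)%E.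
  move=> mE; apply: le_lt_trans.
  apply: (@le_trans _ _ (\int[mu]_t (rnorm (if t \in E then h t else 0) `^ p)%:E)%E).
    by apply: ge0_subset_integralW => // t _; exact: powR_ge0.
  rewrite [leRHS]integral_mkcond restrict_EFin.
  apply: ge0_le_integralW => // t _; first exact: powR_ge0.
  rewrite patchE; case: ifP => // _.
  by rewrite rnorm0 powR0// gt_eqF// (lt_trans ltr01).
apply/Lp_inP => //; exists g; split; first exact: smeasurable_if.
  apply: ae_mono (ae_and D12 (ae_and e1 e2)) => t [D12t [E1 E2]] Dt; rewrite /g /h2.
  case: ifPn => [/[!inE] D1t|]; last rewrite notin_setE => nD1; first by rewrite ff1// E1.
  by case: (D12t Dt) => // D2t; rewrite mem_set// ff2// E2.
apply: (@le_lt_trans _ _ (\int[mu]_(t in D) (rnorm (h1 t) `^ p)%:E +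
    \int[mu]_(t in D) (rnorm (h2 t) `^ p)%:E)%E); last by apply: lte_add_pinfty; exact: hi.
rewrite -ge0_integralD//; last 4 first.
- by move=> t _; rewrite lee_fin powR_ge0.
- exact: measurable_rnorm_powR.
- by move=> t _; rewrite lee_fin powR_ge0.
- exact: measurable_rnorm_powR.
under [leRHS]eq_integral do rewrite -EFinD.
apply: ge0_le_integralW => // t _; first exact: powR_ge0.
by rewrite /g /h1; case: ifP => _; [rewrite lerDl powR_ge0|rewrite lerDr powR_ge0].
Qed.

End LpSpaces.

(** * Integrals over intervals *)

Section Intervals.
Variables (R : realType) (k : scalar_kind).
Variable X : completeNormedModType (scalar_field R k).
Local Notation mu := (@lebesgue_measure R).
Implicit Types (f g : R -> X) (a b c t : R).

Lemma lebesgue_measure_oo_lty a b : (mu `]a, b[%classic < +oo)%E.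
Proof. by rewrite lebesgue_measure_itv/=; case: ifP => _; rewrite ?ltry// -EFinB ltry. Qed.

Lemma subitvoo a b a' b' : a' <= a -> b <= b' ->
  `]a, b[%classic `<=` `]a', b'[%classic.
Proof.
move=> aa bb t /=; rewrite !in_itv/= => /andP[at_ tb].
by rewrite (le_lt_trans aa)// (lt_le_trans tb).
Qed.

Lemma itvoo_eq0 a b : b <= a -> `]a, b[%classic = set0.
Proof.
move=> ba; apply/seteqP; split=> // t /=; rewrite in_itv/= => /andP[at_ tb].
by have := lt_trans at_ tb; rewrite ltNge ba.
Qed.

Lemma measure_itvoo_split a c b (E : set R) : a <= c <= b -> measurable E ->
  (mu (`]a, b[ `&` E) = mu (`]a, c[ `&` E) + mu (`]c, b[ `&` E))%E.
Proof.
move=> /andP[ac cb] mE.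
(* The third piece is at most the point [c] and has measure zero. *)
have -> : `]a, b[%classic `&` E =
    ((`]a, c[%classic `&` E) `|` (`]c, b[%classic `&` E)) `|` ([set c] `&` `]a, b[ `&` E).
  apply/seteqP; split=> t /=.
    rewrite !in_itv/= => -[/andP[at_ tb] Et]; have [tc|tc|tc] := ltgtP t c.
    - by left; left; rewrite at_.
    - by left; right; rewrite tb.
    - by right; rewrite at_ tb.
  rewrite !in_itv/= => -[[[/andP[at_ tc] Et]|[/andP[ct tb] Et]]|[[_ ->]]] //.
  - by rewrite at_ (lt_le_trans tc).
  - by rewrite tb (le_lt_trans ac).
rewrite measureU0//; last 3 first.
- by apply: measurableU; apply: measurableI.
- by apply: measurableI => //; apply: measurableI.
- apply/eqP; rewrite eq_le measure_ge0 andbT -(lebesgue_measure_set1 c).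
  rewrite le_measure// ?inE//.
    by apply: measurableI => //; apply: measurableI.
  by move=> t [[]].
rewrite measureU//; try exact: measurableI.
apply/seteqP; split=> // t /= [[]]; rewrite !in_itv/= => /andP[_ tc] _ [/andP[ct _] _].
by have := lt_trans tc ct; rewrite ltxx.
Qed.

Lemma bint_split a c b f : a <= c <= b -> bochner_integrable `]a, b[ f ->
  bochner_integral `]a, b[ f = bochner_integral `]a, c[ f + bochner_integral `]c, b[ f.
Proof.
move=> acb; have /andP[ac cb] := acb.
apply: bochner_integral_split => //.
- exact: lebesgue_measure_oo_lty.
- exact: subitvoo.
- exact: subitvoo.
- by move=> E mE; exact: measure_itvoo_split.
Qed.

Lemma bochner_integrable_sub a b a' b' f : a' <= a -> b <= b' ->
  bochner_integrable `]a', b'[ f -> bochner_integrable `]a, b[ f.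
Proof. by move=> aa bb; apply: bochner_integrableS => //; exact: subitvoo. Qed.

Lemma bint_nil a b f : b <= a -> bochner_integral `]a, b[ f = 0.
Proof.
move=> ba; rewrite itvoo_eq0//; apply/rnorm0_eq0/eqP.
rewrite eq_le rnorm_ge0 andbT -lee_fin.
rewrite (le_trans (rnorm_bochner_integral_le _ _ _))//.
- by rewrite measure0.
- exists (fun=> 0); split; first exact: smeasurable_cst.
    exact: ae_all.
  by rewrite integral_set0.
- by rewrite integral_set0.
Qed.

Lemma bint_shift c a b f : bochner_integrable `]a, b[ f ->
  bochner_integrable `]a - c, b - c[ (fun t => f (t + c)) /\
  bochner_integral `]a - c, b - c[ (fun t => f (t + c)) = bochner_integral `]a, b[ f.
Proof.
move=> fi.
have -> : `]a - c, b - c[%classic = (fun t => t + c) @^-1` `]a, b[.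
  by apply/seteqP; split=> t /=; rewrite !in_itv/= ltrBlDr ltrBrDr.
apply: (@bochner_integral_preserving _ _ _ (fun t => t + c)) => //.
- exact: measurable_shift.
- by move=> t; exists (t - c); rewrite subrK.
- by move=> E; exact: lebesgue_measure_shift.
- exact: lebesgue_measure_oo_lty.
Qed.

Lemma bint_reflect c a b f : bochner_integrable `]a, b[ f ->
  bochner_integrable `]c - b, c - a[ (fun t => f (c - t)) /\
  bochner_integral `]c - b, c - a[ (fun t => f (c - t)) = bochner_integral `]a, b[ f.
Proof.
move=> fi.
have -> : `]c - b, c - a[%classic = (fun t => c - t) @^-1` `]a, b[.
  by apply/seteqP; split=> t /=; rewrite !in_itv/= => /andP[? ?]; apply/andP; split; lra.
apply: (@bochner_integral_preserving _ _ _ (fun t => c - t)) => //.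
- exact: measurable_reflect.
- by move=> t; exists (c - t); rewrite subKr.
- by move=> E; exact: lebesgue_measure_reflect.
- exact: lebesgue_measure_oo_lty.
Qed.

Lemma bint_cst a b (x : X) : a <= b ->
  bochner_integral `]a, b[ (fun=> x) = of_real k (b - a) *: x.
Proof.
move=> ab; rewrite (bochner_integrable_cst _ _ x).2//; last exact: lebesgue_measure_oo_lty.
congr (of_real k _ *: _); rewrite lebesgue_measure_itv/= lte_fin.
have [ab'|ba] := ltP a b; first by rewrite -EFinB.
by apply/esym/eqP; rewrite subr_eq0 eq_le ba ab.
Qed.

Lemma rnorm_bint_le a b f (C : R) : a <= b -> bochner_integrable `]a, b[ f ->
  (forall t, a < t < b -> rnorm (f t) <= C) ->
  rnorm (bochner_integral `]a, b[ f) <= C * (b - a).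
Proof.
move=> ab fi fC; rewrite -lee_fin.
rewrite (le_trans (rnorm_bochner_integral_le _ _ fi))//; first exact: lebesgue_measure_oo_lty.
rewrite (@le_trans _ _ (\int[mu]_(t in `]a, b[) C%:E)%E)//.
  apply: ge0_le_integralW => [||t]; first exact: measurable_itv.
    by move=> t _; exact: rnorm_ge0.
  by rewrite /= in_itv/=; exact: fC.
rewrite integral_cst_lebesgue// lebesgue_measure_itv/= lte_fin.
have [ab'|ba] := ltP a b; first by rewrite -EFinB -EFinM.
by rewrite mule0 lee_fin (_ : b - a = 0) ?mulr0//; apply/eqP; rewrite subr_eq0 eq_le ba ab.
Qed.

Lemma bounded_bochner_integrable a b f g (C : R) : smeasurable g ->
  (forall t, a < t < b -> f t = g t) ->
  (forall t, a < t < b -> rnorm (f t) <= C) -> bochner_integrable `]a, b[ f.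
Proof.
move=> mg fg fC; exists g; split => //.
  by apply: ae_all => t /=; rewrite in_itv/=; exact: fg.
rewrite (@le_lt_trans _ _ (\int[mu]_(t in `]a, b[) `|C|%:E)%E)//.
  apply: ge0_le_integralW => [||t]; first exact: measurable_itv.
    by move=> t _; exact: rnorm_ge0.
  rewrite /= in_itv/=.
  by move=> tab; rewrite -fg// (le_trans (fC t tab))// ler_norm.
by rewrite integral_cst_lebesgue// lte_mul_pinfty//; exact: lebesgue_measure_oo_lty.
Qed.

End Intervals.

(** * Holomorphic semigroups *)

Section HolomorphicSemigroups.
Variable R : realType.

Lemma sector_real (theta t : R) : 0 < theta -> 0 < t -> sector theta t%:C%C.
Proof.
move=> theta0 t0; exists t, 0; split => //; first by rewrite normr0.
by rewrite cos0 sin0 mulr1 mulr0.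
Qed.

Lemma cmod_real (t : R) : cmod t%:C%C = `|t|.
Proof. by rewrite /cmod normc_def /= expr0n /= addr0 sqrtr_sqr. Qed.

(* Only the restriction of the holomorphic extension to the positive half-line
   is used: local boundedness and differentiability in operator norm. *)
Lemma holomorphic_semigroup_real (k : scalar_kind)
    (X : completeNormedModType (scalar_field R k)) (T : R -> {linear X -> X}) :
  holomorphic_semigroup (fun t => T t : X -> X) ->
  (exists M : R, forall t x, 0 < t <= 1 -> rnorm (T t x) <= M * rnorm x) /\
  (forall t, 0 < t -> exists (L : X -> X) (M : R), (forall x, rnorm (L x) <= M * rnorm x) /\
    forall e : R, 0 < e -> exists2 d, 0 < d & forall h x, 0 < h < d ->
      rnorm (T (t + h) x - T t x - of_real k h *: L x) <= e * h * rnorm x).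
Proof.
case: k X T => X T [theta [S [/andP[theta0 _] bS hS ST locb]]].
(* Local boundedness is granted only on smaller sectors, and half the angle still contains the
   positive axis. Over the reals [x] is embedded as [(x, 0)], and the norm of a first component is
   at most the sum norm. *)
- have theta2 : 0 < theta / 2 < theta by lra.
  have N0 (x : X) : `|(x, 0 : X).1| + `|(x, 0 : X).2| = `|x| by rewrite /= normr0 addr0.
  split.
    have [M hM] := locb _ theta2; exists M => t x /andP[t0 t1].
    have /= := hM t%:C%C (sector_real _ t0) _ (x, 0).
    rewrite cmod_real gtr0_norm// => /(_ _ t1); rewrite N0 ST// /=.
    by move=> h; apply: le_trans (h _); [rewrite lerDl|lra].
  move=> t t0; have [L [LD LZ [M LM]] hL] := hS _ (sector_real theta0 t0).
  exists (fun x => (L (x, 0)).1), M; split.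
    by move=> x; have := LM (x, 0); rewrite N0 => h; apply: le_trans h; rewrite lerDl.
  move=> e e0; have [d d0 hd] := hL e e0; exists d => // h x /andP[h0 hd0].
  have th0 : 0 < t + h by rewrite addr_gt0.
  have := hd _ (sector_real theta0 th0).
  have -> : (t + h)%:C%C - t%:C%C = h%:C%C by rewrite -rmorphB /= addrC addKr.
  rewrite cmod_real gtr0_norm// => /(_ hd0 (x, 0)); rewrite N0.
  apply: le_trans; rewrite ST// ST// /= scale0r subr0.
  by rewrite lerDl.
- have theta2 : 0 < theta / 2 < theta by lra.
  split.
    have [M hM] := locb _ theta2; exists M => t x /andP[t0 t1].
    have := hM t%:C%C (sector_real _ t0) _ x.
    rewrite cmod_real gtr0_norm// => /(_ _ t1); rewrite ST//.
    by apply; lra.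
  move=> t t0; have [L [LD LZ [M LM]] hL] := hS _ (sector_real theta0 t0).
  exists L, M; split => // e e0; have [d d0 hd] := hL e e0.
  exists d => // h x /andP[h0 hd0].
  have th0 : 0 < t + h by rewrite addr_gt0.
  have := hd _ (sector_real theta0 th0).
  have -> : (t + h)%:C%C - t%:C%C = h%:C%C by rewrite -rmorphB /= addrC addKr.
  by rewrite cmod_real gtr0_norm// => /(_ hd0 x); rewrite ST// ST.
Qed.

End HolomorphicSemigroups.

(** Increments over equal short steps are summed, and so are their bounds. With [m := id] this says
    that a uniformly vanishing derivative forces constancy; a general [m] allows control by an
    integral, as for absolutely continuous functions. *)
Lemma telescoping (R : realType) (k : scalar_kind)
    (X : normedModType (scalar_field R k)) (F : R -> X) (m : R -> R) (a b : R) :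
  a <= b ->
  (forall e, 0 < e -> exists2 d, 0 < d & forall x y, a <= x -> x <= y -> y <= b ->
     y - x < d -> rnorm (F y - F x) <= e * (m y - m x)) ->
  F b = F a.
Proof.
move=> ab hF; apply/eqP; rewrite -subr_eq0; apply/eqP/rnorm0_eq0/eqP.
rewrite eq_le rnorm_ge0 andbT; apply/ler_addgt0Pr => e e0; rewrite add0r.
(* The added 1 keeps the divisor of [e] positive when [m b = m a]. *)
have c0 : 0 < `|m b - m a| + 1 by rewrite ltr_wpDl.
have [d d0 hd] := hF _ (divr_gt0 e0 c0).
set e' := e / _ in hd.
have e'0 : 0 < e' by rewrite divr_gt0.
have [n hn] : exists n : nat, (b - a) / n.+1%:R < d.
  exists (Num.truncn ((b - a) / d)); rewrite ltr_pdivrMr// -ltr_pdivrMl// mulrC.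
  exact: truncnS_gt.
pose x i := a + i%:R * ((b - a) / n.+1%:R).
have xS i : x i.+1 = x i + (b - a) / n.+1%:R.
  by rewrite /x -addrA -[in LHS]natr1 mulrDl mul1r.
have st0 : 0 <= (b - a) / n.+1%:R by rewrite divr_ge0// subr_ge0.
have ax i : a <= x i by rewrite /x lerDl mulr_ge0.
have xn : x n.+1 = b by rewrite /x mulrCA mulfV// mulr1 addrC subrK.
have xb i : (i <= n.+1)%N -> x i <= b.
  by move=> ni; rewrite -xn /x lerD2l ler_wpM2r// ler_nat.
have H i : (i <= n.+1)%N -> rnorm (F (x i) - F a) <= e' * (m (x i) - m a).
  elim: i => [_|i IH ni]; first by rewrite /x mul0r addr0 !subrr rnorm0 mulr0.
  rewrite (le_trans (rnorm_triangle (F (x i)) _ _))//.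
  have := hd (x i) (x i.+1) (ax i); rewrite xS lerDl => /(_ st0); rewrite -xS => /(_ (xb _ ni)).
  have -> : x i.+1 - x i < d by rewrite xS addrC addKr.
  move=> /(_ isT) h1; have := IH (ltnW ni); lra.
have := H n.+1 (leqnn _); rewrite xn => h; rewrite (le_trans h)//.
rewrite (@le_trans _ _ (e' * (`|m b - m a| + 1)))//.
  by rewrite ler_wpM2l ?(ltW e'0)//; have := ler_norm (m b - m a); lra.
by rewrite /e' divfK// gt_eqF.
Qed.

(** * Orbits of the semigroup and its generator *)

Section SemigroupBasics.
Variables (R : realType) (k : scalar_kind).
Variable X : completeNormedModType (scalar_field R k).
Variables (T : R -> {linear X -> X}) (DA : set X) (A : X -> X).
Hypotheses (T_semigroup : C0_semigroup T)
  (T_holomorphic : holomorphic_semigroup (fun t => T t : X -> X))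
  (T_generator : is_generator T DA (fun x => - A x)).
Implicit Types (x y : X) (s t h : R).

Lemma sg0 x : T 0 x = x.
Proof. by have [_ + _ _] := T_semigroup; apply. Qed.

Lemma sgD s t x : 0 <= s -> 0 <= t -> T (s + t) x = T s (T t x).
Proof. by have [_ _ + _] := T_semigroup; apply. Qed.

Lemma sg_continuous t : 0 <= t -> continuous (T t).
Proof. by have [+ _ _ _] := T_semigroup; apply. Qed.

Lemma sg_right x (e : R) : 0 < e ->
  exists2 d, 0 < d & forall h, 0 <= h < d -> rnorm (T h x - x) < e.
Proof.
move=> e0; have [_ _ _ /(_ x)] := T_semigroup.
move=> /cvg_rnormP/cvgr0Pnorm_lt/(_ _ e0) [d /= d0 hd]; exists d => // h /andP[h0 hd0].
move: h0; rewrite le_eqVlt => /predU1P[<-|h0]; first by rewrite sg0 subrr rnorm0.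
apply: le_lt_trans (ler_norm _) _; apply: hd => //=.
by rewrite sub0r normrN gtr0_norm.
Qed.

(** Near 0 the bound is part of holomorphy; the semigroup law propagates it as a power. Taking it at
    least 1 covers T(0) = I and makes the powers increasing. *)
Lemma sg_bounded (B : R) :
  exists2 M, 1 <= M & forall t x, 0 <= t <= B -> rnorm (T t x) <= M * rnorm x.
Proof.
have [[M0 hM0] _] := holomorphic_semigroup_real T_holomorphic.
pose M1 := Num.max M0 1.
have M11 : 1 <= M1 by rewrite le_max lexx orbT.
have h1 t x : 0 <= t <= 1 -> rnorm (T t x) <= M1 * rnorm x.
  move=> /andP[t0 t1]; move: t0; rewrite le_eqVlt => /predU1P[<-|t0].
    by rewrite sg0 ler_peMl ?rnorm_ge0.
  rewrite (le_trans (hM0 t x _)) ?t0//.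
  by rewrite ler_wpM2r ?rnorm_ge0// le_max lexx.
have H n t x : 0 <= t <= n.+1%:R -> rnorm (T t x) <= M1 ^+ n.+1 * rnorm x.
  elim: n t => [|n IH] t /andP[t0 tn]; first by rewrite expr1 h1// t0.
  have [t1|t1] := leP t 1.
    rewrite (le_trans (h1 t x _)) ?t0// ler_wpM2r ?rnorm_ge0//.
    by rewrite exprS ler_peMr ?exprn_ege1// (le_trans ler01).
  have -> : t = 1 + (t - 1) by rewrite addrC subrK.
  rewrite sgD// ?subr_ge0 ?(ltW t1)//.
  rewrite (le_trans (h1 _ _ _)) ?ler01 ?lexx//.
  rewrite exprS -mulrA ler_wpM2l ?(le_trans ler01)//.
  by apply: IH; rewrite subr_ge0 (ltW t1)/= lerBlDr natr1.
exists (M1 ^+ (Num.truncn B).+1); first exact: exprn_ege1.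
move=> t x /andP[t0 tB]; apply: H; rewrite t0/=.
by rewrite (le_trans tB)// ltW// truncnS_gt.
Qed.

(** [T] is arbitrary at negative times. Freezing it at [T 0] there yields a family that is strongly
    continuous on the whole line, as the measurability lemmas expect. *)
Definition sgp t : {linear X -> X} := T (Num.max 0 t).

Lemma sgpE t : 0 <= t -> sgp t = T t.
Proof. by move=> t0; rewrite /sgp max_r. Qed.

Lemma sg_dist (M B : R) s t x :
  (forall t x, 0 <= t <= B -> rnorm (T t x) <= M * rnorm x) ->
  0 <= s -> s <= t -> t <= B -> rnorm (T t x - T s x) <= M * rnorm (T (t - s) x - x).
Proof.
move=> hM s0 st tB.
have -> : T t x = T s (T (t - s) x) by rewrite -sgD ?subr_ge0// addrC subrK.
by rewrite -linearB hM// s0 (le_trans st).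
Qed.

(** Left continuity follows from right continuity at 0 as well: [sg_dist] factors out the operator
    at the smaller time, which is locally bounded. *)
Lemma sgp_continuous x : continuous (fun t => sgp t x).
Proof.
move=> t; apply/cvg_rnormP/cvgr0Pnorm_lt => e e0.
have [M M1 hM] := sg_bounded (Num.max 0 t + 1).
have M0 : 0 < M by rewrite (lt_le_trans ltr01).
have [d d0 hd] := sg_right x (divr_gt0 e0 M0).
have d10 : 0 < Num.min d 1 by rewrite lt_min d0 ltr01.
apply/nbhs_ballP; exists (Num.min d 1) => // s /=.
rewrite lt_min => /andP[tsd ts1]; rewrite ger0_norm ?rnorm_ge0//.
have key a b : 0 <= a -> a <= b -> b <= Num.max 0 t + 1 -> b - a < d ->
    rnorm (T b x - T a x) < e.
  move=> a0 ab bB bad; rewrite (le_lt_trans (sg_dist x hM a0 ab bB))//.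
  by rewrite mulrC -ltr_pdivlMr// hd// subr_ge0 ab.
have m0 (r : R) : 0 <= Num.max 0 r by rewrite le_max lexx.
rewrite /sgp; have [st|st] := leP s t.
  rewrite rnormB; apply: key => //.
  - by rewrite ge_max m0/= le_max st orbT.
  - by rewrite lerDl.
  - move: tsd; rewrite ltr_norml => /andP[_].
    by rewrite !maxEle; case: ifP; case: ifP; lra.
apply: key => //.
- by rewrite ge_max m0/= le_max (ltW st) orbT.
- move: ts1; rewrite ltr_norml => /andP[+ _].
  by rewrite !maxEle; case: ifP; case: ifP; lra.
- move: tsd; rewrite ltr_norml => /andP[+ _].
  by rewrite !maxEle; case: ifP; case: ifP; lra.
Qed.

Lemma sgp_op_continuous t : continuous (sgp t).
Proof. by apply: sg_continuous; rewrite le_max lexx. Qed.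

Lemma smeasurable_sg (t : R) (g : R -> X) : smeasurable g ->
  smeasurable (fun s => sgp (t - s) (g s)).
Proof.
move=> mg; apply: (@smeasurable_apply _ _ _ (fun s => sgp (t - s))) => // [x|s].
  apply: continuous_smeasurable => s.
  apply: (@continuous_comp _ _ _ (fun s => t - s) (fun r => sgp r x)).
    by apply: cvgB; [exact: cvg_cst|exact: cvg_id].
  exact: sgp_continuous.
exact: sgp_op_continuous.
Qed.

Lemma sgZ t (a : R) x : T t (of_real k a *: x) = of_real k a *: T t x.
Proof. by rewrite linearZ. Qed.

Definition diff_quotient x (h : R) : X := of_real k h^-1 *: (T h x - x).

Lemma generatorP x y : diff_quotient x h @[h --> 0^'+] --> y <-> DA x /\ A x = - y.
Proof.
have [g1 g2] := T_generator; split=> [xy|[/g2 h Ax]]; last by move: h; rewrite Ax opprK.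
have Dx : DA x by apply/g1; exists y.
split => //; apply: oppr_inj; rewrite opprK.
have := g2 x Dx; rewrite -/(diff_quotient x) => h.
exact: (cvg_unique _ h xy).
Qed.

Lemma DA_cvg x : DA x -> diff_quotient x h @[h --> 0^'+] --> - A x.
Proof. by move=> Dx; apply/generatorP; split => //; rewrite opprK. Qed.

(** [DA] is a bare set and [A] a bare function; their linear structure is read off the difference
    quotients. *)
Lemma DA_D x y : DA x -> DA y -> DA (x + y) /\ A (x + y) = A x + A y.
Proof.
move=> /DA_cvg hx /DA_cvg hy.
have /generatorP[] : diff_quotient (x + y) h @[h --> 0^'+] --> (- A x - A y).
  apply: (cvg_trans _ (cvgD hx hy)); apply: near_eq_cvg; apply: nearW => h /=.
  by rewrite /diff_quotient (linearD (T h)) opprD addrACA scalerDr.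
by rewrite opprD !opprK.
Qed.

Lemma DA_Z (a : R) x : DA x ->
  DA (of_real k a *: x) /\ A (of_real k a *: x) = of_real k a *: A x.
Proof.
move=> /DA_cvg hx.
have /generatorP[] : diff_quotient (of_real k a *: x) h @[h --> 0^'+] --> of_real k a *: (- A x).
  apply: (cvg_trans _ (cvg_of_realZ (cvg_cst a) hx)); apply: near_eq_cvg.
  by apply: nearW => h /=; rewrite /diff_quotient (linearZ_LR (T h)) -scalerBr !scalerA mulrC.
by rewrite scalerN opprK.
Qed.

Lemma DA_B x y : DA x -> DA y -> DA (x - y) /\ A (x - y) = A x - A y.
Proof.
move=> Dx Dy; have [] := DA_Z (-1) Dy; rewrite of_realN of_real1 !scaleN1r => Dy' Ay'.
by have [? ->] := DA_D Dx Dy'; rewrite Ay'.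
Qed.

Lemma DA_0 : DA 0 /\ A 0 = 0.
Proof.
have /generatorP[] : diff_quotient 0 h @[h --> 0^'+] --> (0 : X).
  rewrite (_ : diff_quotient 0 = fun=> 0); first exact: cvg_cst.
  by apply/funext => h; rewrite /diff_quotient (linear0 (T h)) subrr scaler0.
by rewrite oppr0.
Qed.

Lemma DA_sg t x : 0 <= t -> DA x -> DA (T t x) /\ A (T t x) = T t (A x).
Proof.
move=> t0 /DA_cvg hx.
have /generatorP[] : diff_quotient (T t x) h @[h --> 0^'+] --> T t (- A x).
  have hTx : T t (diff_quotient x h) @[h --> 0^'+] --> T t (- A x).
    exact: (cvg_comp _ _ hx (sg_continuous t0 (x := - A x))).
  apply: (cvg_trans _ hTx).
  apply: near_eq_cvg; near=> h.
  have h0 : 0 <= h by near: h; exact: nbhs_right_ge.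
  have hE : T h (T t x) = T t (T h x) by rewrite -!sgD// addrC.
  by rewrite /= /diff_quotient sgZ (linearB (T t)) hE.
by rewrite (linearN (T t)) opprK.
Unshelve. all: by end_near. Qed.

Lemma DA_small x (e : R) : DA x -> 0 < e ->
  exists2 d, 0 < d & forall h, 0 <= h < d -> rnorm (T h x - x + of_real k h *: A x) <= e * h.
Proof.
move=> /DA_cvg /cvg_rnormP/cvgr0Pnorm_lt h e0.
have [d /= d0 hd] := h _ e0; exists d => // r /andP[r0 rd].
move: r0; rewrite le_eqVlt => /predU1P[<-|r0].
  by rewrite sg0 subrr of_real0 scale0r addr0 rnorm0 mulr0.
have : rnorm (diff_quotient x r + A x) < e.
  have := hd r; rewrite /= sub0r normrN gtr0_norm// opprK => /(_ rd r0).
  exact: le_lt_trans (ler_norm _).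
have -> : T r x - x + of_real k r *: A x = of_real k r *: (diff_quotient x r + A x).
  by rewrite scalerDr scalerA -of_realM mulfV ?gt_eqF// of_real1 scale1r.
by rewrite rnormZ gtr0_norm// mulrC => /ltW ?; rewrite ler_wpM2r// ltW.
Qed.

(** Since T(h) T(t) = T(t+h), the difference quotient of T(t)x at 0 is that of the orbit of x at t.
    It converges to [L x], so -A T(t) is the bounded operator [L]. *)
Lemma sg_DA t : 0 < t -> exists C : R, forall x, DA (T t x) /\ rnorm (A (T t x)) <= C * rnorm x.
Proof.
move=> t0; have [_ /(_ t t0)[L [M [LM hL]]]] := holomorphic_semigroup_real T_holomorphic.
exists M => x.
have /generatorP[DT AT] : diff_quotient (T t x) h @[h --> 0^'+] --> L x.
  apply/cvg_rnormP/cvgr0Pnorm_lt => e e0.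
  have x0 : 0 < rnorm x + 1 by rewrite ltr_wpDl ?rnorm_ge0.
  have [d d0 hd] := hL _ (divr_gt0 e0 x0).
  near=> h.
  have h0 : 0 < h by near: h; exact: nbhs_right_gt.
  have hdd : h < d by near: h; exact: nbhs_right_lt.
  have -> : diff_quotient (T t x) h - L x =
      of_real k h^-1 *: (T (t + h) x - T t x - of_real k h *: L x).
    rewrite scalerBr scalerA -of_realM mulVf ?gt_eqF// of_real1 scale1r.
    by rewrite /diff_quotient [t + h]addrC sgD// ltW.
  rewrite rnormZ ger0_norm; last by rewrite mulr_ge0 ?rnorm_ge0.
  rewrite gtr0_norm ?invr_gt0// mulrC ltr_pdivrMr//.
  rewrite (le_lt_trans (hd h x _)) ?h0// mulrAC ltr_pM2r//.
  by rewrite -mulrA gtr_pMr// mulrC ltr_pdivrMr// mul1r ltrDl.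
by rewrite AT rnormN.
Unshelve. all: by end_near. Qed.

End SemigroupBasics.

(** * The mild solution formula *)

Lemma lebesgue_measure_oo (R : realType) (a b : R) : a <= b ->
  lebesgue_measure `]a, b[%classic = (b - a)%:E.
Proof.
move=> ab; rewrite lebesgue_measure_itv/= lte_fin.
have [ab'|ba] := ltP a b; first by rewrite -EFinB.
by congr EFin; apply/esym/eqP; rewrite subr_eq0 eq_le ba ab.
Qed.

Lemma subr_telescope (V : zmodType) (a c i j : V) :
  a - (i + j) - (c - i) = a - c - j.
Proof.
by rewrite opprB [i - c]addrC addrA addrAC opprD [- i - j]addrC addrA subrK addrAC.
Qed.

Section MildFormula.
Variables (R : realType) (k : scalar_kind).
Variable X : completeNormedModType (scalar_field R k).
Local Notation mu := (@lebesgue_measure R).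
Variables (T : R -> {linear X -> X}) (DA : set X) (A : X -> X).
Hypotheses (T_semigroup : C0_semigroup T)
  (T_holomorphic : holomorphic_semigroup (fun t => T t : X -> X))
  (T_generator : is_generator T DA (fun x => - A x)).
Implicit Types (x y z : X) (a b c s t : R) (f g u v : R -> X).

Lemma sg_orbit_integrable a b z : 0 <= a -> bochner_integrable `]a, b[ (fun s => T s z).
Proof.
move=> a0; have [M _ hM] := sg_bounded T_semigroup T_holomorphic b.
apply: (@bounded_bochner_integrable _ _ _ _ _ _ (fun s => sgp T s z) (M * rnorm z)).
- exact/continuous_smeasurable/(sgp_continuous T_semigroup T_holomorphic).
- by move=> t /andP[at_ _]; rewrite sgpE// (le_trans a0)// ltW.
- by move=> t /andP[at_ tb]; rewrite hM// (le_trans a0 (ltW at_)) ltW.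
Qed.

(** The orbit plus the integral of its negative derivative is constant by [telescoping]. Factoring
    out T(r) at the left end of each step leaves only the behaviour at time 0 of the orbits of [y]
    and [A y], hence one step size for all [r]. *)
Lemma sg_FTC y a b : DA y -> 0 <= a <= b ->
  T b y - T a y = - bochner_integral `]a, b[ (fun s => T s (A y)).
Proof.
move=> Dy /andP[a0 ab].
pose F t := T t y + bochner_integral `]a, t[ (fun s => T s (A y)).
suff : F b = F a.
  by rewrite /F [in RHS]bint_nil// addr0 => <-; rewrite opprD addrA subrr sub0r.
have [M M1 hM] := sg_bounded T_semigroup T_holomorphic b.
have M0 : 0 < M by rewrite (lt_le_trans ltr01).
apply: (@telescoping _ _ _ F id) => // e e0.
have e20 : 0 < e / (2 * M) by rewrite divr_gt0// mulr_gt0.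
have hMe : M * (e / (2 * M)) = e / 2 by field; rewrite gt_eqF.
have [d1 d10 hd1] := DA_small T_semigroup T_generator Dy e20.
have [d2 d20 hd2] := sg_right T_semigroup (A y) e20.
exists (Num.min d1 d2) => [|r q ar rq qb]; rewrite lt_min; first by rewrite d10.
move=> /andP[qr1 qr2].
have r0 := le_trans a0 ar.
have -> : F q - F r = T r (T (q - r) y - y + of_real k (q - r) *: A y) +
    bochner_integral `]r, q[ (fun s => T s (A y) - T r (A y)).
  have iq := sg_orbit_integrable q (A y) a0.
  have irq := sg_orbit_integrable q (A y) r0.
  have [_ ->] := bochner_integralB (measurable_itv _) (lebesgue_measure_oo_lty _ _) irq
    (bochner_integrable_cst (measurable_itv _) (lebesgue_measure_oo_lty r q) (T r (A y))).1.
  rewrite bint_cst// (linearD (T r)) (linearB (T r)) sgZ -(sgD T_semigroup)// ?subr_ge0//.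
  rewrite [r + _]addrC subrK.
  rewrite /F (@bint_split _ _ _ a r q) ?ar// opprD addrACA.
  rewrite -[RHS]addrA [_ *: _ + _]addrC subrK; congr (_ + _).
  by rewrite [X in X - _]addrC addrK.
rewrite (le_trans (rnormD _ _))// [e]splitr mulrDl lerD//.
  rewrite (le_trans (hM _ _ _)) ?r0 ?(le_trans rq)//.
  rewrite -hMe -mulrA ler_wpM2l ?(ltW M0)//.
  by rewrite hd1// subr_ge0 rq.
apply: rnorm_bint_le => //.
  have irq := sg_orbit_integrable q (A y) r0.
  by have [] := bochner_integralB (measurable_itv _) (lebesgue_measure_oo_lty _ _) irq
    (bochner_integrable_cst (measurable_itv _) (lebesgue_measure_oo_lty r q) (T r (A y))).1.
move=> t /andP[rt tq].
rewrite (le_trans (sg_dist T_semigroup _ hM r0 (ltW rt) (le_trans (ltW tq) qb)))//.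
rewrite -hMe ler_wpM2l ?(ltW M0)// ltW// hd2//; apply/andP; split; lra.
Qed.

Lemma convolution_integrable f t a b : b <= t -> bochner_integrable `]a, b[ f ->
  bochner_integrable `]a, b[ (fun s => T (t - s) (f s)).
Proof.
move=> bt [g [mg fg ig]].
have [M M1 hM] := sg_bounded T_semigroup T_holomorphic (t - a).
exists (fun s => sgp T (t - s) (g s)); split.
- exact: smeasurable_sg.
- apply: ae_mono fg => s h; rewrite /= in_itv/= => /andP[as_ sb].
  have ts : 0 <= t - s by lra.
  by rewrite sgpE// h// /= in_itv/= as_ sb.
apply: (@le_lt_trans _ _ (M%:E * \int[mu]_(s in `]a, b[) (rnorm (g s))%:E)%E).
  rewrite -ge0_integralZl_EFin//; last 3 first.
  - by move=> s _; rewrite lee_fin rnorm_ge0.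
  - exact: measurable_rnorm_EFin.
  - by rewrite (le_trans ler01).
  under [leRHS]eq_integral do rewrite -EFinM.
  apply: ge0_le_integralW => [|s _|s]; [exact: measurable_itv|exact: rnorm_ge0|].
  rewrite /= in_itv/= => /andP[as_ sb].
  have ts : 0 <= t - s by lra.
  rewrite sgpE//.
  by apply: hM; apply/andP; split; lra.
by rewrite lte_mul_pinfty// lee_fin (le_trans ler01).
Qed.

Lemma sg_FTC_reflect y t a b : DA y -> a <= b <= t ->
  T (t - b) y - T (t - a) y = bochner_integral `]a, b[ (fun s => T (t - s) (A y)).
Proof.
move=> Dy /andP[ab bt].
have i := sg_orbit_integrable (t - a) (A y) (_ : 0 <= t - b).
have tb : 0 <= t - b by rewrite subr_ge0.
have := (bint_reflect t (i tb)).2; rewrite !subKr => ->.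
by rewrite -[RHS]opprK -sg_FTC// ?opprB// tb lerD2l lerN2.
Qed.

(** Real-valued so that [rnorm_mass g 0] can serve as the control function in [telescoping]. *)
Definition rnorm_mass g s t : R :=
  fine (\int[mu]_(r in `]s, t[) (rnorm (g r))%:E)%E.

Lemma rnorm_massP g b s t : smeasurable g ->
  (\int[mu]_(r in `]0%R, b[) (rnorm (g r))%:E < +oo)%E -> 0 <= s -> s <= t -> t <= b ->
  [/\ (\int[mu]_(r in `]s, t[) (rnorm (g r))%:E = (rnorm_mass g s t)%:E)%E,
    0 <= rnorm_mass g s t &
    rnorm_mass g s t <= rnorm_mass g 0 t - rnorm_mass g 0 s].
Proof.
move=> mg ig s0 st tb.
have fin a c : 0 <= a -> c <= b ->
    (\int[mu]_(r in `]a, c[) (rnorm (g r))%:E = (rnorm_mass g a c)%:E)%E.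
  move=> a0 cb; rewrite fineK// ge0_fin_numE; last first.
    by apply: integral_ge0 => r _; rewrite lee_fin rnorm_ge0.
  apply: le_lt_trans ig; apply: ge0_subset_integralW; try exact: measurable_itv.
    exact: subitvoo.
  by move=> r _; exact: rnorm_ge0.
split; first exact: fin.
  by apply: fine_ge0; apply: integral_ge0 => r _; rewrite lee_fin rnorm_ge0.
rewrite lerBrDl -lee_fin EFinD -!fin// ?(le_trans st)//.
rewrite -ge0_integral_setU; try exact: measurable_itv; last 3 first.
- exact: measurable_rnorm_EFin.
- by move=> r _; rewrite lee_fin rnorm_ge0.
- apply/disj_setPS => r /= []; rewrite !in_itv/= => /andP[_ rs] /andP[sr _].
  by have := lt_trans rs sr; rewrite ltxx.
apply: ge0_subset_integralW.
- by apply: measurableU; exact: measurable_itv.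
- exact: measurable_itv.
- by move=> r [|]; apply: subitvoo.
- by move=> r _; exact: rnorm_ge0.
Qed.

(* [T e] makes the generator bounded. For [s] in [[x, y]] the increments of
   [s |-> T(t-s) T(e) u(s) - \int_0^s T(t-r) T(e) f(r) dr] are then bounded by
   [(y - x) \int_x^y |v|] up to a constant. *)
Lemma regularized_mild_formula (b : R) (t e : R) u v f : 0 < e -> 0 <= t <= b ->
  bochner_integrable `]0, b[ v -> bochner_integrable `]0, b[ f ->
  (forall t, 0 <= t <= b -> u t = u 0 + bochner_integral `]0, t[ v) ->
  {ae mu, forall t, 0 < t < b -> DA (u t) /\ v t + A (u t) = f t} ->
  T e (u t) = T e (T t (u 0) + convolution T f t).
Proof.
move=> e0 /andP[t0 tb] iv if_ uE aeu.
have [g gv] := iv; have [mg aeg ig] := gv.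
have [M M1 hM] := sg_bounded T_semigroup T_holomorphic t.
have M0 : 0 < M by rewrite (lt_le_trans ltr01).
have [C0 hC0] := sg_DA T_semigroup T_holomorphic T_generator e0.
pose C := `|C0| + 1.
have Cp : 0 < C by rewrite /C ltr_wpDl.
have DTe x : DA (T e x) by have [] := hC0 x.
have hC x : rnorm (A (T e x)) <= C * rnorm x.
  rewrite (le_trans (hC0 x).2)// ler_wpM2r ?rnorm_ge0//.
  by rewrite /C; have := ler_norm C0; lra.
have e0' : 0 <= e by exact: ltW.
have [Me _ hMe] := sg_bounded T_semigroup T_holomorphic e.
have Tei (a c : R) (h : R -> X) : bochner_integrable `]a, c[ h ->
    bochner_integrable `]a, c[ (fun s => T e (h s)) /\
    bochner_integral `]a, c[ (fun s => T e (h s)) = T e (bochner_integral `]a, c[ h).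
  move=> ih; apply: (@bochner_integral_linear _ _ _ _ _ _ (T e) Me) => //.
  - exact: lebesgue_measure_oo_lty.
  - by move=> x y; rewrite linearD.
  - by move=> x y; rewrite sgZ.
  - by move=> x; apply: hMe; rewrite e0' lexx.
have Tti (a c r : R) (h : R -> X) : 0 <= r <= t -> bochner_integrable `]a, c[ h ->
    bochner_integrable `]a, c[ (fun s => T r (h s)) /\
    bochner_integral `]a, c[ (fun s => T r (h s)) = T r (bochner_integral `]a, c[ h).
  move=> rt ih; apply: (@bochner_integral_linear _ _ _ _ _ _ (T r) M) => //.
  - exact: lebesgue_measure_oo_lty.
  - by move=> x y; rewrite linearD.
  - by move=> x y; rewrite sgZ.
  - by move=> x; exact: hM.
have sub (a c : R) (h : R -> X) : 0 <= a -> c <= b -> bochner_integrable `]0, b[ h ->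
  bochner_integrable `]a, c[ h by exact: bochner_integrable_sub.
pose w s := T (t - s) (T e (f s)).
have wi (a c : R) : 0 <= a -> c <= t -> bochner_integrable `]a, c[ w.
  move=> a0 ct; apply: convolution_integrable => //.
  by apply: (Tei _ _ _ _).1; apply: sub => //; exact: le_trans tb.
pose F (x : R) := T (t - x) (T e (u x)) - bochner_integral `]0, x[ w.
have F0 : F 0 = T e (T t (u 0)).
  by rewrite /F bint_nil// !subr0 -!sgD// addrC.
have Ft : F t = T e (u t) - T e (convolution T f t).
  rewrite /F subrr (sg0 T_semigroup); congr (_ - _).
  have ict : bochner_integrable `]0, t[ (fun s => T (t - s) (f s)).
    by apply: convolution_integrable => //; exact: sub.
  rewrite /convolution -(Tei _ _ _ ict).2; apply: eq_bochner_integral => s /=.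
  rewrite in_itv/= => /andP[s0 st].
  by rewrite /w -!sgD ?subr_ge0 ?(ltW st)// addrC.
suff FE : F t = F 0 by rewrite linearD -F0 -FE Ft subrK.
apply: (@telescoping _ _ _ F (rnorm_mass g 0)) => // d d0.
have MC0 : 0 < M * C by rewrite mulr_gt0.
(* The two error terms each integrate to at most [M * C * (y - x) * mm], where [mm] is the mass of
   |v| on the step. *)
exists (d / (2 * (M * C))) => [|x y x0 xy yt yxd]; first by rewrite divr_gt0// mulr_gt0.
have yb := le_trans yt tb; have y0 := le_trans x0 xy.
pose mm := rnorm_mass g x y.
have [mmE mm0 mmle] := rnorm_massP mg ig x0 xy yb.
have vE : u y - u x = bochner_integral `]x, y[ v.
  have xb := le_trans xy yb.
  rewrite (uE y) ?y0// (uE x) ?x0// (@bint_split _ _ _ 0 x y) ?x0//; last exact: sub.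
  by rewrite opprD addrACA subrr add0r addrAC subrr add0r.
have v_le s : x <= s -> s <= y -> rnorm (u s - u x) <= mm.
  move=> xs sy; have sb := le_trans sy yb; have s0 := le_trans x0 xs.
  have -> : u s - u x = bochner_integral `]x, s[ v.
    have xb := le_trans xs sb.
    have u1 := uE s; rewrite s0 sb in u1; rewrite (u1 isT).
    have u2 := uE x; rewrite x0 xb in u2; rewrite (u2 isT).
    rewrite (@bint_split _ _ _ 0 x s) ?x0//; last exact: sub.
    by rewrite opprD addrACA subrr add0r addrAC subrr add0r.
  rewrite -lee_fin -mmE (le_trans (rnorm_bochner_integral_le _ _ (sub _ _ _ x0 sb iv)))//.
    exact: lebesgue_measure_oo_lty.
  apply: (@le_trans _ _ (\int[mu]_(r in `]x, s[) (rnorm (g r))%:E)%E).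
    apply: ge0_ae_le_integral; [exact: measurable_itv|..].
    - by move=> r _; exact: rnorm_ge0.
    - by move=> r _; exact: rnorm_ge0.
    apply: ae_mono aeg => r h xsr; rewrite h//.
    exact: subitvoo xsr.
  apply: ge0_subset_integralW; try exact: measurable_itv; first exact: subitvoo.
  by move=> r _; exact: rnorm_ge0.
(* The increment of [F] is split with [u] frozen at [x]: [phi1] integrates to T(t-y) T(e) (u(y) -
   u(x)) and [phi2] to (T(t-y) - T(t-x)) T(e) u(x). *)
pose z := A (T e (u x)).
pose phi1 s := T (t - y) (T e (v s)).
pose phi2 s := T (t - s) z.
have ty0 : 0 <= t - y <= t by apply/andP; split; lra.
have ivxy := sub _ _ _ x0 yb iv.
have [iTev TevE] := Tei _ _ _ ivxy.
have [i1 phi1E] := Tti _ _ _ _ ty0 iTev.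
have i2 : bochner_integrable `]x, y[ phi2.
  apply: convolution_integrable => //.
  exact: (bochner_integrable_cst (measurable_itv _) (lebesgue_measure_oo_lty _ _) _).1.
have iw := wi _ _ x0 yt.
have [i12 i12E] := bochner_integralD (measurable_itv _) (lebesgue_measure_oo_lty _ _) i1 i2.
have [i3 i3E] := bochner_integralB (measurable_itv _) (lebesgue_measure_oo_lty _ _) i12 iw.
have FE : F y - F x = bochner_integral `]x, y[ (fun s => phi1 s + phi2 s - w s).
  rewrite i3E i12E phi1E TevE -vE -(sg_FTC_reflect (DTe (u x)) (a := x) (b := y)) ?xy//.
  rewrite /F (@bint_split _ _ _ 0 x y) ?x0//; last exact: wi.
  rewrite (linearB (T e)) (linearB (T (t - y))) [in RHS]addrA subrK.
  exact: subr_telescope.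
rewrite FE -lee_fin (le_trans (rnorm_bochner_integral_le _ _ i3))//.
  exact: lebesgue_measure_oo_lty.
pose K := M * C * (y - x).
have K0 : 0 <= K by rewrite mulr_ge0 ?subr_ge0// ltW.
(* Substituting f = v + A u leaves two errors: moving T(t-s) to T(t-y) on T(e) v(s), which costs (y
   - s) |A T(e) v(s)|, and freezing u(s) at u(x), which costs |u(s) - u(x)| <= [mm]. *)
have pw : {ae mu, forall s, `]x, y[%classic s ->
    rnorm (phi1 s + phi2 s - w s) <= K * rnorm (g s) + M * C * mm}.
  apply: ae_mono (ae_and aeg aeu) => s [hg hu] /=; rewrite in_itv/= => /andP[xs sy].
  have s0b : 0 < s < b by rewrite (le_lt_trans x0)//= (lt_le_trans sy).
  have [Du fE] := hu s0b.
  have -> : phi1 s + phi2 s - w s =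
      - (T (t - s) (T e (v s)) - T (t - y) (T e (v s))) - T (t - s) (A (T e (u s)) - z).
    rewrite /w -fE (DA_sg T_semigroup T_generator (ltW e0) Du).2 /phi1 /phi2.
    rewrite (linearD (T e)) (linearD (T (t - s))) (linearB (T (t - s))).
    by rewrite !opprB opprD addrACA.
  rewrite (le_trans (rnormD _ _))// !rnormN lerD//.
    rewrite rnormB (sg_FTC_reflect (DTe (v s)) (a := s) (b := y)) ?(ltW sy)//.
    apply: (@le_trans _ _ (M * (C * rnorm (v s)) * (y - s))).
      apply: rnorm_bint_le; first exact: ltW.
        apply: convolution_integrable => //.
        exact: (bochner_integrable_cst (measurable_itv _) (lebesgue_measure_oo_lty _ _) _).1.
      move=> r /andP[sr ry].
      rewrite (le_trans (hM _ _ _))//; first by apply/andP; split; lra.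
      by rewrite ler_wpM2l ?(ltW M0).
    rewrite hg /=; last by rewrite in_itv/=.
    have -> : M * (C * rnorm (g s)) * (y - s) = M * C * rnorm (g s) * (y - s) by ring.
    have -> : K * rnorm (g s) = M * C * rnorm (g s) * (y - x) by rewrite /K; ring.
    by rewrite ler_wpM2l ?mulr_ge0 ?rnorm_ge0 ?(ltW M0) ?(ltW Cp)//; lra.
  rewrite (le_trans (hM _ _ _))//; first by apply/andP; split; lra.
  rewrite -mulrA ler_wpM2l ?(ltW M0)// /z.
  have [_ <-] := DA_B T_generator (DTe (u s)) (DTe (u x)).
  rewrite -(linearB (T e)) (le_trans (hC _))// ler_wpM2l ?(ltW Cp)//.
  by apply: v_le; exact: ltW.
apply: (@le_trans _ _ (\int[mu]_(s in `]x, y[) (K * rnorm (g s) + M * C * mm)%:E)%E).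
  apply: ge0_ae_le_integral => [|s _|s _|]; [exact: measurable_itv|exact: rnorm_ge0| |exact: pw].
  by rewrite addr_ge0//; [rewrite mulr_ge0// rnorm_ge0|rewrite mulr_ge0// ltW].
under eq_integral do rewrite EFinD EFinM.
rewrite ge0_integralD//; try exact: measurable_itv; last 3 first.
- by move=> s _; rewrite mule_ge0 ?lee_fin ?rnorm_ge0.
- by apply: emeasurable_funM => //; exact: measurable_rnorm_EFin.
- by move=> s _; rewrite lee_fin mulr_ge0// ltW.
rewrite ge0_integralZl_EFin//; try exact: measurable_itv; last 2 first.
- by move=> s _; rewrite lee_fin rnorm_ge0.
- exact: measurable_rnorm_EFin.
rewrite integral_cst_lebesgue ?mmE; last exact: measurable_itv.
rewrite lebesgue_measure_oo//.
rewrite -!EFinM -EFinD lee_fin.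
apply: (@le_trans _ _ (d * mm)); last by rewrite ler_wpM2l// ltW.
have -> : K * mm + M * C * mm * (y - x) = (y - x) * (2 * (M * C)) * mm by rewrite /K; ring.
by rewrite ler_wpM2r// ltW// -ltr_pdivlMr// mulr_gt0.
Qed.

(** Both sides agree after applying T(r) for every r > 0; strong continuity at 0 removes T(r). *)
Lemma mild_formula (b : R) u v f :
  bochner_integrable `]0, b[ v -> bochner_integrable `]0, b[ f ->
  (forall t, 0 <= t <= b -> u t = u 0 + bochner_integral `]0, t[ v) ->
  {ae mu, forall t, 0 < t < b -> DA (u t) /\ v t + A (u t) = f t} ->
  forall t, 0 <= t <= b -> u t = T t (u 0) + convolution T f t.
Proof.
move=> iv if_ uE aeu t tb; apply: rnorm_le_eps => e e0.
set y := T t (u 0) + _.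
have e20 : 0 < e / 2 by rewrite divr_gt0.
have [d1 d10 h1] := sg_right T_semigroup (u t) e20.
have [d2 d20 h2] := sg_right T_semigroup y e20.
pose r := Num.min d1 d2 / 2.
have m0 : 0 < Num.min d1 d2 by rewrite lt_min d10.
have r0 : 0 < r by rewrite divr_gt0.
have rm : r < Num.min d1 d2 by rewrite /r; lra.
move: (rm); rewrite lt_min => /andP[r1 r2].
have := h1 r; rewrite (ltW r0) r1 => /(_ isT) h1r.
have := h2 r; rewrite (ltW r0) r2 => /(_ isT) h2r.
rewrite (le_trans (rnorm_triangle (T r (u t)) _ _))//.
rewrite (regularized_mild_formula r0 tb iv if_ uE aeu) in h1r *.
by rewrite rnormB -/y; rewrite -/y in h1r; lra.
Qed.

End MildFormula.

(** * Lebesgue points *)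

Section LebesguePoints.
Variables (R : realType) (k : scalar_kind).
Variable X : completeNormedModType (scalar_field R k).
Local Notation mu := (@lebesgue_measure R).
Implicit Types (f g : R -> X).

(** The averages run over balls of length 2h; restricting to the right half turns the bound e/2 on
    the average into e h for the integral. *)
Lemma lebesgue_pt_right (r : R -> R) t (e : R) : lebesgue_pt r t -> 0 < e ->
  exists2 d, 0 < d & forall h, 0 < h < d ->
    (\int[mu]_(s in `]t, (t + h)%R[) `|r s - r t|%:E <= (e * h)%:E)%E.
Proof.
move=> rt e0.
have e20 : 0 < e / 2 by rewrite divr_gt0.
have [d /= d0 hd] : \forall h \near (0:R)^'+, (davg r t h < (e / 2)%:E)%E.
  by apply: (rt [set y | (y < (e / 2)%:E)%E]); exact: (@nbhs_open_ereal_lt _ 0 (fun=> e / 2)).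
exists d => // h /andP[h0 hdd].
have := hd h; rewrite /= sub0r normrN gtr0_norm// => /(_ hdd h0).
rewrite /davg /iavg lebesgue_measure_ball ?(ltW h0)//.
have h20 : 0 < h *+ 2 by rewrite mulrn_wgt0.
rewrite inver gt_eqF// lte_pdivrMl// => hI.
apply: (@le_trans _ _ (\int[mu]_(y in ball t h) `|r y - r t|%:E)%E); last first.
  apply: (le_trans (ltW hI)); rewrite -EFinM lee_fin -mulr_natl; lra.
apply: ge0_subset_integralW => //; first exact: measurable_ball.
move=> s /=; rewrite in_itv/= => /andP[ts sth].
by rewrite /ball /= ltr0_norm; lra.
Qed.

(** Reduction to the scalar theorem for the countably many functions |g - y_j|, with y_j
    approximating the range. At a common Lebesgue point, choosing y_j close to g(t) gives |g(s) -
    g(t)| <= | |g(s) - y_j| - |g(t) - y_j| | + 2 |g(t) - y_j|. *)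
Lemma bochner_lebesgue_points (b : R) f : bochner_integrable `]0, b[ f ->
  {ae mu, forall t, 0 < t < b -> forall e : R, 0 < e -> exists2 d, 0 < d &
    forall h, 0 < h < d -> t + h <= b ->
    (\int[mu]_(s in `]t, (t + h)%R[) (rnorm (f s - f t))%:E <= (e * h)%:E)%E}.
Proof.
move=> [g [mg fg ig]].
have mD : measurable (`]0, b[%classic : set R) by exact: measurable_itv.
(* Extension by zero gives integrability on the whole line, hence local integrability of each
   [phi j] there. *)
pose g0 t := if t \in `]0, b[%classic then g t else 0.
have mg0 : smeasurable g0 by apply: smeasurable_if => //; exact: smeasurable_cst.
have [y_ hy] := smeasurable_near_range mg0.
have ig0 : (\int[mu]_t (rnorm (g0 t))%:E < +oo)%E.
  apply: le_lt_trans ig; rewrite [leRHS]integral_mkcond restrict_EFin.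
  apply: ge0_le_integralW => // t _; first exact: rnorm_ge0.
  by rewrite patchE /g0; case: ifP => // _; rewrite rnorm0.
pose phi j t := rnorm (g0 t - y_ j).
have loc j : locally_integrable setT (phi j).
  split; [exact: smeasurable_dist|exact: openT|move=> K _ cK].
  have mK : measurable K by exact: compact_measurable.
  apply: (@le_lt_trans _ _ (\int[mu]_(t in K) (rnorm (g0 t))%:E +
      \int[mu]_(t in K) (rnorm (y_ j))%:E)%E).
    rewrite -ge0_integralD//; last 3 first.
    - by move=> t _; rewrite lee_fin rnorm_ge0.
    - exact: measurable_rnorm_EFin.
    - by move=> t _; rewrite lee_fin rnorm_ge0.
    under [leRHS]eq_integral do rewrite -EFinD.
    apply: ge0_le_integralW => // t _.
    by rewrite ger0_norm ?rnorm_ge0// (le_trans (rnormD _ _))// rnormN.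
  apply: lte_add_pinfty.
    by apply: le_lt_trans ig0; apply: ge0_subset_integralW => // t _; exact: rnorm_ge0.
  rewrite integral_cst_lebesgue// lte_mul_pinfty ?lee_fin ?rnorm_ge0//.
  exact: compact_finite_measure.
have aej : {ae mu, forall t, forall j, lebesgue_pt (phi j) t}.
  apply: ae_foralln => j; exact: lebesgue_differentiation.
apply: ae_mono (ae_and fg aej) => t [fgt leb] /andP[t0 tb] e e0.
have e40 : 0 < e / 4 by rewrite divr_gt0.
have tD : (`]0, b[%classic : set R) t by rewrite /= in_itv/= t0.
have [j hj] := hy t _ e40.
have [d d0 hd] := lebesgue_pt_right (leb j) e40.
exists d => // h hh thb.
have /andP[h0 _] := hh.
apply: (@le_trans _ _ (\int[mu]_(s in `]t, (t + h)%R[) (`|phi j s - phi j t| + e / 2)%:E)%E).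
  apply: ge0_ae_le_integral => [|s _|s _|]; [exact: measurable_itv|exact: rnorm_ge0| |].
    by rewrite addr_ge0// ltW// divr_gt0.
  apply: ae_mono fg => s fgs /=; rewrite in_itv/= => /andP[ts sth].
  have sD : (`]0, b[%classic : set R) s.
    by rewrite /= in_itv/= (lt_trans t0)//= (lt_le_trans sth).
  rewrite fgs// fgt//.
  have -> : g s = g0 s by rewrite /g0 mem_set.
  have -> : g t = g0 t by rewrite /g0 mem_set.
  rewrite (le_trans (rnorm_triangle (y_ j) _ _))// [X in _ + X]rnormB.
  rewrite -/(phi j s) -/(phi j t).
  have := ler_norm (phi j s - phi j t); move: hj; rewrite -/(phi j t); lra.
under eq_integral do rewrite EFinD.
rewrite ge0_integralD//; last 2 first.
- apply/measurable_EFinP/measurable_funTS; apply: measurableT_comp => //.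
  by apply: measurable_funB; [exact: smeasurable_dist|exact: measurable_cst].
- by move=> s _; rewrite lee_fin ltW// divr_gt0.
rewrite integral_cst_lebesgue; last exact: measurable_itv.
rewrite lebesgue_measure_oo; last by rewrite lerDl ltW.
have -> : t + h - t = h by ring.
rewrite -EFinM.
apply: (le_trans (leeD (hd h hh) (lexx _))).
rewrite -EFinD lee_fin; have : 0 < e * h by rewrite mulr_gt0.
lra.
Qed.

End LebesguePoints.

(** * Strong solutions and the trace space *)

Section StrongSolutions.
Variables (R : realType) (k : scalar_kind).
Variable X : completeNormedModType (scalar_field R k).
Local Notation mu := (@lebesgue_measure R).
Variables (T : R -> {linear X -> X}) (DA : set X) (A : X -> X) (p tau : R).
Hypotheses (T_semigroup : C0_semigroup T)
  (T_holomorphic : holomorphic_semigroup (fun t => T t : X -> X))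
  (T_generator : is_generator T DA (fun x => - A x))
  (tau_gt0 : 0 < tau) (p_gt1 : 1 < p).
Implicit Types (f g u v w : R -> X).

Local Notation strong := (strong_solution p tau DA A).
Local Notation LpX := (@Lp R k X p tau).

Let mD : measurable (`]0, tau[%classic : set R). Proof. exact: measurable_itv. Qed.

Let Dfin : (mu `]0%R, tau[%classic < +oo)%E. Proof. exact: lebesgue_measure_oo_lty. Qed.

Lemma Lp_integrable f : LpX f -> bochner_integrable `]0, tau[ f.
Proof. exact: Lp_bochner_integrable. Qed.

Lemma Lp_integrable_sub f (a b : R) : LpX f -> 0 <= a -> b <= tau ->
  bochner_integrable `]a, b[ f.
Proof. by move=> /Lp_integrable h a0 bt; apply: bochner_integrable_sub h. Qed.

Lemma W1p_derivativeD u1 v1 u2 v2 :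
  W1p_derivative p tau u1 v1 -> W1p_derivative p tau u2 v2 ->
  W1p_derivative p tau (fun t => u1 t + u2 t) (fun t => v1 t + v2 t).
Proof.
move=> [lu1 lv1 e1] [lu2 lv2 e2].
split; [exact: (LpD p_gt1 mD lu1 lu2)|exact: (LpD p_gt1 mD lv1 lv2)|].
move=> t /andP[t0 tt].
have [_ ->] := bochner_integralD (measurable_itv _) (lebesgue_measure_oo_lty 0 t)
  (Lp_integrable_sub lv1 (lexx _) tt) (Lp_integrable_sub lv2 (lexx _) tt).
by rewrite addrACA -e1 ?t0// -e2 ?t0.
Qed.

Lemma W1p_derivativeN u v :
  W1p_derivative p tau u v ->
  W1p_derivative p tau (fun t => - u t) (fun t => - v t).
Proof.
move=> [lu lv e]; split; [exact: (LpN mD lu)|exact: (LpN mD lv)|].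
move=> t /andP[t0 tt].
have := bochner_integralZ (measurable_itv _) (lebesgue_measure_oo_lty 0 t) (-1)
  (Lp_integrable_sub lv (lexx _) tt).
rewrite of_realN of_real1 scaleN1r.
have -> : (fun s => -1 *: v s) = (fun s => - v s).
  by apply/funext => s; rewrite scaleN1r.
by move=> [_ ->]; rewrite -opprD -e ?t0.
Qed.

Lemma strongD f1 u1 f2 u2 : strong f1 u1 -> strong f2 u2 ->
  strong (fun t => f1 t + f2 t) (fun t => u1 t + u2 t).
Proof.
move=> [v1 w1 e1] [v2 w2 e2]; exists (fun t => v1 t + v2 t).
  exact: W1p_derivativeD.
apply: ae_mono (ae_and e1 e2) => t [h1 h2] tt.
have [D1 <-] := h1 tt; have [D2 <-] := h2 tt.
have [D12 ->] := DA_D T_generator D1 D2.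
by split => //; rewrite addrACA.
Qed.

Lemma strongN f u : strong f u -> strong (fun t => - f t) (fun t => - u t).
Proof.
move=> [v w e]; exists (fun t => - v t); first exact: W1p_derivativeN.
apply: ae_mono e => t h tt; have [D1 <-] := h tt.
have := DA_Z T_generator (-1) D1; rewrite of_realN of_real1 !scaleN1r => -[D2 ->].
by split => //; rewrite opprD.
Qed.

Lemma strongB f1 u1 f2 u2 : strong f1 u1 -> strong f2 u2 ->
  strong (fun t => f1 t - f2 t) (fun t => u1 t - u2 t).
Proof. by move=> h1 h2; apply: strongD => //; exact: strongN. Qed.

Lemma strong_ext f u f' u' : strong f u -> (forall t, 0 <= t <= tau -> u' t = u t) ->
  (forall t, 0 < t < tau -> f' t = f t) -> strong f' u'.
Proof.
move=> [v [lu lv e] ae] uu ff; exists v.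
  split; [|exact: lv|].
    apply: (Lp_ae mD lu); apply: ae_all => t /=; rewrite in_itv/= => /andP[t0 tt].
    by rewrite uu// !ltW.
  by move=> t tt; rewrite uu// uu ?lexx ?(ltW tau_gt0)//; exact: e.
apply: ae_mono ae => t h tt; rewrite ff//.
by have /andP[t0 t1] := tt; rewrite uu ?(ltW t0) ?(ltW t1)//; exact: h.
Qed.

Lemma strong_mild f u : LpX f -> strong f u ->
  forall t, 0 <= t <= tau -> u t = T t (u 0) + convolution T f t.
Proof.
move=> lf [v [lu lv e] ae].
exact: (mild_formula T_semigroup T_holomorphic T_generator (Lp_integrable lv)
  (Lp_integrable lf) e ae).
Qed.

Lemma convolution0 f : convolution T f 0 = 0.
Proof. by rewrite /convolution bint_nil. Qed.

Lemma convolutionD f1 f2 t : LpX f1 -> LpX f2 -> t <= tau ->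
  convolution T (fun s => f1 s + f2 s) t = convolution T f1 t + convolution T f2 t.
Proof.
move=> l1 l2 tt; rewrite /convolution.
have i1 := convolution_integrable T_semigroup T_holomorphic (lexx t)
  (Lp_integrable_sub l1 (lexx 0) tt).
have i2 := convolution_integrable T_semigroup T_holomorphic (lexx t)
  (Lp_integrable_sub l2 (lexx 0) tt).
have [_ <-] := bochner_integralD (measurable_itv _) (lebesgue_measure_oo_lty _ _) i1 i2.
by apply: eq_bochner_integral => s _; rewrite linearD.
Qed.

(** The norm of [f] may fail to be measurable, so the constant is pulled out for a measurable
    representative. *)
Lemma integral_rnormZ (a b C : R) f : 0 <= C -> bochner_integrable `]a, b[ f ->
  (\int[mu]_(s in `]a, b[) (C * rnorm (f s))%:E <=
   C%:E * \int[mu]_(s in `]a, b[) (rnorm (f s))%:E)%E.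
Proof.
move=> C0 [g [mg fg ig]].
have eqfg : (\int[mu]_(s in `]a, b[) (rnorm (f s))%:E =
    \int[mu]_(s in `]a, b[) (rnorm (g s))%:E)%E.
  apply: ge0_ae_eq_integralW => [|s _|s _|]; [exact: measurable_itv|..].
  - exact: rnorm_ge0.
  - exact: rnorm_ge0.
  by apply: ae_mono fg => s h Ds; rewrite h.
rewrite eqfg -ge0_integralZl_EFin//; try exact: measurable_itv; last 2 first.
- by move=> s _; rewrite lee_fin rnorm_ge0.
- exact: measurable_rnorm_EFin.
under [leRHS]eq_integral do rewrite -EFinM.
apply: ge0_ae_le_integral => [|s _|s _|]; [exact: measurable_itv|..].
- by rewrite mulr_ge0// rnorm_ge0.
- by rewrite mulr_ge0// rnorm_ge0.
by apply: ae_mono fg => s h Ds; rewrite h.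
Qed.

(* The right derivative of [T * f] at a common Lebesgue point of [f] and of the
   derivative [v] shows that the difference quotient of the semigroup
   converges to [v - f]. *)
Lemma convolution_strong f : LpX f -> W1p p tau (convolution T f) ->
  strong f (convolution T f).
Proof.
move=> lf [v W]; exists v => //; have [_ lv uE] := W.
set u := convolution T f in uE *.
apply: ae_mono (ae_and (bochner_lebesgue_points (Lp_integrable lf))
  (bochner_lebesgue_points (Lp_integrable lv))) => t [hf hv] tt.
have /andP[t0 t1] := tt; move: (hf tt) (hv tt) => {}hf {}hv.
suff /(generatorP T_generator)[Du AE] :
    diff_quotient T (u t) h @[h --> 0^'+] --> v t - f t.
  by split => //; rewrite AE opprB addrC subrK.
apply/cvg_rnormP/cvgr0Pnorm_lt => e e0.
have [M M1 hM] := sg_bounded T_semigroup T_holomorphic tau.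
have M0 : 0 < M by rewrite (lt_le_trans ltr01).
have e40 : 0 < e / 4 by rewrite divr_gt0.
have e4M0 : 0 < e / 4 / M by rewrite divr_gt0.
have [d1 d10 h1] := hv _ e40.
have [d2 d20 h2] := hf _ e4M0.
have [d3 d30 h3] := sg_right T_semigroup (f t) e40.
near=> h.
have h0 : 0 < h by near: h; exact: nbhs_right_gt.
have hd1 : h < d1 by near: h; exact: nbhs_right_lt.
have hd2 : h < d2 by near: h; exact: nbhs_right_lt.
have hd3 : h < d3 by near: h; exact: nbhs_right_lt.
have hdt : h < tau - t by near: h; apply: nbhs_right_lt; rewrite subr_gt0.
have tht : t + h <= tau by lra.
have tth : t <= t + h by rewrite lerDl ltW.
have th0 : 0 <= t + h by lra.
have i0 := lexx (0 : R).
(* u(t+h) is expanded twice, as u(t) + V from the derivative and as T(h) u(t) + J from the semigroup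
   law, so that T(h) u(t) - u(t) = V - J. *)
pose V := bochner_integral `]t, (t + h)%R[ v.
pose J := bochner_integral `]t, (t + h)%R[ (fun s => T (t + h - s) (f s)).
have VE : u (t + h) = u t + V.
  have u1 := uE (t + h); rewrite th0 tht in u1; rewrite (u1 isT).
  have u2 := uE t; rewrite (ltW t0) (ltW t1) in u2; rewrite (u2 isT).
  rewrite (@bint_split _ _ _ 0 t (t + h)) ?(ltW t0)//; last exact: Lp_integrable_sub.
  by rewrite addrA.
have JE : u (t + h) = T h (u t) + J.
  have tt_h : 0 <= t <= t + h by rewrite (ltW t0).
  have ith := convolution_integrable T_semigroup T_holomorphic (lexx (t + h))
    (Lp_integrable_sub lf (lexx 0) tht).
  rewrite /u /convolution (bint_split tt_h ith).
  congr (_ + _).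
  have htau : 0 <= h <= tau by apply/andP; split; lra.
  have it : bochner_integrable `]0, t[ (fun s => T (t - s) (f s)).
    apply: (convolution_integrable T_semigroup T_holomorphic) => //.
    by apply: Lp_integrable_sub => //; exact: ltW.
  have [_ <-] := bochner_integral_linear (L := T h) (measurable_itv _) (lebesgue_measure_oo_lty _ _)
    (fun x y => linearD (T h) x y) (sgZ T h) (C := M)
    (fun x => hM h x htau) it.
  apply: eq_bochner_integral => s /=; rewrite in_itv/= => /andP[s0 st].
  rewrite -(sgD T_semigroup) ?subr_ge0 ?(ltW st) ?(ltW h0)//.
  by congr (T _ _); ring.
have cvE (z : X) : bochner_integrable `]t, (t + h)%R[ (fun=> z) /\
    bochner_integral `]t, (t + h)%R[ (fun=> z) = of_real k h *: z.
  split; first exact: (bochner_integrable_cst (measurable_itv _) (lebesgue_measure_oo_lty _ _) z).1.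
  by rewrite bint_cst//; congr (of_real k _ *: _); ring.
have ivth := Lp_integrable_sub lv (ltW t0) tht.
have ifth := Lp_integrable_sub lf (ltW t0) tht.
have mth : measurable (`]t, (t + h)%R[%classic : set R) by exact: measurable_itv.
have fth := lebesgue_measure_oo_lty t (t + h).
have nV : rnorm (V - of_real k h *: v t) <= e / 4 * h.
  have [iv' <-] := cvE (v t).
  have [ivv <-] := bochner_integralB mth fth ivth iv'.
  by rewrite -lee_fin (le_trans (rnorm_bochner_integral_le mth fth ivv))// h1// h0.
have nJ : rnorm (J - of_real k h *: f t) <= e / 4 * h + e / 4 * h.
  have [ift' iftE] := cvE (f t).
  have [iff' _] := bochner_integralB mth fth ifth ift'.
  have ic1 := convolution_integrable T_semigroup T_holomorphic (lexx (t + h)) iff'.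
  have ic2 := convolution_integrable T_semigroup T_holomorphic (lexx (t + h)) ift'.
  have [ic3 ic3E] := bochner_integralB mth fth ic2 ift'.
  (* First [f] is frozen at [t], a Lebesgue point, and then T(t+h-s) is replaced by the identity on
     the fixed vector [f t]. *)
  have -> : J - of_real k h *: f t =
      bochner_integral `]t, (t + h)%R[ (fun s => T (t + h - s) (f s - f t)) +
      bochner_integral `]t, (t + h)%R[ (fun s => T (t + h - s) (f t) - f t).
    rewrite ic3E iftE addrA; congr (_ - _).
    have [_ <-] := bochner_integralD mth fth ic1 ic2.
    by apply: eq_bochner_integral => s _; rewrite -linearD subrK.
  rewrite (le_trans (rnormD _ _))// lerD//.
    rewrite -lee_fin (le_trans (rnorm_bochner_integral_le mth fth ic1))//.
    apply: (@le_trans _ _ (\int[mu]_(s in `]t, (t + h)%R[) (M * rnorm (f s - f t))%:E)%E).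
      apply: ge0_le_integralW => // s; first by move=> _; exact: rnorm_ge0.
      rewrite /= in_itv/= => /andP[ts sth]; apply: hM; apply/andP; split; lra.
    apply: (le_trans (integral_rnormZ (ltW M0) iff')).
    have -> : e / 4 * h = M * (e / 4 / M * h) by field; rewrite gt_eqF.
    by rewrite EFinM lee_wpmul2l ?lee_fin ?(ltW M0)// h2// h0.
  apply: (@le_trans _ _ (e / 4 * (t + h - t))); last by rewrite addrAC subrr add0r.
  apply: rnorm_bint_le => // s /andP[ts sth].
  by apply/ltW/h3; apply/andP; split; lra.
have -> : diff_quotient T (u t) h - (v t - f t) =
    of_real k h^-1 *: ((V - of_real k h *: v t) - (J - of_real k h *: f t)).
  rewrite /diff_quotient (_ : T h (u t) - u t = V - J); last first.
    by apply/eqP; rewrite subr_eq addrAC [V + _]addrC -VE JE addrK.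
  have -> : v t - f t = of_real k h^-1 *: (of_real k h *: v t - of_real k h *: f t).
    by rewrite -scalerBr scalerA -of_realM mulVf ?gt_eqF// of_real1 scale1r.
  rewrite -scalerBr; congr (_ *: _).
  by rewrite !opprB addrACA [RHS]addrACA; congr (_ + _); rewrite addrC.
rewrite rnormZ ger0_norm ?mulr_ge0 ?rnorm_ge0// gtr0_norm ?invr_gt0//.
rewrite mulrC ltr_pdivrMr// (le_lt_trans (rnormD _ _))// rnormN.
have : 0 < e * h by rewrite mulr_gt0.
lra.
Unshelve. all: by end_near. Qed.

(** The forcing is v + A w. Graph-norm approximants of [w] take values in D(A), so applying [A] to
    them gives simple functions converging to A w. *)
Lemma MR_strong w : MR_space p tau DA A w -> exists2 f, LpX f & strong f w.
Proof.
move=> [[v W] [[s_ [ss hs]] iw]]; have [lw lv wE] := W.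
have lA : LpX (fun t => A (w t)).
  split.
    exists (fun n => A \o s_ n); split.
      by move=> n; split=> //; exact: simple_map_comp (ss n).1.
    apply: ae_mono hs => t h Dt; split => //; have [Dw hw] := h Dt.
    apply: (squeeze_cvgr _ (cvg_cst 0) hw); apply: nearW => n.
    rewrite rnorm_ge0/= /graph_norm.
    have Ds : DA (s_ n t) by apply: (ss n).2; exists t.
    by have [_ ->] := DA_B T_generator Dw Ds; rewrite lerDr rnorm_ge0.
  apply: le_lt_trans iw; apply: ge0_le_integralW => // t _; first exact: powR_ge0.
  rewrite ge0_ler_powR ?nnegrE ?(le_trans _ (ltW p_gt1)) ?addr_ge0 ?rnorm_ge0//.
  by rewrite /graph_norm lerDr rnorm_ge0.
exists (fun t => v t + A (w t)); first exact: (LpD p_gt1 mD lv lA).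
exists v => //; apply: ae_mono hs => t h tt.
by split => //; apply: (h _).1; rewrite /= in_itv.
Qed.

(* In the graph norm, [u t] is a limit of the vectors [T(1/m) x_i], where the
   [x_i] are dense in the range of [u]; nearest points among them give simple
   functions with values in the domain. *)
Lemma strong_MR f u : LpX f -> strong f u -> MR_space p tau DA A u.
Proof.
move=> lf [v W ae]; split; first by exists v.
have [lu lv _] := W; have lk := LpB p_gt1 mD lf lv.
have [gu [mgu ugu iu]] := (Lp_inP p u mD).1 lu.
have [gk [mgk kgk ik]] := (Lp_inP p (fun t => f t - v t) mD).1 lk.
have [N [mN N0 hN]] := ae_and ae (ae_and ugu kgk).
pose E := (`]0, tau[%classic : set R) `\` N.
have mE : measurable E by exact: measurableD.
have goodE t : E t -> [/\ DA (u t), u t = gu t & A (u t) = gk t].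
  move=> [Dt Nt]; have : ~ ~ ((0 < t < tau -> DA (u t) /\ v t + A (u t) = f t) /\
      (`]0, tau[%classic t -> u t = gu t) /\ (`]0, tau[%classic t -> f t - v t = gk t)).
    by move=> nP; apply: Nt; apply: hN.
  move=> /contrapT[h1 [h2 h3]].
  have tt : 0 < t < tau by move: Dt; rewrite /= in_itv.
  have [Du hA] := h1 tt; split => //; first exact: h2.
  by rewrite -h3// -hA addrC addKr.
(* Off the good set both representatives are set to 0, an element of D(A), so that [g] is
   D(A)-valued everywhere with measurable image [kk] under [A]. *)
pose g t := if t \in E then gu t else 0.
pose kk t := if t \in E then gk t else 0.
have m0 : smeasurable (fun=> 0 : X) by exact: smeasurable_cst.
have mg : smeasurable g by exact: smeasurable_if.
have mk : smeasurable kk by exact: smeasurable_if.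
have gD t : DA (g t) /\ A (g t) = kk t.
  rewrite /g /kk; case: ifPn => [/[!inE] /goodE[Du <- <-]//|_].
  exact: (DA_0 T_generator).
have [x_ hx] := smeasurable_near_range mg.
pose y_ j := let: (i, m) := odflt (0%N, 0%N) (unpickle j) in T (m.+1%:R^-1) (x_ i).
have yD j : DA (y_ j).
  rewrite /y_; case: (odflt _ _) => i m.
  have m0' : 0 < m.+1%:R^-1 :> R by rewrite invr_gt0.
  by have [C hC] := sg_DA T_semigroup T_holomorphic T_generator m0'; exact: (hC _).1.
pose d j t := rnorm (g t - y_ j) + rnorm (kk t - A (y_ j)).
have dE j t : d j t = graph_norm A (g t - y_ j).
  by rewrite /graph_norm (DA_B T_generator (gD t).1 (yD j)).2 (gD t).2.
have [||t e e0|q [sq hq]] := @nearest_index R d.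
- by move=> j; apply: measurable_funD; exact: smeasurable_dist.
- by move=> j t; rewrite addr_ge0 ?rnorm_ge0.
- have e40 : 0 < e / 4 by rewrite divr_gt0.
  have [d1 d10 h1] := sg_right T_semigroup (g t) e40.
  have [d2 d20 h2] := sg_right T_semigroup (kk t) e40.
  have m0' : 0 < Num.min d1 d2 by rewrite lt_min d10.
  have [m hm] : exists m : nat, m.+1%:R^-1 < Num.min d1 d2.
    exists (Num.truncn (Num.min d1 d2)^-1).
    by rewrite invf_plt ?posrE// truncnS_gt.
  set r := m.+1%:R^-1 in hm.
  have r0 : 0 < r by rewrite /r invr_gt0.
  have [C hC] := sg_DA T_semigroup T_holomorphic T_generator r0.
  have [M _ hM] := sg_bounded T_semigroup T_holomorphic r.
  have B0 : 0 < `|M| + `|C| + 1 by rewrite ltr_wpDl ?addr_ge0.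
  (* [i] is chosen after [m], because the bound [C] of A T(r) depends on r. Moving [g t] and [kk t]
     by T(r) costs e/4 each, and replacing [g t] by [x_ i] less than another e/4. *)
  have [i hi] := hx t _ (divr_gt0 e40 B0).
  exists (pickle (i, m)).
  have yE : y_ (pickle (i, m)) = T r (x_ i) by rewrite /y_ pickleK.
  move: hm; rewrite lt_min => /andP[r1 r2].
  have n1 := h1 r; rewrite (ltW r0) r1 in n1; move: (n1 isT) => {}n1.
  have n2 := h2 r; rewrite (ltW r0) r2 in n2; move: (n2 isT) => {}n2.
  have nMC : (`|M| + `|C| + 1) * rnorm (g t - x_ i) < e / 4.
    by rewrite mulrC -ltr_pdivlMr.
  have n3 : rnorm (T r (g t - x_ i)) <= `|M| * rnorm (g t - x_ i).
    rewrite (le_trans (hM _ _ _)) ?lexx ?(ltW r0)//.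
    by rewrite ler_wpM2r ?rnorm_ge0// ler_norm.
  have n4 : rnorm (A (T r (g t - x_ i))) <= `|C| * rnorm (g t - x_ i).
    by rewrite (le_trans (hC _).2)// ler_wpM2r ?rnorm_ge0// ler_norm.
  have AT : A (T r (g t - x_ i)) = T r (kk t) - A (T r (x_ i)).
    have [D1 A1] := DA_sg T_semigroup T_generator (ltW r0) (gD t).1.
    by rewrite linearB (DA_B T_generator D1 (hC _).1).2 A1 (gD t).2.
  have e1 : rnorm (g t - T r (x_ i)) <= e / 4 + rnorm (T r (g t - x_ i)).
    rewrite (le_trans (rnorm_triangle (T r (g t)) _ _))// linearB lerD2r.
    by rewrite rnormB ltW.
  have e2 : rnorm (kk t - A (T r (x_ i))) <= e / 4 + rnorm (A (T r (g t - x_ i))).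
    rewrite (le_trans (rnorm_triangle (T r (kk t)) _ _))// AT lerD2r.
    by rewrite rnormB ltW.
  rewrite /d yE; have := rnorm_ge0 (g t - x_ i); lra.
have aeE : {ae mu, forall t, `]0, tau[%classic t -> E t}.
  exists N; split => // t /= nt; apply: contrapT => Nt; apply: nt => Dt.
  by split.
split.
  exists (fun n => y_ \o q n); split.
    by move=> n; split=> [|_ [t _ <-]]; [exact: simple_map_comp|exact: yD].
  apply: ae_mono aeE => t h Dt; have [Du ugt _] := goodE _ (h Dt); split => //.
  have -> : u t = g t by rewrite /g mem_set ?ugt//; exact: h.
  move: (hq t); apply: cvg_trans; apply: near_eq_cvg; apply: nearW => n /=.
  by rewrite dE.
apply: le_lt_trans (integral_powR_add_lty p_gt1 mD mgu mgk iu ik).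
apply: ge0_ae_le_integral => // [t _|t _|]; [exact: powR_ge0|exact: powR_ge0|].
apply: ae_mono aeE => t h Dt; have [Du ugt Aut] := goodE _ (h Dt).
by rewrite /graph_norm Aut ugt.
Qed.

(** The working description of the trace space: it trades the graph-norm condition for an equation
    with L^p forcing. *)
Lemma trace_spaceP (x : X) : trace_space p tau DA A x <->
  exists f u, [/\ LpX f, strong f u & u 0 = x].
Proof.
split=> [[w /MR_strong[f lf sw] wx]|[f [u [lf su ux]]]]; first by exists f, w.
by exists u; [exact: strong_MR su|].
Qed.

(** The constant function [z] solves the equation with constant forcing [A z]. *)
Lemma DA_trace (z : X) : DA z -> trace_space p tau DA A z.
Proof.
move=> Dz; apply/trace_spaceP; exists (fun=> A z), (fun=> z).
have lc (x : X) : LpX (fun=> x).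
  apply: (@Lp_bounded _ _ _ _ p_gt1 _ _ (rnorm x)) => //.
  by exists (fun=> x); [exact: smeasurable_cst|exact: ae_all].
split; [exact: lc| |by []]; exists (fun=> 0); last by apply: ae_all => t _; rewrite add0r.
split; [exact: lc|exact: lc|move=> t /andP[t0 _]].
by rewrite bint_cst// scaler0 addr0.
Qed.

Lemma trace_spaceB (x y : X) : trace_space p tau DA A x -> trace_space p tau DA A y ->
  trace_space p tau DA A (x - y).
Proof.
move=> /trace_spaceP[f [u [lf su <-]]] /trace_spaceP[g [w [lg sw <-]]].
apply/trace_spaceP; exists (fun t => f t - g t), (fun t => u t - w t).
split; [exact: (LpB p_gt1 mD lf lg)|exact: strongB|by []].
Qed.

Lemma trace_spaceD (x y : X) : trace_space p tau DA A x -> trace_space p tau DA A y ->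
  trace_space p tau DA A (x + y).
Proof.
move=> /trace_spaceP[f [u [lf su <-]]] /trace_spaceP[g [w [lg sw <-]]].
apply/trace_spaceP; exists (fun t => f t + g t), (fun t => u t + w t).
split; [exact: (LpD p_gt1 mD lf lg)|exact: strongD|by []].
Qed.

Lemma Lp_reflect f : LpX f -> LpX (fun t => f (tau - t)).
Proof.
move=> lf; have := Lp_preserving (measurable_reflect tau)
  (@lebesgue_measure_reflect _ tau) mD lf.
congr (Lp_in _ _ _ _ _).
by apply/seteqP; split=> t /=; rewrite !in_itv/= => /andP[? ?]; apply/andP; split; lra.
Qed.

(** The reversed function has derivative -v(tau-t), so its forcing is -v + A u = f - 2v at time
    tau-t. *)
Lemma strong_reflect f u : LpX f -> strong f u ->
  exists2 f', LpX f' & strong f' (fun t => u (tau - t)).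
Proof.
move=> lf [v [lu lv uE] ae].
have lv' := Lp_reflect lv.
exists (fun t => f (tau - t) - v (tau - t) - v (tau - t)).
  exact: (LpB p_gt1 mD (LpB p_gt1 mD (Lp_reflect lf) lv') lv').
exists (fun t => - v (tau - t)).
  split; [exact: (Lp_reflect lu)|exact: (LpN mD lv')|move=> t /andP[t0 tt]].
  have st0 : 0 <= tau - t by rewrite subr_ge0.
  have stt : tau - t <= tau by rewrite lerBlDr lerDl.
  have u1 := uE tau; rewrite (ltW tau_gt0) lexx in u1.
  have u2 := uE (tau - t); rewrite st0 stt in u2.
  rewrite /= subr0 (u2 isT) (u1 isT).
  have st : 0 <= tau - t <= tau by rewrite st0.
  rewrite (bint_split st (Lp_integrable lv)).
  rewrite -!addrA; congr (_ + _); rewrite -[LHS]addr0; congr (_ + _).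
  have iv := Lp_integrable_sub lv st0 (lexx tau).
  have [ir] := bint_reflect tau iv; rewrite subrr subKr => <-.
  rewrite subrr subKr in ir.
  have := bochner_integralZ (measurable_itv _) (lebesgue_measure_oo_lty 0 t) (-1) ir.
  rewrite of_realN of_real1 scaleN1r.
  have -> : (fun s => -1 *: v (tau - s)) = (fun s => - v (tau - s)).
    by apply/funext => s; rewrite scaleN1r.
  by move=> [_ ->]; rewrite subrr.
have := ae_preserving (measurable_reflect tau) (@lebesgue_measure_reflect _ tau) ae.
apply: ae_mono => t h tt.
have stt : 0 < tau - t < tau by move: tt => /andP[? ?]; apply/andP; split; lra.
have [Du <-] := h stt; split => //.
by rewrite [v _ + A _]addrC addrK addrC.
Qed.

Lemma DA_T (t : R) (x : X) : 0 < t -> DA (T t x).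
Proof.
by move=> /(sg_DA T_semigroup T_holomorphic T_generator)[C hC]; exact: (hC x).1.
Qed.

(** For f(s) = T(s) y / tau the integrand T(tau-s) f(s) is constant in s. *)
Lemma sg_convolution (y : X) : exists2 f, LpX f & convolution T f tau = T tau y.
Proof.
pose f s := of_real k tau^-1 *: sgp T s y.
exists f.
  have [M M1 hM] := sg_bounded T_semigroup T_holomorphic tau.
  apply: (@Lp_bounded _ _ _ _ p_gt1 _ _ (`|tau^-1| * (M * rnorm y))) => //.
    exists f; last exact: ae_all.
    apply: smeasurableZ; apply: continuous_smeasurable.
    exact: sgp_continuous.
  move=> s /=; rewrite in_itv/= => /andP[s0 st].
  rewrite rnormZ ler_wpM2l// sgpE ?(ltW s0)//.
  by apply: hM; rewrite (ltW s0) ltW.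
rewrite /convolution.
rewrite (@eq_bochner_integral _ _ _ _ _ (fun=> of_real k tau^-1 *: T tau y)).
  rewrite bint_cst ?(ltW tau_gt0)// subr0 scalerA -of_realM mulfV ?gt_eqF//.
  by rewrite of_real1 scale1r.
move=> s /=; rewrite in_itv/= => /andP[s0 st].
rewrite /f sgZ sgpE ?(ltW s0)// -(sgD T_semigroup) ?subr_ge0 ?(ltW st) ?(ltW s0)//.
by rewrite subrK.
Qed.

End StrongSolutions.

(** * The problem with boundary condition *)

Section BoundaryProblem.
Variables (R : realType) (k : scalar_kind).
Variable X : completeNormedModType (scalar_field R k).
Local Notation mu := (@lebesgue_measure R).
Variables (T : R -> {linear X -> X}) (DA : set X) (A : X -> X) (p tau : R).
Variable Phi : {linear X -> X}.
Hypotheses (T_semigroup : C0_semigroup T)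
  (T_holomorphic : holomorphic_semigroup (fun t => T t : X -> X))
  (T_generator : is_generator T DA (fun x => - A x))
  (tau_gt0 : 0 < tau) (p_gt1 : 1 < p).
Implicit Types (f g u v w : R -> X) (x y z : X).

Local Notation strong := (strong_solution p tau DA A).
Local Notation LpX := (@Lp R k X p tau).
Local Notation tr := (trace_space p tau DA A).
Local Notation conv := (convolution T).

Let mD : measurable (`]0, tau[%classic : set R). Proof. exact: measurable_itv. Qed.

Let mild f u (lf : LpX f) (su : strong f u) :
  forall t, 0 <= t <= tau -> u t = T t (u 0) + conv f t :=
  strong_mild T_semigroup T_holomorphic T_generator p_gt1 lf su.

Let trP x : tr x <-> exists f u, [/\ LpX f, strong f u & u 0 = x] :=
  trace_spaceP tau T_semigroup T_holomorphic T_generator p_gt1 x.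

Variable B : X -> X.
Hypotheses (FB : forall y, B y - Phi (T tau (B y)) = y)
  (Finj : forall x y, x - Phi (T tau x) = y - Phi (T tau y) -> x = y).

Lemma trace_strong f u : LpX f -> strong f u -> tr (u 0).
Proof.
move=> lf su.
apply/trP.
by exists f, u; split; [exact: lf|exact: su|].
Qed.

Lemma trace_strong_end f u : LpX f -> strong f u -> tr (u tau).
Proof.
move=> lf su; have [f' lf' sf'] := strong_reflect tau_gt0 p_gt1 lf su.
by have := trace_strong lf' sf'; rewrite subr0.
Qed.

(** * From maximal regularity of A to the boundary problem *)

Section FromMaximalRegularity.
Hypotheses (MR : maximal_regularity p tau T)
  (Phi_tr : forall x, tr x -> tr (Phi x)) (B_tr : forall x, tr x -> tr (B x)).

Let conv_strong f (lf : LpX f) : strong f (conv f) :=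
  convolution_strong T_semigroup T_holomorphic T_generator p_gt1 lf (MR lf).

Lemma problem_of_maximal_regularity : problem_maximal_regularity p tau DA A Phi.
Proof.
move=> f lf.
have tau0 : 0 <= tau <= tau by rewrite (ltW tau_gt0) lexx.
have t00 : 0 <= (0 : R) <= tau by rewrite lexx ltW.
have sf := conv_strong lf.
have x0tr : tr (B (Phi (conv f tau))).
  by apply/B_tr/Phi_tr; exact: trace_strong_end lf sf.
(* By [FB], x0 = Phi (T(tau) x0 + (T * f)(tau)), which is the boundary condition for [u] below. *)
set x0 := B _ in x0tr.
have [f1 [w [lf1 sw w0]]] :=
  (trP x0).1 x0tr.
pose u t := T t x0 + conv f t.
(* The orbit of [x0] is w - T * f1, a solution with zero forcing; adding T * f gives forcing [f]. *)
have su : strong f u.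
  apply: (strong_ext tau_gt0 (strongD T_generator p_gt1
    (strongB T_generator p_gt1 sw (conv_strong lf1)) sf)) => t tt.
    by rewrite (mild lf1 sw tt) w0 addrK.
  by rewrite subrr add0r.
have u0 : u 0 = x0 by rewrite /u (sg0 T_semigroup) convolution0 addr0.
exists u; split; first exact: su.
  rewrite u0 /u linearD; have := FB (Phi (conv f tau)); rewrite -/x0 => h.
  by rewrite -[in X in _ = _ + X]h addrC subrK.
(* By the mild formula only the initial values can differ, and both solve the same equation for I -
   Phi T(tau). *)
move=> u' su' u'0 t tt; rewrite (mild lf su' tt) /u; congr (T t _ + _).
apply: Finj; rewrite {1}u'0 (mild lf su' tau0) linearD addrC addKr.
by rewrite FB.
Qed.

End FromMaximalRegularity.

(** * From the boundary problem to maximal regularity and invariance *)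

Section FromProblem.
Hypothesis P : problem_maximal_regularity p tau DA A Phi.

(** Inserting the mild formula at tau into u(0) = Phi u(tau) identifies the vector as the initial
    value of the solution. *)
Lemma B_Phi_convolution f : LpX f -> tr (B (Phi (conv f tau))).
Proof.
move=> lf; have [u [su u0 _]] := P lf.
have tau0 : 0 <= tau <= tau by rewrite (ltW tau_gt0) lexx.
have -> : B (Phi (conv f tau)) = u 0; last exact: trace_strong lf su.
apply: Finj; rewrite FB {1}u0 (mild lf su tau0) linearD addrC.
by rewrite addKr.
Qed.

(** The reversed solution ends at [x], so x = T(tau) w(tau) + (T * f')(tau) with the reversed
    forcing [f']; [sg_convolution] absorbs the orbit term. *)
Lemma trace_convolution x : tr x -> exists2 f, LpX f & conv f tau = x.
Proof.
move=> /trP[f [w [lf sw <-]]].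
have tau0 : 0 <= tau <= tau by rewrite (ltW tau_gt0) lexx.
have [f' lf' sf'] := strong_reflect tau_gt0 p_gt1 lf sw.
have [g lg gE] := sg_convolution T_semigroup T_holomorphic tau_gt0 p_gt1 (w tau).
exists (fun t => g t + f' t); first exact: (LpD p_gt1 mD lg lf').
rewrite (convolutionD T_semigroup T_holomorphic p_gt1 lg lf' (lexx tau)) gE.
by have := mild lf' sf' tau0; rewrite subrr subr0 => ->.
Qed.

Lemma B_Phi_trace x : tr x -> tr (B (Phi x)).
Proof. by move=> /trace_convolution[f lf <-]; exact: B_Phi_convolution. Qed.

Lemma trace_T_tau x : tr (T tau x).
Proof.
apply: (DA_trace tau T_semigroup T_holomorphic T_generator p_gt1).
exact: (DA_T T_semigroup T_holomorphic T_generator).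
Qed.

(** Applying I - Phi T(tau) to either side gives [x]. *)
Lemma B_resolvent x : B x = x + B (Phi (T tau x)).
Proof.
apply: Finj; rewrite FB linearD linearD opprD addrACA FB.
by rewrite subrK.
Qed.

Lemma B_trace x : tr x -> tr (B x).
Proof.
move=> xtr; rewrite B_resolvent.
apply: (trace_spaceD T_semigroup T_holomorphic T_generator p_gt1); first exact: xtr.
exact/B_Phi_trace/trace_T_tau.
Qed.

Lemma Phi_T_trace z : tr (Phi (T tau z)).
Proof.
pose z' := z - Phi (T tau z).
have zE : z = B z' by apply: Finj; rewrite FB.
(* Adding [z'] to either side gives [z]: on the left by the choice of [z'], on the right by
   [B_resolvent] and z = B z'. *)
have -> : Phi (T tau z) = B (Phi (T tau z')).
  apply: (addrI z'); rewrite -B_resolvent -zE /z' subrK //.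
exact/B_Phi_trace/trace_T_tau.
Qed.

Lemma Phi_trace x : tr x -> tr (Phi x).
Proof.
move=> xtr; rewrite -(FB (Phi x)).
apply: (trace_spaceB T_semigroup T_holomorphic T_generator p_gt1).
  exact: B_Phi_trace.
exact: Phi_T_trace.
Qed.

(** The midpoint, so that translation by [c] carries [0, c] exactly onto [c, tau]. *)
Let c := tau / 2.

Let c0 : 0 < c. Proof. by rewrite divr_gt0. Qed.

Let ctau : c < tau. Proof. by rewrite /c; have := tau_gt0; lra. Qed.

Let tauc : tau = c + c. Proof. by rewrite /c; lra. Qed.

Let mDc : measurable (`]c, tau[%classic : set R). Proof. exact: measurable_itv. Qed.

Let finc (a b : R) := lebesgue_measure_oo_lty a b.

Lemma Lp_sgp (a d : R) x : 0 <= d -> d <= a ->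
  Lp_in setT (@rnorm R k X) p `]a, tau[ (fun t => sgp T (t - d) x).
Proof.
move=> d0 da; have [M M1 hM] := sg_bounded T_semigroup T_holomorphic tau.
apply: (@Lp_bounded _ _ _ _ p_gt1 _ _ (M * rnorm x)).
- exact: measurable_itv.
- exact: finc.
- exists (fun t => sgp T (t - d) x); last exact: ae_all.
  apply: continuous_smeasurable => t.
  apply: (@continuous_comp _ _ _ (fun s => s - d) (fun r => sgp T r x)).
    by apply: cvgB; [exact: cvg_id|exact: cvg_cst].
  exact: sgp_continuous.
move=> t /=; rewrite in_itv/= => /andP[at_ tt].
rewrite sgpE; last lra.
by apply: hM; apply/andP; split; lra.
Qed.

(* Away from [t = 0], [T * f] is the difference of the solution of the problem
   and of an orbit, which is smooth there. *)
Lemma convolution_second_half f : LpX f -> LpX (conv f) /\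
  exists2 v, Lp_in setT (@rnorm R k X) p `]c, tau[ v &
    forall t, c <= t <= tau -> conv f t = conv f c + bochner_integral `]c, t[ v.
Proof.
move=> lf; have [u [su _ _]] := P lf.
have convE t : 0 <= t <= tau -> conv f t = u t - T t (u 0).
  by move=> tt; rewrite (mild lf su tt) addrC addKr.
have [v0 [lu lv uE] _] := su.
split.
  have l1 := Lp_sgp (u 0) (lexx 0) (lexx 0).
  have := LpB p_gt1 mD lu l1; move/Lp_ae; apply=> //.
  apply: ae_all => t /=; rewrite in_itv/= => /andP[t0 tt].
  by rewrite convE ?(ltW t0) ?(ltW tt)// subr0 sgpE// ltW.
have Dy : DA (T c (u 0)) by exact: (DA_T T_semigroup T_holomorphic T_generator).
set y := T c (u 0) in Dy.
have lv' : Lp_in setT (@rnorm R k X) p `]c, tau[ v0.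
  by apply: Lp_subset lv => //; apply: subitvoo => //; exact: ltW.
(* On [c, tau] the orbit of u(0) has derivative -T(t-c) A T(c) u(0), which is bounded; its sign
   flips because the orbit is subtracted. *)
have l2 := Lp_sgp (A y) (ltW c0) (lexx c).
exists (fun t => v0 t + sgp T (t - c) (A y)); first exact: (LpD p_gt1 mDc lv' l2).
move=> t /andP[ct tt].
have t0 : 0 <= t by exact: le_trans (ltW c0) ct.
have i1 := Lp_integrable_sub p_gt1 lv (ltW c0) tt.
have i2 : bochner_integrable `]c, t[ (fun s => sgp T (s - c) (A y)).
  have := Lp_bochner_integrable p_gt1 mDc (finc c tau) l2.
  by apply: bochner_integrable_sub.
have [_ ->] := bochner_integralD (measurable_itv _) (finc c t) i1 i2.
have u1 := uE t; rewrite t0 tt in u1.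
have u2 := uE c; rewrite (ltW c0) (ltW ctau) in u2.
have VE : u t - u c = bochner_integral `]c, t[ v0.
  rewrite (u1 isT) (u2 isT) (@bint_split _ _ _ 0 c t) ?(ltW c0) ?ct//.
    by rewrite opprD addrACA subrr add0r addrAC subrr add0r.
  exact: (Lp_integrable_sub p_gt1 lv (lexx 0) tt).
have TE : y - T t (u 0) = bochner_integral `]c, t[ (fun s => sgp T (s - c) (A y)).
  have tc0 : 0 <= (0 : R) <= t - c by rewrite lexx subr_ge0.
  have := sg_FTC T_semigroup T_holomorphic T_generator Dy tc0.
  rewrite (sg0 T_semigroup) /y -(sgD T_semigroup) ?subr_ge0 ?(ltW c0)// subrK -/y => h.
  have i0 := sg_orbit_integrable T_semigroup T_holomorphic (t - c) (A y) (lexx 0).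
  rewrite -opprB h opprK -(bint_shift (- c) i0).2.
  rewrite opprK add0r subrK; apply: eq_bochner_integral => s /=.
  by rewrite in_itv/= => /andP[cs st]; rewrite sgpE// subr_ge0 ltW.
rewrite !convE ?t0 ?(ltW c0) ?(ltW ctau)// -VE -TE -/y.
rewrite addrACA [u c + _]addrC subrK; congr (_ + _).
by rewrite addrA addNr add0r.
Qed.

Let ae_halves : {ae mu, forall s, `]0, tau[%classic s ->
  `]0, c[%classic s \/ `]c, tau[%classic s}.
Proof.
exists [set c]; split; [exact: measurable_set1|exact: lebesgue_measure_set1|].
move=> s /= ns; apply: contrapT => sc; apply: ns; rewrite !in_itv/= => /andP[s0 st].
by have [sc'|cs'|//] := ltgtP s c; [left|right]; rewrite ?s0 ?st.
Qed.

Lemma Lp_shift f : LpX f -> LpX (fun s => if s < c then 0 else f (s - c)).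
Proof.
move=> lf.
have m0c : measurable (`]0, c[%classic : set R) by exact: measurable_itv.
apply: (Lp_glue p_gt1 mD m0c mDc (f1 := fun=> 0) (f2 := fun s => f (s - c))).
- apply: (Lp_bounded p_gt1 m0c (finc 0 c) (C := 0)).
    by exists (fun=> 0); [exact: smeasurable_cst|exact: ae_all].
  by move=> t _; rewrite rnorm0.
- have mpre : measurable ((fun t : R => t - c) @^-1` `]0, tau[).
    by rewrite -[_ @^-1` _]setTI; exact: (@measurable_shift _ (- c)).
  apply: (Lp_subset mDc mpre); last first.
    exact: (Lp_preserving (measurable_shift (- c)) (@lebesgue_measure_shift _ (- c)) mD lf).
  move=> s /=; rewrite !in_itv/= => /andP[cs st]; have := c0.
  by move=> ?; apply/andP; split; lra.
- by move=> s /=; rewrite in_itv/= => /andP[_ ->].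
- by move=> s /=; rewrite in_itv/= => /andP[cs _]; rewrite ltNge (ltW cs).
exact: ae_halves.
Qed.

(** Delaying the forcing delays the convolution, so the behaviour on [0, c] is seen on [c, tau],
    where [convolution_second_half] applies. *)
Lemma convolution_shift f t : LpX f -> 0 <= t <= c ->
  conv (fun s => if s < c then 0 else f (s - c)) (t + c) = conv f t.
Proof.
move=> lf /andP[t0 tc]; set g := fun s => _.
have lg : LpX g := Lp_shift lf.
have tct : t + c <= tau by rewrite tauc lerD2r.
have ig : bochner_integrable `]0, (t + c)%R[ (fun s => T (t + c - s) (g s)).
  apply: (convolution_integrable T_semigroup T_holomorphic) => //.
  exact: (Lp_integrable_sub p_gt1 lg (lexx 0) tct).
rewrite /convolution (@bint_split _ _ _ 0 c (t + c)) ?(ltW c0) ?lerDr//.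
rewrite (@eq_bochner_integral _ _ _ `]0, c[ _ (fun=> 0)); last first.
  by move=> s /=; rewrite in_itv/= => /andP[_ sc]; rewrite /g sc linear0.
rewrite bint_cst ?(ltW c0)// scaler0 add0r.
have iF : bochner_integrable `]0, t[ (fun s => T (t - s) (f s)).
  apply: (convolution_integrable T_semigroup T_holomorphic) => //.
  exact: (Lp_integrable_sub p_gt1 lf (lexx 0) (le_trans tc (ltW ctau))).
rewrite -(bint_shift (- c) iF).2 opprK add0r.
apply: eq_bochner_integral => s /=; rewrite in_itv/= => /andP[cs _].
by rewrite /g ltNge (ltW cs)/=; congr (T _ _); ring.
Qed.

Lemma maximal_regularity_of_problem : maximal_regularity p tau T.
Proof.
move=> f lf; have [lconv [v1 lv1 e1]] := convolution_second_half lf.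
have lg := Lp_shift lf; set g := (fun s => _) in lg.
have [_ [v2 lv2 e2]] := convolution_second_half lg.
have e2' t : 0 <= t <= c -> conv f t = bochner_integral `]0, t[ (fun s => v2 (s + c)).
  move=> /andP[t0 tc]; have tct : t + c <= tau by rewrite tauc lerD2r.
  rewrite -(convolution_shift lf) ?t0// -/g e2 ?lerDr ?t0//.
  (* No constant of integration appears, since the delayed convolution at [c] is the original one at
     0. *)
  have -> : conv g c = 0.
    have := @convolution_shift f 0 lf; rewrite lexx (ltW c0) add0r => /(_ isT) ->.
    exact: convolution0.
  have i2 : bochner_integrable `]c, (t + c)%R[ v2.
    have := Lp_bochner_integrable p_gt1 mDc (finc c tau) lv2.
    exact: bochner_integrable_sub.
  by rewrite add0r -(bint_shift c i2).2 subrr addrK.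
pose v t := if t < c then v2 (t + c) else v1 t.
have m0c : measurable (`]0, c[%classic : set R) by exact: measurable_itv.
have lv : LpX v.
  apply: (Lp_glue p_gt1 mD m0c mDc (f1 := fun s => v2 (s + c)) (f2 := v1)).
  - have mpre : measurable ((fun t : R => t + c) @^-1` `]c, tau[).
      by rewrite -[_ @^-1` _]setTI; exact: (@measurable_shift _ c).
    apply: (Lp_subset m0c mpre); last first.
      exact: (Lp_preserving (measurable_shift c) (@lebesgue_measure_shift _ c) mDc lv2).
    move=> s /=; rewrite !in_itv/= => /andP[s0 sc].
    by rewrite ltrDr s0/= [ltRHS]tauc ltrD2r.
  - exact: lv1.
  - by move=> s /=; rewrite in_itv/= => /andP[_ sc]; rewrite /v sc.
  - by move=> s /=; rewrite in_itv/= => /andP[cs _]; rewrite /v ltNge (ltW cs).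
  exact: ae_halves.
exists v; split; [exact: lconv|exact: lv|].
move=> t /andP[t0 tt]; rewrite convolution0 add0r.
have vlow s : s <= c -> bochner_integral `]0, s[ v = bochner_integral `]0, s[ (fun s => v2 (s + c)).
  move=> sc; apply: eq_bochner_integral => r /=; rewrite in_itv/= => /andP[_ rs].
  by rewrite /v (lt_le_trans rs sc).
have [tc|ct] := leP t c; first by rewrite e2' ?t0// vlow.
rewrite (@bint_split _ _ _ 0 c t) ?(ltW c0) ?(ltW ct)//; last first.
  exact: (Lp_integrable_sub p_gt1 lv (lexx 0) tt).
rewrite vlow// -e2' ?(ltW c0) ?lexx// e1 ?(ltW ct)//; congr (_ + _).
apply: eq_bochner_integral => r /=; rewrite in_itv/= => /andP[cr _].
by rewrite /v ltNge (ltW cr).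
Qed.

End FromProblem.
End BoundaryProblem.

Theorem theorem2p11 (R : realType) (k : scalar_kind)
  (X : completeNormedModType (scalar_field R k))
  (T : R -> {linear X -> X}) (DA : set X) (A : X -> X)
  (tau p : R) (Phi : {linear X -> X})
  (T_semigroup : C0_semigroup T)
  (T_holomorphic : holomorphic_semigroup (fun t => T t : X -> X))
  (T_generator : is_generator T DA (fun x => - A x))
  (tau_gt0 : 0 < tau) (p_gt1 : 1 < p)
  (bij : bijective (fun x : X => x - Phi (T tau x))) :
  problem_maximal_regularity p tau DA A Phi <->
  [/\ maximal_regularity p tau T,
      Phi @` trace_space p tau DA A `<=` trace_space p tau DA A &
      'pinv_(fun=> 0) [set: X] (fun x : X => x - Phi (T tau x))
        @` trace_space p tau DA A `<=` trace_space p tau DA A].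
Proof.
set F := fun x : X => x - Phi (T tau x) in bij *.
pose B := 'pinv_(fun=> 0) [set: X] F.
have Finj x y : F x = F y -> x = y by have [g gK _] := bij; exact: (can_inj gK).
(* By surjectivity every [y] lies in the image of [F], where ['pinv_] is a right inverse and its
   default is not reached. *)
have FB y : F (B y) = y.
  have [g _ gK] := bij; apply: (@pinvK _ _ (fun=> 0) [set: X] F).
  by rewrite inE; exists (g y).
split=> [P|[MR PhiS BS]].
  have Phi_tr := Phi_trace T_semigroup T_holomorphic T_generator tau_gt0 p_gt1 FB Finj P.
  have B_tr := B_trace T_semigroup T_holomorphic T_generator tau_gt0 p_gt1 FB Finj P.
  split; first exact: (maximal_regularity_of_problem T_semigroup T_holomorphic
    T_generator tau_gt0 p_gt1 P).
  - by move=> _ [x xtr <-]; exact: Phi_tr.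
  - by move=> _ [x xtr <-]; exact: B_tr.
apply: (problem_of_maximal_regularity T_semigroup T_holomorphic T_generator
  tau_gt0 p_gt1 FB Finj MR) => x xtr.
- by apply: PhiS; exists x.
- by apply: BS; exists x.
Qed.
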